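(* \textsc{Unweighted Vertex Integrity} can be solved in time $2^{O(\mathrm{ml}(G))} n^{O(1)}$, where $n$ is the number of vertices of the input graph $G$.
   Context: Graphs are finite, simple and undirected. The max-leaf number $\mathrm{ml}(G)$ of a connected graph $G$ is the maximum number of leaves of a spanning tree of $G$. The vertex integrity of $G$ is $\mathrm{vi}(G) = \min_{S \subseteq V(G)} \{ |S| + \max_{D} |D| \}$, where the maximum ranges over the vertex sets $D$ of the connected components of $G - S$. \textsc{Unweighted Vertex Integrity}: given a graph $G$ and an integer $k$, decide whether $\mathrm{vi}(G) \le k$. *)

(* Defs.v *)
From mathcomp Require Import all_boot.
Set Implicit Arguments. Unset Strict Implicit. Unset Printing Implicit Defensive.

Definition simple_graph n (E : {set {set 'I_n}}) : Prop :=
  forall e, e \in E -> #|e| = 2.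

Definition adj n (E : {set {set 'I_n}}) : rel 'I_n :=
  fun x y => [set x; y] \in E.

Definition connected_graph n (E : {set {set 'I_n}}) : Prop :=
  forall x y : 'I_n, connect (adj E) x y.

Definition spanning_tree n (E T : {set {set 'I_n}}) : bool :=
  [&& T \subset E, [forall x, forall y, connect (adj T) x y] & #|T|.+1 == n].

Definition degree n (T : {set {set 'I_n}}) (v : 'I_n) : nat :=
  #|[set e in T | v \in e]|.

Definition leaves n (T : {set {set 'I_n}}) : nat :=
  #|[set v : 'I_n | degree T v == 1]|.

Definition max_leaf n (E : {set {set 'I_n}}) : nat :=
  \max_(T in powerset E | spanning_tree E T) leaves T.

Definition adj_minus n (E : {set {set 'I_n}}) (S : {set 'I_n}) : rel 'I_n :=
  fun x y => [&& x \notin S, y \notin S & [set x; y] \in E].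

Definition component n (E : {set {set 'I_n}}) (S : {set 'I_n}) (v : 'I_n)
  : {set 'I_n} :=
  [set u | (u \notin S) && connect (adj_minus E S) v u].

(* max size of a connected component of G - S (0 if G - S is empty) *)
Definition max_comp n (E : {set {set 'I_n}}) (S : {set 'I_n}) : nat :=
  \max_(v | v \notin S) #|component E S v|.

(* vi(G) = min_S (|S| + max_D |D|); the value for S = V is n, so n is a
   harmless initial value for the minimum. *)
Definition vertex_integrity n (E : {set {set 'I_n}}) : nat :=
  \big[minn/n]_(S : {set 'I_n}) (#|S| + max_comp E S).

(* tape alphabet: Some b (a bit) or None (blank) *)
Definition sym := option bool.

Record TM := {
  state : finType;
  q_start : state;
  q_acc : state;
  q_rej : state;
  acc_neq_rej : q_acc != q_rej;
  (* transition: new state, written symbol, move right (true) / left (false) *)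
  delta : state -> sym -> state * sym * bool
}.

(* two-way infinite tape: (reversed left part, current cell, right part) *)
Definition tape := (seq sym * sym * seq sym)%type.

Definition move_right (t : tape) : tape :=
  let: (l, a, r) := t in
  match r with [::] => (a :: l, None, [::]) | b :: r' => (a :: l, b, r') end.

Definition move_left (t : tape) : tape :=
  let: (l, a, r) := t in
  match l with [::] => ([::], None, a :: r) | b :: l' => (l', b, a :: r) end.

Definition config (M : TM) := (state M * tape)%type.

Definition step (M : TM) (c : config M) : config M :=
  let: (q, (l, a, r)) := c in
  if (q == q_acc M) || (q == q_rej M) then c else
  let: (q', b, dir) := delta q a in
  (q', if dir then move_right (l, b, r) else move_left (l, b, r)).

Definition init_config (M : TM) (w : seq bool) : config M :=
  (q_start M, match map Some w with [::] => ([::], None, [::])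
                                  | a :: r => ([::], a, r) end).

Definition run (M : TM) (w : seq bool) (t : nat) : config M :=
  iter t (step (M := M)) (init_config M w).

Fixpoint bits_fuel (f k : nat) : seq bool :=
  match f with
  | 0 => [::]
  | f'.+1 => if k == 0 then [::] else odd k :: bits_fuel f' k./2
  end.

Definition bin (k : nat) : seq bool := bits_fuel k k.

(* n in unary, a separator, the adjacency matrix row by row, then k in
   binary (the input ends at the first blank). *)
Definition encode n (E : {set {set 'I_n}}) (k : nat) : seq bool :=
  nseq n true ++ [:: false] ++
  [seq adj E i j | i <- enum 'I_n, j <- enum 'I_n] ++ bin k.

(* Main.v *)
(* Let X consist of the vertices of degree different from 2 together with one more
   vertex, and let Y be X with its neighbours; an exchange argument on a spanning
   tree with the maximum number of leaves gives #|Y| <= 51 * ml + 1.  Outside Y the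
   graph is a union of paths ("threads"), each leaving Y through a "port", and an
   optimal deletion set may be assumed to meet all but the crowded threads in
   equidistant tokens (p + 1 apart).  So, for each bound p on the component sizes,
   it is enough to guess four subsets of Y (the part of S in Y, and how the tokens
   start on each thread), and then to find the right phases of the tokens by local
   search: shifting by one step the tokens of all the threads whose ports lie in
   some subset of Y.  The potential is the number of connected ordered pairs in
   G - S.  A shortest path in the graph of token moves shows that some shift along
   a subset of ports decreases the potential as long as S is infeasible and the
   guess is right, hence quadratically many rounds suffice.  This search is written
   in a small loop language whose programs run on a one-tape machine with
   polynomial overhead. *)
Require Import Defs.
From mathcomp Require Import all_boot zify.
Set Implicit Arguments. Unset Strict Implicit. Unset Printing Implicit Defensive.

(** The number of tokens on a thread is nearly forced. A feasible set that meets a thread with L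
    vertices uses at least m = (L - 1) %/ (p + 1) of them, and equidistant tokens never call for
    more than m + 1, so one bit per port records the number. What stays unknown is the phase of each
    thread, which has up to n values: guessing phases would cost n to the power |Y|, hence the local
    search. Sliding all tokens of a thread by one step transfers one vertex between the components
    at its two ends and changes no other size. A single slide may fail to improve anything. Along a
    shortest path of slides from an oversized component to one that must grow, however, all
    intermediate sizes are unchanged and the sum of the squared sizes drops; this is why whole
    subsets of ports are shifted at once. The program knows nothing about families of tokens. A
    shift that pushes a token off its thread loses a vertex, so comparing cardinalities rejects
    exactly the shifts that leave the family. A wrong guess is harmless, because the answer is
    raised only after the components of the set at hand have been measured. *)

(** * Basic operations executed by sweeps of a one-tape machine *)

Module Machine.

(** [Put] and [Get] access the entry of a track at the index held by a variable; [Cur] tests the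
    current input bit; [Adv] consumes it and tests whether it was the last one. *)
Inductive op :=
  | Init | Inc of nat | Cpy of nat & nat | Put of nat & nat & bool
  | Eq of nat & nat | Lt of nat & nat | Get of nat & nat | Cur | Adv.

Section Machine.
Variables K B0 : nat.
Notation B := B0.+2.

(** Variable 0 is never assigned. It stays equal to 0, so its bit is set in block 0 only and tells
    the returning head where the memory starts. *)
Definition wfop (o : op) : bool :=
  match o with
  | Inc v => 0 < v < K
  | Cpy v w => [&& 0 < v, v < K & w < K]
  | Put t v _ => [&& K <= t, t < B & v < K]
  | Eq v w | Lt v w => (v < K) && (w < K)
  | Get t v => [&& K <= t, t < B & v < K]
  | _ => true
  end.

(* The left half of the tape is divided into blocks of [B] cells.  In block [j] the bit [v < K]
   says whether the variable [v] is equal to [j], and the bit [t >= K] is the entry [j] of the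
   track [t]; every operation is one sweep over the blocks. *)
Definition upd (o : op) (q : bool * bool) (f : nat -> bool) (i : nat) : bool :=
  match o with
  | Init => if f 0 then f i else i < K
  | Inc v => if i == v then q.1 else f i
  | Cpy v w => if i == v then f w else f i
  | Put t v b => if (i == t) && f v then b else f i
  | _ => f i
  end.

(** [None] ends the sweep at this block. The register [q] tells [Inc] that the previous block held
    the old value, and [Cpy] which of the two values have been passed; the comparisons stop at the
    first block that holds one of their variables. *)
Definition nxt (o : op) (q : bool * bool) (f : nat -> bool) : option (bool * bool) :=
  match o with
  | Inc v => if q.1 then None else Some (f v, false)
  | Cpy v w => if (q.1 || f v) && (q.2 || f w) then None
               else Some (q.1 || f v, q.2 || f w)
  | Put _ v _ | Get _ v => if f v then None else Some q
  | Eq v w | Lt v w => if f v || f w then None else Some q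
  | _ => None
  end.

Definition res (o : op) (f : nat -> bool) : bool :=
  match o with
  | Eq v w => f v && f w
  | Lt v w => f v && ~~ f w
  | Get t v => f t
  | _ => true
  end.

Definition isinput (o : op) : bool := match o with Cur | Adv => true | _ => false end.

Variable code : seq (op * nat * nat).
Hypothesis wfcode : all (fun x => wfop x.1.1) code.
Notation N := (size code).

Definition bits := {ffun 'I_B -> bool}.
(** Program counter, phase, offset in the current block, buffered block, register of the sweep,
    whether the sweep ends at this block, and the result of the test. *)
Definition ctl : finType :=
  ('I_N.+1 * 'I_9 * 'I_B * bits * (bool * bool) * bool * bool)%type.
Definition mstate : finType := (ctl + bool)%type.

Definition enc (f : nat -> bool) : bits := [ffun k : 'I_B => f k].

Definition mk (pc ph i : nat) (f : nat -> bool) (q : bool * bool) (s r : bool) : mstate :=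
  inl (inord pc, inord ph, inord i, enc f, q, s, r).

Definition bt (f : bits) : nat -> bool := fun k => f (inord k).

Definition setb (f : nat -> bool) (i : nat) (b : bool) : nat -> bool :=
  fun k => if k == i then b else f k.

(** A jump to the address [N] accepts and a jump beyond it rejects, so a program halts by its
    addresses alone. *)
Definition home (pc : nat) : mstate :=
  if pc < N then mk pc 0 0 (fun=> false) (false, false) false false
  else inr (pc == N).

Definition target (pc : nat) (r : bool) : nat :=
  let x := nth (Init, 0, 0) code pc in if r then x.1.2 else x.2.

Definition mop (pc : nat) := (nth (Init, 0, 0) code pc).1.1.

Definition wr (b : bool) : sym := Some b.
Definition rd (a : sym) : bool := a == Some true.

(* Phases: 0 at home; 1 read a block outwards; 2 rewrite it inwards; 3 skip it
   outwards; 4 return home; 5 search the input; 6-7 look for its end; 8 come back. *)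
Definition mdn (pc ph i : nat) (f : nat -> bool) (q : bool * bool) (stp r : bool)
    (a : sym) : mstate * sym * bool :=
  let o := mop pc in
  match ph with
  | 0 => if a == Some false then (inr true, a, true)
         else if isinput o then (mk pc 5 0 f q stp r, a, true)
         else (mk pc 1 0 (fun=> false) (false, false) false false, a, false)
  | 1 => let f' := setb f i (rd a) in
         if i.+1 < B then (mk pc 1 i.+1 f' q stp r, a, false)
         else let g := upd o q f' in
              let s' := nxt o q f' in
              (mk pc 2 i.-1 g (odflt (false, false) s') (s' == None) (res o f'),
               wr (g i), true)
  | 2 => if 0 < i then (mk pc 2 i.-1 f q stp r, wr (f i), true)
         else if stp then
           (if f 0 then home (target pc r) else mk pc 4 B.-1 f q stp r,
            wr (f 0), true)
         else (mk pc 3 1 f q stp r, wr (f 0), false)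
  | 3 => if i.+1 < B then (mk pc 3 i.+1 f q stp r, a, false)
         else (mk pc 1 0 f q stp r, a, false)
  | 4 => if 0 < i then (mk pc 4 i.-1 f q stp r, a, true)
         else (if rd a then home (target pc r) else mk pc 4 B.-1 f q stp r, a, true)
  | 5 => match a with
         | None => (mk pc 5 0 f q stp r, a, true)
         | Some b => match o with
                     | Cur => (mk pc 8 0 f q stp b, a, false)
                     | _ => (mk pc 6 0 f q stp r, None, true)
                     end
         end
  | 6 => match a with
         | None => (mk pc 7 0 f q stp true, a, false)
         | Some _ => (mk pc 8 0 f q stp false, a, false)
         end
  | 7 => (mk pc 8 0 f q stp r, Some false, false)
  | _ => match a with
         | None => (mk pc 8 0 f q stp r, a, false)
         | Some _ => (mk pc 4 0 f q stp r, a, false)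
         end
  end.

Definition mdelta (s : mstate) (a : sym) : mstate * sym * bool :=
  match s with
  | inr b => (s, a, true)
  | inl (pc, ph, i, f, q, stp, r) => mdn pc ph i (bt f) q stp r a
  end.

Lemma inr_neq : (inr true : mstate) != inr false. Proof. by []. Qed.

Definition machine : TM := @Build_TM mstate (home 0) (inr true) (inr false) inr_neq mdelta.

Notation stepm := (step (M := machine)).

(* [at_ c m a0 r0 T]: the head of [T] is on memory cell [c.-1] of the left half
   tape, or on the home cell if [c = 0]. *)
Definition at_ (c : nat) (m : nat -> sym) (a0 : sym) (r0 : seq sym) (T : tape) : Prop :=
  let: (l, a, r) := T in
  (forall i, nth None l i = m (c + i)) /\
  match c with
  | 0 => a = a0 /\ r = r0
  | c'.+1 => a = m c' /\ r = rev (mkseq m c') ++ a0 :: r0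
  end.

Definition setm (m : nat -> sym) c b : nat -> sym := fun k => if k == c then b else m k.

Lemma at_ext c m m' a0 r0 T : m =1 m' -> at_ c m a0 r0 T -> at_ c m' a0 r0 T.
Proof.
case: T => [[l a] r] E [H1 H2]; split=> [i|]; first by rewrite H1 E.
by case: c H1 H2 => [|c] _ [-> ->] //; rewrite E (eq_mkseq E).
Qed.

Lemma at_left c m a0 r0 l a r b :
  at_ c.+1 m a0 r0 (l, a, r) -> at_ c.+2 (setm m c b) a0 r0 (move_left (l, b, r)).
Proof.
move=> [Hl [_ Hr]].
have Hmk : mkseq (setm m c b) c = mkseq m c.
  apply/eq_in_map => i; rewrite mem_iota /setm => /andP[_ Hi].
  by case: eqP => // E; move: Hi; rewrite E add0n ltnn.
have E : rev (mkseq (setm m c b) c.+1) ++ a0 :: r0 = b :: r.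
  by rewrite mkseqS rev_rcons Hmk /= Hr /setm eqxx.
have F i : setm m c b (c.+1 + i) = m (c.+1 + i).
  by rewrite /setm; case: eqP => // E'; exfalso; lia.
case: l Hl => [|x l] Hl /=; split.
- by move=> i; rewrite nth_nil addSnnS F -Hl nth_nil.
- by rewrite -E; split=> //; move: (Hl 0); rewrite -F addn0.
- by move=> i; rewrite addSnnS F -Hl.
- by rewrite -E; split=> //; move: (Hl 0); rewrite -F addn0.
Qed.

Lemma at_right c m a0 r0 l a r b :
  at_ c.+1 m a0 r0 (l, a, r) -> at_ c (setm m c b) a0 r0 (move_right (l, b, r)).
Proof.
move=> [Hl [_ Hr]].
have Hmk k : k <= c -> mkseq (setm m c b) k = mkseq m k.
  move=> Hk; apply/eq_in_map => i; rewrite mem_iota /setm => /andP[_ Hi].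
  by case: eqP => // E; exfalso; lia.
have Hl' i : nth None (b :: l) i = setm m c b (c + i).
  case: i => [|i] /=; first by rewrite addn0 /setm eqxx.
  rewrite Hl addSnnS /setm; case: eqP => // E; exfalso; lia.
case: c Hl Hr Hmk Hl' => [|c] Hl Hr Hmk Hl'; first by rewrite Hr.
rewrite Hr mkseqS rev_rcons /=; split=> //; split.
  by rewrite /setm; case: eqP => // E; exfalso; lia.
by rewrite Hmk.
Qed.

Lemma at_home m a0 r0 l a r :
  at_ 0 m a0 r0 (l, a, r) -> at_ 1 m a0 r0 (move_left (l, a0, r)).
Proof.
move=> [Hl [_ ->]]; case: l Hl => [|x l] Hl /=; (split; last by rewrite -(Hl 0)) => i.
  by rewrite nth_nil -Hl nth_nil.
by rewrite -Hl.
Qed.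

Lemma setm_id m c : setm m c (m c) =1 m.
Proof. by move=> k; rewrite /setm; case: eqP => [->|]. Qed.

Lemma bt_enc (g : nat -> bool) k : k < B -> bt (enc g) k = g k.
Proof. by move=> Hk; rewrite /bt ffunE inordK. Qed.

Lemma mk_ext pc ph i f f' q s r : (forall k, k < B -> f k = f' k) ->
  mk pc ph i f q s r = mk pc ph i f' q s r.
Proof. by move=> E; rewrite /mk; congr (inl (_, _, _, _, _, _, _)); apply/ffunP=> k; rewrite !ffunE E. Qed.

Lemma upd_ext o q f f' i : wfop o -> K <= B -> i < B -> (forall k, k < B -> f k = f' k) ->
  upd o q f i = upd o q f' i.
Proof.
by move=> W KB Hi E; case: o W => //= *; rewrite ?E //; lia.
Qed.
Lemma nxt_ext o q f f' : wfop o -> K <= B -> (forall k, k < B -> f k = f' k) ->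
  nxt o q f = nxt o q f'.
Proof. by move=> W KB E; case: o W => //= *; rewrite ?E //; lia. Qed.
Lemma res_ext o f f' : wfop o -> K <= B -> (forall k, k < B -> f k = f' k) ->
  res o f = res o f'.
Proof. by move=> W KB E; case: o W => //= *; rewrite ?E //; lia. Qed.


Lemma mdelta_mk pc ph i (f : nat -> bool) q s r a : pc < N -> ph < 9 -> i < B ->
  mdelta (mk pc ph i f q s r) a = mdn pc ph i (bt (enc f)) q s r a.
Proof. by move=> H1 H2 H3; rewrite /mk /= !inordK //; lia. Qed.

(** The quantification over tapes is there because [at_] fixes the left half only up to trailing
    blanks. *)
Definition goes k s c m a0 r0 s' c' m' a0' r0' :=
  forall T, at_ c m a0 r0 T ->
  exists T', iter k stepm (s, T) = (s', T') /\ at_ c' m' a0' r0' T'.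

Lemma goes0 s c m m' a0 r0 : m =1 m' -> goes 0 s c m a0 r0 s c m' a0 r0.
Proof. by move=> E T HT; exists T; split=> //; apply: at_ext HT. Qed.

Lemma goesD k1 k2 s1 c1 m1 a1 r1 s2 c2 m2 a2 r2 s3 c3 m3 a3 r3 :
  goes k1 s1 c1 m1 a1 r1 s2 c2 m2 a2 r2 -> goes k2 s2 c2 m2 a2 r2 s3 c3 m3 a3 r3 ->
  goes (k1 + k2) s1 c1 m1 a1 r1 s3 c3 m3 a3 r3.
Proof.
move=> H1 H2 T /H1[T1 [E1 /H2[T2 [E2 H]]]]; exists T2; split=> //.
by rewrite addnC iterD E1.
Qed.

Lemma goesS k s1 c1 m1 a1 r1 s2 c2 m2 a2 r2 s3 c3 m3 a3 r3 :
  goes k s1 c1 m1 a1 r1 s2 c2 m2 a2 r2 -> goes 1 s2 c2 m2 a2 r2 s3 c3 m3 a3 r3 ->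
  goes k.+1 s1 c1 m1 a1 r1 s3 c3 m3 a3 r3.
Proof. by move=> H1 H2; rewrite -addn1; apply: goesD H1 H2. Qed.

Lemma goes_ext k s c m a0 r0 s' c' m' a0' r0' m1 m2 : m1 =1 m -> m' =1 m2 ->
  goes k s c m a0 r0 s' c' m' a0' r0' -> goes k s c m1 a0 r0 s' c' m2 a0' r0'.
Proof.
move=> E1 E2 H T /(at_ext E1)/H[T' [E HT']]; exists T'; split=> //.
exact: at_ext HT'.
Qed.

Lemma iter1_mk pc ph i f q s r l a rr :
  iter 1 stepm (mk pc ph i f q s r, (l, a, rr)) =
  let: (s', b, d) := mdelta (mk pc ph i f q s r) a in
  (s', if d then move_right (l, b, rr) else move_left (l, b, rr)).
Proof. by []. Qed.

Lemma goes_left s' b pc ph i (f : nat -> bool) q s r c m a0 r0 : pc < N -> ph < 9 -> i < B ->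
  mdn pc ph i (bt (enc f)) q s r (m c) = (s', b, false) ->
  goes 1 (mk pc ph i f q s r) c.+1 m a0 r0 s' c.+2 (setm m c b) a0 r0.
Proof.
move=> H1 H2 H3 E [[l a] rr] HT; exists (move_left (l, b, rr)); split; last exact: at_left HT.
by rewrite iter1_mk; case: HT => _ [-> _]; rewrite mdelta_mk // E.
Qed.

Lemma goes_right s' b pc ph i (f : nat -> bool) q s r c m a0 r0 : pc < N -> ph < 9 -> i < B ->
  mdn pc ph i (bt (enc f)) q s r (m c) = (s', b, true) ->
  goes 1 (mk pc ph i f q s r) c.+1 m a0 r0 s' c (setm m c b) a0 r0.
Proof.
move=> H1 H2 H3 E [[l a] rr] HT; exists (move_right (l, b, rr)); split; last exact: at_right HT.
by rewrite iter1_mk; case: HT => _ [-> _]; rewrite mdelta_mk // E.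
Qed.

(** The memory during the inward pass over block [j]: the cells from offset [i] on are already
    rewritten. *)
Definition blk (m : nat -> sym) j i (g : nat -> bool) : nat -> sym :=
  fun c => if j * B + i <= c < j * B + B then Some (g (c - j * B)) else m c.

Definition mm (m : nat -> sym) (j k : nat) : bool := rd (m (j * B + k)).

Hypothesis KB : K <= B.

Lemma mop_wf pc : wfop (mop pc).
Proof.
rewrite /mop; case: (ltnP pc N) => H; last by rewrite nth_default.
exact: (all_nthP (Init, 0, 0) wfcode).
Qed.

Lemma read_block pc j f0 q s r m a0 r0 i : pc < N -> i < B ->
  goes i (mk pc 1 0 f0 q s r) (j * B).+1 m a0 r0
    (mk pc 1 i (fun k => if k < i then mm m j k else f0 k) q s r) (j * B + i).+1 m a0 r0.
Proof.
move=> Hpc; elim: i => [|i IH] Hi; first by rewrite addn0; apply: goes0.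
rewrite addnS.
apply: goesS (IH (ltnW Hi)) _; apply: goes_ext (frefl _) (setm_id m (j * B + i)) _.
apply: goes_left => //; first by lia.
rewrite /mdn Hi; congr (_, _, _); apply: mk_ext => k Hk; rewrite /setb bt_enc //.
case: eqP => [->|Hki]; first by rewrite leqnn.
by rewrite ltnS [k <= i]leq_eqVlt; move/eqP/negbTE: Hki => ->.
Qed.

Lemma rewrite_block pc j g q s r m a0 r0 i : pc < N -> i <= B0 ->
  goes i (mk pc 2 B0 g q s r) (j * B + B0).+1 (blk m j B0.+1 g) a0 r0
    (mk pc 2 (B0 - i) g q s r) (j * B + (B0 - i)).+1 (blk m j (B0 - i).+1 g) a0 r0.
Proof.
move=> Hpc; elim: i => [|i IH] Hi; first by rewrite subn0; apply: goes0.
apply: goesS (IH (ltnW Hi)) _.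
have Hi' : B0 - i = (B0 - i.+1).+1 by lia.
rewrite Hi'; set k := B0 - i.+1.
apply: (@goes_ext _ _ _ (blk m j k.+2 g) _ _ _ _ (setm (blk m j k.+2 g) (j * B + k.+1) (Some (g k.+1)))) => //.
  move=> c; rewrite /setm /blk; case: eqP => [->|Hc].
    by rewrite leqnn ltn_add2l addKn; case: ifP => //; lia.
  by case: ifP => H1; case: ifP => H2 //; lia.
rewrite addnS; apply: goes_right => //; first by lia.
by rewrite /mdn /= bt_enc; [congr (_, _, _); apply: mk_ext => x Hx; rewrite bt_enc|lia].
Qed.

(** [B0.+1] steps buffer the block up to its last cell, one step turns around there and writes it,
    and [B0] steps lead back to the first cell, which is still to be rewritten. *)
Lemma enter_block pc j f0 q s r m a0 r0 (o := mop pc) (g := upd o q (mm m j)) : pc < N ->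
  goes (B0.+1 + 1 + B0) (mk pc 1 0 f0 q s r) (j * B).+1 m a0 r0
    (mk pc 2 0 g (odflt (false, false) (nxt o q (mm m j))) (nxt o q (mm m j) == None)
       (res o (mm m j))) (j * B).+1 (blk m j 1 g) a0 r0.
Proof.
move=> Hpc.
have H1 : goes (B0.+1 + 1) (mk pc 1 0 f0 q s r) (j * B).+1 m a0 r0
    (mk pc 2 B0 g (odflt (false, false) (nxt o q (mm m j))) (nxt o q (mm m j) == None)
       (res o (mm m j))) (j * B + B0.+1) (setm m (j * B + B0.+1) (Some (g B0.+1))) a0 r0.
  apply: goesD; first exact: (@read_block pc j f0 q s r m a0 r0 B0.+1 Hpc (ltnSn _)).
  apply: goes_right => //.
  rewrite /mdn ltnn /=.
  set f' := setb _ _ _.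
  have Ef k : k < B -> f' k = mm m j k.
    move=> Hk; rewrite /f' /setb bt_enc //; case: eqP => [->|Hk'] //.
    by rewrite ifT //; lia.
  rewrite (nxt_ext q (mop_wf pc) KB Ef) (res_ext (mop_wf pc) KB Ef).
  rewrite (upd_ext q (mop_wf pc) KB _ Ef) //.
  by congr (_, _, _); apply: mk_ext => k Hk; apply: (upd_ext q (mop_wf pc) KB _ Ef).
apply: goesD H1 _.
have := @rewrite_block pc j g (odflt (false, false) (nxt o q (mm m j)))
  (nxt o q (mm m j) == None) (res o (mm m j)) m a0 r0 B0 Hpc (leqnn _).
rewrite subnn addn0 addnS.
apply: goes_ext => // c; rewrite /setm /blk; case: eqP => [->|Hc].
  by rewrite ifT ?addKn ?/wr; [congr (Some (g _)); lia|lia].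
by case: ifP => // H; lia.
Qed.

Lemma skip_block pc j f q s r m a0 r0 i : pc < N -> i <= B0 ->
  goes i (mk pc 3 1 f q s r) (j * B + 1).+1 m a0 r0
    (mk pc 3 i.+1 f q s r) (j * B + i.+1).+1 m a0 r0.
Proof.
move=> Hpc; elim: i => [|i IH] Hi; first exact: goes0.
rewrite [j * B + i.+2]addnS.
apply: goesS (IH (ltnW Hi)) _; apply: goes_ext (frefl _) (setm_id m (j * B + i.+1)) _.
apply: goes_left => //; first by lia.
rewrite /mdn ifT; last by lia.
by congr (_, _, _); apply: mk_ext => k Hk; rewrite bt_enc.
Qed.

Lemma blk0 m j g : setm (blk m j 1 g) (j * B) (Some (g 0)) =1 blk m j 0 g.
Proof.
move=> c; rewrite /setm /blk; case: eqP => [->|Hc].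
  by rewrite ifT ?subnn //; lia.
by case: ifP => H1; case: ifP => H2 //; lia.
Qed.

Lemma pass_block pc j f0 q q' s r m a0 r0 (o := mop pc) (g := upd o q (mm m j)) :
  pc < N -> nxt o q (mm m j) = Some q' ->
  exists f1 s1 r1,
  goes (3 * B0 + 4) (mk pc 1 0 f0 q s r) (j * B).+1 m a0 r0
    (mk pc 1 0 f1 q' s1 r1) (j.+1 * B).+1 (blk m j 0 g) a0 r0.
Proof.
move=> Hpc E; exists g, false, (res o (mm m j)).
have := @enter_block pc j f0 q s r m a0 r0 Hpc; rewrite E /= -/o -/g => H1.
have H2 : goes 1 (mk pc 2 0 g q' false (res o (mm m j))) (j * B).+1 (blk m j 1 g) a0 r0
   (mk pc 3 1 g q' false (res o (mm m j))) (j * B + 1).+1 (blk m j 0 g) a0 r0.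
  apply: goes_ext (frefl _) (blk0 m j g) _; rewrite addn1.
  apply: goes_left => //; rewrite /mdn /= bt_enc //.
  by congr (_, _, _); apply: mk_ext => k Hk; rewrite bt_enc.
have H3 := @skip_block pc j g q' false (res o (mm m j)) (blk m j 0 g) a0 r0 B0 Hpc (leqnn _).
have H4 : goes 1 (mk pc 3 B0.+1 g q' false (res o (mm m j))) (j * B + B0.+1).+1 (blk m j 0 g) a0 r0
   (mk pc 1 0 g q' false (res o (mm m j))) (j.+1 * B).+1 (blk m j 0 g) a0 r0.
  apply: goes_ext (frefl _) (setm_id _ (j * B + B0.+1)) _.
  rewrite (_ : j.+1 * B = (j * B + B0.+1).+1); last by rewrite mulSn; lia.
  apply: goes_left => //; rewrite /mdn /= ltnn.
  by congr (_, _, _); apply: mk_ext => k Hk; rewrite bt_enc.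
have := goesD (goesD H1 H2) (goesD H3 H4).
by congr goes; lia.
Qed.

Lemma back_block pc j f q s r m a0 r0 i : pc < N -> i <= B0.+1 ->
  goes i (mk pc 4 B0.+1 f q s r) (j * B + B0.+1).+1 m a0 r0
    (mk pc 4 (B0.+1 - i) f q s r) (j * B + (B0.+1 - i)).+1 m a0 r0.
Proof.
move=> Hpc; elim: i => [|i IH] Hi; first by rewrite subn0; apply: goes0.
apply: goesS (IH (ltnW Hi)) _.
have Hi' : B0.+1 - i = (B0.+1 - i.+1).+1 by lia.
rewrite Hi'; set k := _ - i.+1.
apply: goes_ext (frefl _) (setm_id m (j * B + k.+1)) _.
rewrite addnS; apply: goes_right => //; first by lia.
by rewrite /mdn /=; congr (_, _, _); apply: mk_ext => x Hx; rewrite bt_enc.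
Qed.

(** At each start of a block the head tests the bit of variable 0; only block 0 has it set, and the
    home cell is next to it. *)
Lemma back_home pc j f q s r m a0 r0 : pc < N ->
  (forall i, i <= j -> mm m i 0 = (i == 0)) ->
  goes (j.+1 * B) (mk pc 4 B0.+1 f q s r) (j.+1 * B) m a0 r0
    (home (target pc r)) 0 m a0 r0.
Proof.
move=> Hpc; elim: j f => [|j IH] f Hm.
  have := @back_block pc 0 f q s r m a0 r0 B0.+1 Hpc (leqnn _).
  rewrite mul0n !add0n mul1n subnn => H; rewrite -[X in goes X]addn1.
  apply: goesD H _; apply: goes_ext (frefl _) (setm_id m 0) _.
  by apply: goes_right => //; rewrite /mdn /=; move: (Hm 0 isT); rewrite /mm /= => ->.
have H1 := @back_block pc j.+1 f q s r m a0 r0 B0.+1 Hpc (leqnn _).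
rewrite subnn addn0 in H1.
have H2 : goes 1 (mk pc 4 0 f q s r) (j.+1 * B).+1 m a0 r0
   (mk pc 4 B0.+1 f q s r) (j.+1 * B) m a0 r0.
  apply: goes_ext (frefl _) (setm_id m (j.+1 * B)) _.
  apply: goes_right => //; rewrite /mdn.
  have := Hm j.+1 (leqnn _); rewrite /mm addn0 /= => ->.
  by congr (_, _, _); apply: mk_ext => x Hx; rewrite bt_enc.
have H3 := IH f (fun i Hi => Hm i (leqW Hi)).
have := goesD (goesD H1 H2) H3.
rewrite (_ : j.+2 * B = (j.+1 * B + B0.+1).+1); last by rewrite [j.+2 * B]mulSn; lia.
by congr goes; lia.
Qed.

Lemma stop_block pc j f0 q s r m a0 r0 (o := mop pc) (g := upd o q (mm m j)) :
  pc < N -> nxt o q (mm m j) = None -> g 0 = (j == 0) ->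
  (forall i, i < j -> mm m i 0 = (i == 0)) ->
  goes (2 * B0 + 3 + j * B) (mk pc 1 0 f0 q s r) (j * B).+1 m a0 r0
    (home (target pc (res o (mm m j)))) 0 (blk m j 0 g) a0 r0.
Proof.
move=> Hpc E G0 Hm.
have := @enter_block pc j f0 q s r m a0 r0 Hpc; rewrite E /= -/o -/g => H1.
have H2 : goes 1 (mk pc 2 0 g (false, false) true (res o (mm m j))) (j * B).+1 (blk m j 1 g) a0 r0
   (if j == 0 then home (target pc (res o (mm m j)))
    else mk pc 4 B0.+1 g (false, false) true (res o (mm m j))) (j * B) (blk m j 0 g) a0 r0.
  apply: goes_ext (frefl _) (blk0 m j g) _.
  apply: goes_right => //; rewrite /mdn /= bt_enc // G0.
  congr (_, _, _); case: (j == 0) => //.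
  by apply: mk_ext => k Hk; rewrite bt_enc.
case: j o g E G0 Hm H1 H2 => [|j] o g E G0 Hm H1 H2.
  by have := goesD H1 H2; rewrite mul0n /=; congr goes; lia.
have Hm' i : i <= j -> mm (blk m j.+1 0 g) i 0 = (i == 0).
  move=> Hi; rewrite -Hm // /mm /blk ifF //.
  have : i * B <= j * B by rewrite leq_mul2r Hi orbT.
  by rewrite mulSn; lia.
have H3 := @back_home pc j g (false, false) true (res o (mm m j.+1)) _ a0 r0 Hpc Hm'.
by have := goesD (goesD H1 H2) H3; congr goes; lia.
Qed.

Fixpoint qs (o : op) (m : nat -> nat -> bool) j : bool * bool :=
  if j is j'.+1 then odflt (false, false) (nxt o (qs o m j') (m j'))
  else (false, false).

Definition swept (o : op) (m : nat -> nat -> bool) J : nat -> nat -> bool :=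
  fun j k => if j <= J then upd o (qs o m j) (m j) k else m j k.

Lemma mm_blk m j g i k : k < B ->
  mm (blk m j 0 g) i k = if i == j then g k else mm m i k.
Proof.
move=> Hk; rewrite /mm /blk; case: eqP => [->|Hij].
  by rewrite ifT ?addKn //; [case: (g k)|lia].
rewrite ifF //; case: (ltngtP i j) => H; [|  |lia].
  have : i.+1 * B <= j * B by rewrite leq_mul2r H orbT.
  by rewrite mulSn; lia.
have : j.+1 * B <= i * B by rewrite leq_mul2r H orbT.
by rewrite mulSn; lia.
Qed.

(** [J] is the block where the sweep ends. A block that is passed costs [3 * B0 + 4] steps on the
    way out and [B] on the way home, hence [4 * B] per block. *)
Lemma sweep_goes pc m a0 r0 J (o := mop pc) : pc < N ->
  (forall j, j < J -> nxt o (qs o (mm m) j) (mm m j) <> None) ->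
  nxt o (qs o (mm m) J) (mm m J) = None ->
  (forall j, j <= J -> swept o (mm m) J j 0 = (j == 0)) ->
  exists2 m', (forall j k, k < B -> mm m' j k = swept o (mm m) J j k) &
  exists2 t, t <= (J.+1) * (4 * B) &
  goes t (mk pc 1 0 (fun=> false) (false, false) false false) 1 m a0 r0
    (home (target pc (res o (mm m J)))) 0 m' a0 r0.
Proof.
move=> Hpc H1 H2 H3.
have pass j : j <= J -> exists m1 f1 s1 r1,
    (forall i k, k < B -> mm m1 i k =
       if i < j then upd o (qs o (mm m) i) (mm m i) k else mm m i k) /\
    goes (j * (3 * B0 + 4)) (mk pc 1 0 (fun=> false) (false, false) false false) 1 m a0 r0
     (mk pc 1 0 f1 (qs o (mm m) j) s1 r1) (j * B).+1 m1 a0 r0.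
  elim: j => [|j IH] Hj.
    by exists m, (fun=> false), false, false; split=> //; apply: goes0.
  have [m1 [f1 [s1 [r1 [E1 G1]]]]] := IH (ltnW Hj).
  have Em k : k < B -> mm m1 j k = mm m j k by move=> Hk; rewrite E1 // ltnn.
  have EN := nxt_ext (qs o (mm m) j) (mop_wf pc) KB Em; rewrite -/o in EN.
  case Q : (nxt o (qs o (mm m) j) (mm m j)) => [q'|]; last by case: (H1 _ Hj Q).
  rewrite Q in EN.
  have [f2 [s2 [r2 G2]]] := @pass_block pc j f1 _ q' s1 r1 m1 a0 r0 Hpc EN.
  exists (blk m1 j 0 (upd o (qs o (mm m) j) (mm m1 j))), f2, s2, r2; split.
    move=> i k Hk; rewrite mm_blk //; case: eqP => [->|Hij].
      by rewrite ltnSn; apply: (upd_ext _ (mop_wf pc) KB).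
    by rewrite E1 // ltnS [i <= j]leq_eqVlt; move/eqP/negbTE: Hij => ->.
  by rewrite [qs _ _ _]/= Q mulSn addnC; apply: goesD G1 G2.
have [m1 [f1 [s1 [r1 [E1 G1]]]]] := pass J (leqnn _).
have Em k : k < B -> mm m1 J k = mm m J k by move=> Hk; rewrite E1 // ltnn.
have EN := nxt_ext (qs o (mm m) J) (mop_wf pc) KB Em; rewrite -/o H2 in EN.
have EU k : k < B -> upd o (qs o (mm m) J) (mm m1 J) k = upd o (qs o (mm m) J) (mm m J) k.
  by move=> Hk; apply: (upd_ext _ (mop_wf pc) KB).
have G2 : goes (2 * B0 + 3 + J * B) (mk pc 1 0 f1 (qs o (mm m) J) s1 r1) (J * B).+1 m1 a0 r0
   (home (target pc (res o (mm m1 J)))) 0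
   (blk m1 J 0 (upd o (qs o (mm m) J) (mm m1 J))) a0 r0.
  apply: stop_block => //.
    by rewrite EU //; have := H3 J (leqnn _); rewrite /swept leqnn.
  by move=> i Hi; rewrite E1 // Hi; have := H3 i (ltnW Hi); rewrite /swept (ltnW Hi).
rewrite (res_ext (mop_wf pc) KB Em) in G2.
exists (blk m1 J 0 (upd o (qs o (mm m) J) (mm m1 J))).
  move=> j k Hk; rewrite mm_blk // /swept; case: eqP => [->|Hij]; first by rewrite leqnn EU.
  by rewrite E1 // [j <= J]leq_eqVlt; move/eqP/negbTE: Hij => ->.
exists (J * (3 * B0 + 4) + (2 * B0 + 3 + J * B)); last exact: goesD G1 G2.
by rewrite mulSn; nia.
Qed.

End Machine.

End Machine.

(** * Abstract states of the memory and their simulation by the machine *)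

Module Simulation.
Import Machine.

Record st := St { vr : nat -> nat; tr : nat -> nat -> bool; inp : bool * seq bool }.

Definition setv (s : st) v x := St (fun w => if w == v then x else vr s w) (tr s) (inp s).
Definition sett (s : st) t a b :=
  St (vr s) (fun t' a' => if (t' == t) && (a' == a) then b else tr s t' a') (inp s).

(* The last input bit is replaced by [false] when it is consumed. *)
Definition opst (o : op) (s : st) : st :=
  match o with
  | Inc v => setv s v (vr s v).+1
  | Cpy v w => setv s v (vr s w)
  | Put t v b => sett s t (vr s v) b
  | Adv => St (vr s) (tr s) (if (inp s).2 is b :: r then (b, r) else (false, [::]))
  | _ => s
  end.

Definition opres (o : op) (s : st) : bool :=
  match o with
  | Eq v w => vr s v == vr s w
  | Lt v w => vr s v < vr s w
  | Get t v => tr s t (vr s v)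
  | Cur => (inp s).1
  | Adv => nilp (inp s).2
  | _ => true
  end.

Section Simulation.
Variables K B0 : nat.
Notation B := B0.+2.
Variable code : seq (op * nat * nat).
Hypothesis wfcode : all (fun x => wfop K B0 x.1.1) code.
Hypothesis K_gt0 : 0 < K.
Hypothesis KB : K <= B.
Notation N := (size code).
Notation stepm := (step (M := machine K B0 code)).
Notation home := (home B0 code).
Notation mk := (mk B0 code).
Notation mm := (mm B0).

(** The home cell is the first input bit, which is [true] when the graph has a vertex. It is
    followed by [d] blanks left by consumed bits; [e] counts the blanks already visited after the
    input. *)
Definition rep (d : nat) (s : st) (T : tape) : Prop :=
  exists m e,
    [/\ at_ 0 m (Some true)
         (nseq d None ++ Some (inp s).1 :: map Some (inp s).2 ++ nseq e None) T,
        forall j v, v < K -> mm m j v = (j == vr s v),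
        forall j t, K <= t -> t < B -> mm m j t = tr s t j & vr s 0 = 0].

Lemma mk_bt pc ph i f q s r : mk pc ph i (bt (enc B0 f)) q s r = mk pc ph i f q s r.
Proof. by apply: mk_ext => k Hk; rewrite bt_enc. Qed.

Lemma nseq_cat1 T d (x : T) s : nseq d x ++ x :: s = nseq d.+1 x ++ s.
Proof. by elim: d => //= d ->. Qed.

Lemma scan5 pc f q s r d L x b rest : pc < N ->
  iter d stepm (mk pc 5 0 f q s r, move_right (L, x, nseq d None ++ Some b :: rest)) =
  (mk pc 5 0 f q s r, (nseq d None ++ x :: L, Some b, rest)).
Proof.
move=> Hpc; elim: d L x => [//|d IH] L x.
by rewrite iterSr [move_right _]/= -[stepm _]/(iter 1 stepm _) iter1_mk (mdelta_mk wfcode) //= mk_bt IH nseq_cat1.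
Qed.

Lemma scan8 pc f q s r d l x rest : pc < N ->
  iter d stepm (mk pc 8 0 f q s r, move_left (nseq d None ++ Some true :: l, x, rest)) =
  (mk pc 8 0 f q s r, (l, Some true, nseq d None ++ x :: rest)).
Proof.
move=> Hpc; elim: d x rest => [//|d IH] x rest.
by rewrite iterSr [move_left _]/= -[stepm _]/(iter 1 stepm _) iter1_mk (mdelta_mk wfcode) //= mk_bt IH nseq_cat1.
Qed.

Lemma homeE pc : pc < N -> home pc = mk pc 0 0 (fun=> false) (false, false) false false.
Proof. by rewrite /Machine.home => ->. Qed.

Lemma home_input pc d b rest l : pc < N -> isinput (mop code pc) ->
  exists f q s r, iter d.+1 stepm (home pc, (l, Some true, nseq d None ++ Some b :: rest)) =
    (mk pc 5 0 f q s r, (nseq d None ++ Some true :: l, Some b, rest)).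
Proof.
move=> Hpc Hi; exists (fun=> false), (false, false), false, false.
rewrite -addn1 iterD homeE // iter1_mk (mdelta_mk wfcode) // /mdn Hi mk_bt.
exact: scan5.
Qed.

Lemma home_back pc f q s r m l rest : pc < N ->
  mm m 0 0 -> at_ 0 m (Some true) rest (l, Some true, rest) ->
  exists2 T, iter 2 stepm (mk pc 8 0 f q s r, (l, Some true, rest)) =
    (home (target code pc r), T) & at_ 0 m (Some true) rest T.
Proof.
move=> Hpc H00 HT.
have /(_ _ (at_home HT)) [T [ET HT']] : goes (K := K) 1
   (mk pc 4 0 f q s r) 1 m (Some true) rest (home (target code pc r)) 0 m (Some true) rest.
  apply: goes_ext (frefl _) (setm_id m 0) _.
  by apply: (goes_right wfcode) => //; rewrite /mdn /=; move: H00; rewrite /Machine.mm /= => ->.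
exists T => //; rewrite -ET (iterD 1 1); congr iter.
by rewrite iter1_mk (mdelta_mk wfcode) // /mdn mk_bt.
Qed.

(** The head crosses the consumed cells once in each direction. Since a [false] replaces the last
    bit, the search to the right always meets a bit. *)
Lemma sim_input pc d s T (o := mop code pc) : pc < N -> isinput o -> rep d s T ->
  exists t T' d', [/\ iter t stepm (home pc, T) = (home (target code pc (opres o s)), T'),
    rep d' (opst o s) T', d' <= d.+1 & t <= 2 * d + 10].
Proof.
move=> Hpc Hi [m [e [HT Hv Ht H0]]].
have H00 : mm m 0 0 by rewrite Hv // H0.
case: T HT => [[l a] r] [Hl [Ea Er]]; rewrite {}Ea {}Er.
case: s H0 Hv Ht Hl => [vs ts [b w]] /= H0 Hv Ht Hl.
have [f [q [stp [r0 E1]]]] := @home_input pc d b (map Some w ++ nseq e None) l Hpc Hi.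
have Hback f' q' s' r' x rest d' : at_ 0 m (Some true) (nseq d' None ++ x :: rest) (l, Some true, nseq d' None ++ x :: rest) ->
   exists2 T, iter (2 + d') stepm (mk pc 8 0 f' q' s' r', move_left (nseq d' None ++ Some true :: l, x, rest)) =
     (home (target code pc r'), T) & at_ 0 m (Some true) (nseq d' None ++ x :: rest) T.
  move=> HT; have [T ET HT'] := @home_back pc f' q' s' r' m l _ Hpc H00 HT.
  by exists T => //; rewrite iterD (@scan8 pc f' q' s' r').
have at0 rr : at_ 0 m (Some true) rr (l, Some true, rr) by split.
rewrite /o in Hi; case Eo : (mop code pc) Hi => //= _.
- have [T ET HT'] := Hback f q stp b (Some b) (map Some w ++ nseq e None) d (at0 _).
  exists ((2 + d) + (1 + d.+1)), T, d; split; [|by rewrite /o Eo; exists m, e|by []|by lia].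
  by rewrite /o Eo /opres /inp (iterD (2 + d)) (iterD 1 d.+1) E1 iter1_mk (mdelta_mk wfcode) // /mdn Eo mk_bt ET.
- case: w E1 => [|b' w] E1.
    case: e E1 => [|e] E1.
      have [T ET HT'] := Hback f q stp true (Some false) [:: None] d (at0 _).
      exists ((2 + d) + (1 + (1 + (1 + d.+1)))), T, d; split; [|by rewrite /o Eo; exists m, 1|by []|by lia].
      rewrite /o Eo /opres /inp (iterD (2 + d)) (iterD 1 (1 + (1 + d.+1))) (iterD 1 (1 + d.+1)) (iterD 1 d.+1) E1 iter1_mk (mdelta_mk wfcode) // /mdn Eo mk_bt.
      rewrite iter1_mk (mdelta_mk wfcode) // /mdn mk_bt.
      by rewrite iter1_mk (mdelta_mk wfcode) // /mdn mk_bt ET.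
    have [T ET HT'] := Hback f q stp true (Some false) (None :: nseq e None) d (at0 _).
    exists ((2 + d) + (1 + (1 + (1 + d.+1)))), T, d; split; [|by rewrite /o Eo; exists m, e.+1|by []|by lia].
    rewrite /o Eo /opres /inp (iterD (2 + d)) (iterD 1 (1 + (1 + d.+1))) (iterD 1 (1 + d.+1)) (iterD 1 d.+1) E1 iter1_mk (mdelta_mk wfcode) // /mdn Eo mk_bt.
    rewrite iter1_mk (mdelta_mk wfcode) // /mdn mk_bt.
    by rewrite iter1_mk (mdelta_mk wfcode) // /mdn mk_bt ET.
  have [T ET HT'] := Hback f q stp false (Some b') (map Some w ++ nseq e None) d.+1 (at0 _).
  exists ((2 + d.+1) + (1 + (1 + d.+1))), T, d.+1; split; [|by rewrite /o Eo; exists m, e|by []|by lia].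
  rewrite /o Eo /opres /inp (iterD (2 + d.+1)) (iterD 1 (1 + d.+1)) (iterD 1 d.+1) E1 iter1_mk (mdelta_mk wfcode) // /mdn Eo mk_bt.
  by rewrite iter1_mk (mdelta_mk wfcode) // /mdn mk_bt ET.
Qed.

Lemma home_sweep pc m r0 T : pc < N -> ~~ isinput (mop code pc) ->
  at_ 0 m (Some true) r0 T ->
  exists2 T', at_ 1 m (Some true) r0 T' &
    iter 1 stepm (home pc, T) = (mk pc 1 0 (fun=> false) (false, false) false false, T').
Proof.
move=> Hpc Hi; case: T => [[l a] r] HT; exists (move_left (l, Some true, r)); first exact: at_home HT.
case: HT => _ [-> _].
by rewrite homeE // iter1_mk (mdelta_mk wfcode) //= (negbTE Hi).
Qed.

Lemma sim_sweep pc m r0 J T (o := mop code pc) : pc < N -> ~~ isinput o ->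
  at_ 0 m (Some true) r0 T ->
  (forall j, j < J -> nxt o (qs o (mm m) j) (mm m j) <> None) ->
  nxt o (qs o (mm m) J) (mm m J) = None ->
  (forall j, j <= J -> swept K o (mm m) J j 0 = (j == 0)) ->
  exists t T' m', [/\ iter t stepm (home pc, T) = (home (target code pc (res o (mm m J))), T'),
    at_ 0 m' (Some true) r0 T',
    forall j k, k < B -> mm m' j k = swept K o (mm m) J j k & t <= J.+1 * (4 * B) + 1].
Proof.
move=> Hpc Hi HT H1 H2 H3.
have [T1 HT1 E1] := home_sweep Hpc Hi HT.
have [m' Hm' [t Ht /(_ _ HT1) [T2 [E2 HT2]]]] := sweep_goes wfcode KB (Some true) r0 Hpc H1 H2 H3.
exists (t + 1), T2, m'; split=> //; first by rewrite iterD E1.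
by rewrite leq_add2r.
Qed.

Lemma qs_id o m j : (forall q f q', nxt o q f = Some q' -> q' = q) ->
  qs o m j = (false, false).
Proof. by move=> H; elim: j => //= j ->; case E : (nxt _ _ _) => [q|] //; rewrite (H _ _ _ E). Qed.

(** [M] bounds the variables and the consumed input, hence the length of a sweep. One operation
    raises it by at most one, which makes the total overhead quadratic. *)
Lemma sim_op pc d s T M (o := mop code pc) : pc < N -> rep d s T ->
  (forall v, v < K -> vr s v <= M) -> d <= M ->
  exists t T' d', [/\ iter t stepm (home pc, T) = (home (target code pc (opres o s)), T'),
    rep d' (opst o s) T', d' <= M.+1, (forall v, v < K -> vr (opst o s) v <= M.+1)
    & t <= (M + 3) * (4 * B)].
Proof.
move=> Hpc Hrep HM HdM.
have Hvr : forall v, v < K -> vr (opst o s) v <= M.+1.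
  have := mop_wf wfcode pc; rewrite -/o => W v Hv; have Hle := leqW (HM _ Hv).
  by case: (o) W => //= [w W|w w' /and3P[W0 W1 W2]]; case: eqP => // E; [rewrite ltnS HM //; lia|apply: leqW (HM _ _)].
case: (boolP (isinput o)) => Hi.
  have [t [T' [d' [E R D Ht]]]] := sim_input Hpc Hi Hrep.
  by exists t, T', d'; split=> //; [lia|nia].
have Hinp : inp (opst o s) = inp s by case: (o) Hi.
case: Hrep => m [e [HT Hv Ht H0]].
have := mop_wf wfcode pc; rewrite -/o => W.
(* For each operation, [J] is the block where its sweep ends: the new value for [Inc], the larger
   value for [Cpy], the smaller one for a comparison, the index for [Put] and [Get]. *)
suff [J [J1 J2 J3 J4 [J5 J6]]] : exists J, [/\ J <= M.+1,
   forall j, j < J -> nxt o (qs o (mm m) j) (mm m j) <> None,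
   nxt o (qs o (mm m) J) (mm m J) = None,
   res o (mm m J) = opres o s &
   (forall j v, v < K -> swept K o (mm m) J j v = (j == vr (opst o s) v)) /\
   (forall j t, K <= t -> t < B -> swept K o (mm m) J j t = tr (opst o s) t j)].
  have Z : vr (opst o s) 0 = 0 by case: (o) W => //= [v|v w] W; rewrite ifF //; lia.
  have H3 : forall j, j <= J -> swept K o (mm m) J j 0 = (j == 0).
    by move=> j _; rewrite J5 // Z.
  have [t [T' [m' [E HT' Hm' Ht']]]] := sim_sweep Hpc Hi HT J2 J3 H3.
  rewrite -/o J4 in E.
  exists t, T', d; split=> //; [|by lia|by nia].
  exists m', e; split=> //; first by rewrite Hinp.
    by move=> j v Hv'; rewrite Hm' ?J5 //; lia.
  by move=> j k Hk Hk'; rewrite Hm' ?J6.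
case: (o) Hi W => //= [|v|v w|t v b|v w|v w|t v] _ W.
(* The guard on [f 0] in [upd] makes [Init] the identity on a memory that is already initialised, in
   agreement with [opst]. *)
- have H00 : mm m 0 0 by rewrite Hv // H0.
  exists 0; split; [| | | |split] => //.
  + by move=> j u Hu; rewrite /swept -Hv //= leqn0; case: eqP => // ->; rewrite H00.
  + by move=> j t Ht1 Ht2; rewrite /swept -Ht //= leqn0; case: eqP => // ->; rewrite H00.
- have Q j : j <= (vr s v).+1 -> qs (Inc v) (mm m) j = (vr s v < j, false).
    elim: j => //= j IH Hj; rewrite IH; last by lia.
    by rewrite /= ltnNge -ltnS Hj /= Hv ?ltnS; [congr (_, _); lia|lia].
  exists (vr s v).+1; split; [| | | |split].
  + by have := HM v; lia.
  + by move=> j Hj; rewrite Q /= ?ifF //; lia.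
  + by rewrite Q //= leqnn.
  + by [].
  + move=> j w Hw; rewrite /swept; case: (leqP j (vr s v).+1) => Hj; last first.
      by rewrite Hv //=; case: (w =P v) => // E; rewrite ?E; lia.
    by rewrite Q //=; case: (w =P v) => [_|_]; [lia|rewrite Hv].
  + move=> j t Ht1 Ht2; rewrite /swept; case: leqP => Hj; last by rewrite Ht.
    by rewrite /= ifF ?Ht //; lia.
- have [W0 W1 W2] := and3P W.
  have Q j : j <= maxn (vr s v) (vr s w) -> qs (Cpy v w) (mm m) j = (vr s v < j, vr s w < j).
    elim: j => //= j IH Hj; rewrite IH; last by lia.
    by rewrite /= !Hv // ifF /=; [congr (_, _); lia|lia].
  exists (maxn (vr s v) (vr s w)); split; [| | | |split].
  + by have := HM v W1; have := HM w W2; lia.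
  + by move=> j Hj; rewrite Q /= ?ifF ?Hv //; lia.
  + by rewrite Q //= !Hv // ifT //; lia.
  + by [].
  + move=> j u Hu; rewrite /swept; case: (leqP j (maxn (vr s v) (vr s w))) => Hj; last first.
      by rewrite Hv //=; case: (u =P v) => // E; rewrite ?E; lia.
    by rewrite /=; case: (u =P v) => [_|_]; rewrite Hv.
  + move=> j t Ht1 Ht2; rewrite /swept; case: leqP => Hj; last by rewrite Ht.
    by rewrite /= ifF ?Ht //; lia.
- have [W0 W1 W2] := and3P W.
  have Q j : qs (Put t v b) (mm m) j = (false, false).
    by apply: qs_id => q f q' /=; case: (f v) => // -[].
  exists (vr s v); split; [| | | |split].
  + by have := HM v W2; lia.
  + by move=> j Hj; rewrite Q /= Hv // ifF //; lia.
  + by rewrite Q /= Hv // eqxx.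
  + by [].
  + move=> j u Hu; rewrite /swept /=; case: leqP => _; last by rewrite Hv.
    by rewrite ifF ?Hv //; lia.
  + move=> j t' Ht1 Ht2; rewrite /swept /= (Hv j v W2) Ht //.
    case: leqP => // Hj; rewrite [RHS]ifF //; apply/andP => -[_ /eqP]; lia.
- have [W0 W1] := andP W.
  have Q j : qs (Eq v w) (mm m) j = (false, false).
    by apply: qs_id => q f q' /=; case: (f v || f w) => // -[].
  exists (minn (vr s v) (vr s w)); split; [| | | |split].
  + by have := HM v W0; lia.
  + by move=> j Hj; rewrite Q /= !Hv // ifF //; lia.
  + by rewrite Q /= !Hv // ifT //; lia.
  + by rewrite /= !Hv //; lia.
  + by move=> j u Hu; rewrite /swept /= if_same Hv.
  + by move=> j u Hu Hu'; rewrite /swept /= if_same Ht.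
- have [W0 W1] := andP W.
  have Q j : qs (Lt v w) (mm m) j = (false, false).
    by apply: qs_id => q f q' /=; case: (f v || f w) => // -[].
  exists (minn (vr s v) (vr s w)); split; [| | | |split].
  + by have := HM v W0; lia.
  + by move=> j Hj; rewrite Q /= !Hv // ifF //; lia.
  + by rewrite Q /= !Hv // ifT //; lia.
  + by rewrite /= !Hv //; lia.
  + by move=> j u Hu; rewrite /swept /= if_same Hv.
  + by move=> j u Hu Hu'; rewrite /swept /= if_same Ht.
- have [W0 W1 W2] := and3P W.
  have Q j : qs (Get t v) (mm m) j = (false, false).
    by apply: qs_id => q f q' /=; case: (f v) => // -[].
  exists (vr s v); split; [| | | |split].
  + by have := HM v W2; lia.
  + by move=> j Hj; rewrite Q /= Hv // ifF //; lia.
  + by rewrite Q /= Hv // eqxx.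
  + by rewrite /= Ht.
  + by move=> j u Hu; rewrite /swept /= if_same Hv.
  + by move=> j u Hu Hu'; rewrite /swept /= if_same Ht.
Qed.

End Simulation.

End Simulation.

(** * A loop language and its compilation to flat code *)

Module Language.
Import Machine Simulation.

(* [For i v c] runs [c] with [i = 0, ..., v - 1]; [Ones v] consumes the leading
   ones of the input and adds their number to [v]. *)
Inductive cmd :=
  | Do of op
  | Seq of cmd & cmd
  | If of op & cmd & cmd
  | For of nat & nat & cmd
  | Ones of nat.

Definition ones (i : bool * seq bool) : nat := find negb (i.1 :: i.2).

Fixpoint ev (c : cmd) (s : st) : st :=
  match c with
  | Do o => opst o s
  | Seq c1 c2 => ev c2 (ev c1 s)
  | If o c1 c2 => if opres o s then ev c1 (opst o s) else ev c2 (opst o s)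
  | For i v c => iter (vr s v) (fun s => opst (Inc i) (ev c s)) (setv s i 0)
  | Ones v => iter (ones (inp s)) (fun s => opst (Inc v) (opst Adv s)) s
  end.

(** The exact number of operations executed by the compiled code. In a loop, 2 stands for the reset
    of the counter and the last test, and [+ 2] for the test and the increment of each round. *)
Fixpoint tm (c : cmd) (s : st) : nat :=
  match c with
  | Do o => 1
  | Seq c1 c2 => tm c1 s + tm c2 (ev c1 s)
  | If o c1 c2 => 1 + (if opres o s then tm c1 (opst o s) else tm c2 (opst o s))
  | For i v c =>
    2 + \sum_(j < vr s v)
      (tm c (iter j (fun s => opst (Inc i) (ev c s)) (setv s i 0)) + 2)
  | Ones v => 3 * ones (inp s) + 1
  end.

Definition opmv (o : op) : seq nat :=
  match o with Inc v | Cpy v _ => [:: v] | _ => [::] end.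
Definition opmt (o : op) : seq nat :=
  match o with Put t _ _ => [:: t] | _ => [::] end.

Fixpoint mv (c : cmd) : seq nat :=
  match c with
  | Do o => opmv o
  | Seq c1 c2 => mv c1 ++ mv c2
  | If o c1 c2 => opmv o ++ mv c1 ++ mv c2
  | For i v c => i :: mv c
  | Ones v => [:: v]
  end.

Fixpoint mt (c : cmd) : seq nat :=
  match c with
  | Do o => opmt o
  | Seq c1 c2 => mt c1 ++ mt c2
  | If o c1 c2 => opmt o ++ mt c1 ++ mt c2
  | For i v c => mt c
  | Ones v => [::]
  end.

(** The body of a loop assigns neither the counter nor the bound, so the compiled equality test
    stops after the number of rounds fixed on entry. *)
Fixpoint wf (K B0 : nat) (c : cmd) : bool :=
  match c with
  | Do o => wfop K B0 o
  | Seq c1 c2 => wf K B0 c1 && wf K B0 c2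
  | If o c1 c2 =>
    [&& wfop K B0 o, wf K B0 c1 & wf K B0 c2]
  | For i v c =>
    [&& 0 < i, i < K, v < K, i != v, i \notin mv c, v \notin mv c & wf K B0 c]
  | Ones v => 0 < v < K
  end.

Lemma opst_vr o s v : v \notin opmv o -> vr (opst o s) v = vr s v.
Proof. by case: o => //= [w|w w']; rewrite ?inE => // /negbTE ->. Qed.

Lemma opst_tr o s t : t \notin opmt o -> tr (opst o s) t = tr s t.
Proof.
by case: o => //= t' v b; rewrite inE => /negbTE ->.
Qed.

Lemma ev_vr c s v : v \notin mv c -> vr (ev c s) v = vr s v.
Proof.
elim: c s => [o|c1 IH1 c2 IH2|o c1 IH1 c2 IH2|i w c IH|w] s /=.
- exact: opst_vr.
- by rewrite mem_cat negb_or => /andP[H1 H2]; rewrite IH2 // IH1.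
- rewrite !mem_cat !negb_or => /and3P[H0 H1 H2].
  by case: ifP => _; rewrite ?IH1 ?IH2 // opst_vr.
- rewrite inE negb_or => /andP[/negbTE H1 H2].
  elim: (vr s w) => [|n IHn] /=; first by rewrite H1.
  by rewrite H1 IH.
- by rewrite inE => /negbTE H; elim: (ones _) => //= n IHn; rewrite H.
Qed.

Lemma ev_tr c s t : t \notin mt c -> tr (ev c s) t = tr s t.
Proof.
elim: c s => [o|c1 IH1 c2 IH2|o c1 IH1 c2 IH2|i w c IH|w] s /=.
- exact: opst_tr.
- by rewrite mem_cat negb_or => /andP[H1 H2]; rewrite IH2 // IH1.
- rewrite !mem_cat !negb_or => /and3P[H0 H1 H2].
  by case: ifP => _; rewrite ?IH1 ?IH2 // opst_tr.
- by move=> H; elim: (vr s w) => [|n IHn] //=; rewrite IH.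
- by move=> _; elim: (ones _) => //= n IHn.
Qed.

Fixpoint len (c : cmd) : nat :=
  match c with
  | Do o => 1
  | Seq c1 c2 => len c1 + len c2
  | If o c1 c2 => 1 + (len c1 + len c2)
  | For i v c => 2 + (len c + 1)
  | Ones v => 3
  end.

(** Code to be placed at address [b] and left through address [e]. *)
Fixpoint comp (c : cmd) (b e : nat) : seq (op * nat * nat) :=
  match c with
  | Do o => [:: (o, e, e)]
  | Seq c1 c2 => comp c1 b (b + len c1) ++ comp c2 (b + len c1) e
  | If o c1 c2 => (o, b.+1, b.+1 + len c1) ::
      comp c1 b.+1 e ++ comp c2 (b.+1 + len c1) e
  | For i v c => [:: (Cpy i 0, b.+1, b.+1), (Eq i v, e, b.+2) &
      comp c b.+2 (b.+2 + len c) ++ [:: (Inc i, b.+1, b.+1)]]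
  | Ones v => [:: (Cur, b.+1, e); (Adv, b.+2, b.+2); (Inc v, b, b)]
  end.

Lemma size_comp c b e : size (comp c b e) = len c.
Proof.
elim: c b e => [o|c1 IH1 c2 IH2|o c1 IH1 c2 IH2|i w c IH|w] b e //=.
- by rewrite size_cat IH1 IH2.
- by rewrite size_cat IH1 IH2.
- by rewrite size_cat IH.
Qed.

Section Flat.
Variables (K B0 : nat) (code : seq (op * nat * nat)).

Definition fstep (x : nat * st) : nat * st :=
  if x.1 < size code then
    (target code x.1 (opres (mop code x.1) x.2), opst (mop code x.1) x.2)
  else x.

Lemma fstepE pre o e1 e2 post b s : code = pre ++ (o, e1, e2) :: post -> size pre = b ->
  fstep (b, s) = ((if opres o s then e1 else e2), opst o s).
Proof.
move=> E <-; rewrite /fstep E /= size_cat /= addnS ltnS leq_addr.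
by rewrite /target /mop nth_cat ltnn subnn.
Qed.

Lemma ones_step (i : bool * seq bool) : i.1 -> ones i = (ones (inp (opst Adv (St (fun=> 0) (fun _ _ => false) i)))).+1.
Proof. by case: i => [[] [|b r]]. Qed.

(** Induction on [c] inside an arbitrary context [pre], [post]. That variable 0 vanishes is carried
    along because loops reset their counter by copying it. *)
Lemma comp_correct c b e pre post s : wf K B0 c -> vr s 0 = 0 ->
  code = pre ++ comp c b e ++ post -> size pre = b ->
  iter (tm c s) fstep (b, s) = (e, ev c s) /\ vr (ev c s) 0 = 0.
Proof.
elim: c b e pre post s => [o|c1 IH1 c2 IH2|o c1 IH1 c2 IH2|i w c IH|w] b e pre post s; rewrite [wf _ _ _]/= [comp _ _ _]/= [tm _ _]/= [ev _ _]/=.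
- move=> Wo s0 E sb; rewrite [iter 1 _ _]/= (fstepE _ E sb) if_same; split=> //.
  by rewrite opst_vr //; case: (o) Wo => //= [v|v w]; rewrite inE => ?; lia.
- move=> /andP[W1 W2] s0 E sb.
  have [E1 S1] := IH1 b (b + len c1) pre (comp c2 (b + len c1) e ++ post) s W1 s0
    ltac:(by rewrite E -!catA) sb.
  have [E2 S2] := IH2 (b + len c1) e (pre ++ comp c1 b (b + len c1)) post _ W2 S1
    ltac:(by rewrite E -!catA) ltac:(by rewrite size_cat size_comp sb).
  by split=> //; rewrite addnC iterD E1.
- move=> /and3P[Wo W1 W2] s0 E sb.
  have s0' : vr (opst o s) 0 = 0.
    by rewrite opst_vr //; case: (o) Wo => //= [v|v w]; rewrite inE => ?; lia.
  rewrite (addnC 1) iterD [iter 1 _ _]/= (fstepE _ E sb); case: ifP => _.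
    apply: (IH1 b.+1 e (rcons pre (o, b.+1, b.+1 + len c1)) (comp c2 (b.+1 + len c1) e ++ post)) => //.
      by rewrite cat_rcons E /= -?catA.
    by rewrite size_rcons sb.
  apply: (IH2 (b.+1 + len c1) e (pre ++ (o, b.+1, b.+1 + len c1) :: comp c1 b.+1 e) post) => //.
    by rewrite E -?catA /= -?catA.
  by rewrite size_cat /= size_comp sb; lia.
- move=> /and5P[i0 iK wK iw /and3P[ic wc Wc]] s0 E sb.
  pose body s := setv (ev c s) i (vr (ev c s) i).+1; set s1 := setv s i 0.
  rewrite -!/(body _) -[fun s => setv (ev c s) i _]/body.
  have inv j : vr (iter j body s1) i = j /\ vr (iter j body s1) w = vr s w.
    elim: j => [|j [IHj1 IHj2]] /=; first by rewrite eqxx eq_sym (negbTE iw).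
    by rewrite eqxx eq_sym (negbTE iw) !ev_vr // IHj1 IHj2.
  have E2 : code = rcons pre (Cpy i 0, b.+1, b.+1) ++ (Eq i w, e, b.+2) ::
      ((comp c b.+2 (b.+2 + len c) ++ [:: (Inc i, b.+1, b.+1)]) ++ post).
    by rewrite cat_rcons E.
  have E3 : code = (pre ++ [:: (Cpy i 0, b.+1, b.+1); (Eq i w, e, b.+2)]) ++
      comp c b.+2 (b.+2 + len c) ++ ((Inc i, b.+1, b.+1) :: post).
    by rewrite E -?catA /= -?catA.
  have E4 : code = (pre ++ [:: (Cpy i 0, b.+1, b.+1), (Eq i w, e, b.+2) &
      comp c b.+2 (b.+2 + len c)]) ++ (Inc i, b.+1, b.+1) :: post.
    by rewrite E -?catA /= -?catA.
  have loop j : j <= vr s w ->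
      iter (\sum_(j' < j) (tm c (iter j' body s1) + 2)) fstep (b.+1, s1) = (b.+1, iter j body s1)
      /\ vr (iter j body s1) 0 = 0.
    elim: j => [|j IHj] Hj; first by rewrite big_ord0 /= s0; case: ifP.
    have [F1 F2] := IHj (ltnW Hj); rewrite big_ord_recr /= addnC iterD F1.
    have [I1 I2] := inv j.
    have [G1 G2] := IH b.+2 (b.+2 + len c) _ _ (iter j body s1) Wc F2 E3
      ltac:(by rewrite size_cat /= sb addn2).
    rewrite addnS addn1 iterS iterSr (fstepE _ E2 (b := b.+1)); last by rewrite size_rcons sb.
    rewrite /= I1 I2 ifF; last by lia.
    rewrite G1 (fstepE _ E4 (b := b.+2 + len c)); last by rewrite size_cat /= size_comp sb; lia.
    by split=> //=; rewrite ifF //; lia.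
  have [F1 F2] := loop _ (leqnn (vr s w)); have [I1 I2] := inv (vr s w).
  split=> //; rewrite addSn add1n iterS iterSr (fstepE _ E sb) /= s0.
  rewrite -/s1 F1 (fstepE _ E2 (b := b.+1)); last by rewrite size_rcons sb.
  by rewrite /= I1 I2 eqxx.
- move=> /andP[w0 wK] s0 E sb.
  have E2 : code = rcons pre (Cur, b.+1, e) ++ (Adv, b.+2, b.+2) ::
      [:: (Inc w, b, b)] ++ post by rewrite cat_rcons E.
  have E3 : code = (pre ++ [:: (Cur, b.+1, e); (Adv, b.+2, b.+2)]) ++
      (Inc w, b, b) :: post by rewrite E -?catA.
  move: {-1}(ones _) (erefl (ones (inp s))) => k.
  elim: k s s0 => [|k IHk] s s0 Ek.
    rewrite /= (fstepE _ E sb) /=; split=> //.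
    by case: (inp s) Ek => [[] r].
  have Hc : (inp s).1 by case: (inp s) Ek => [[] r].
  rewrite !(iterSr k) (_ : 3 * k.+1 + 1 = 3 * k + 1 + 3); last by lia.
  rewrite iterD iterSr iterSr [iter 1 _ _]/= (fstepE _ E sb) /= Hc.
  rewrite (fstepE _ E2 (b := b.+1)) /=; last by rewrite size_rcons sb.
  rewrite if_same (fstepE _ E3 (b := b.+2)) /=; last by rewrite size_cat /= sb addn2.
  apply: IHk; first by rewrite /= ifF //; lia.
  by move: Ek; rewrite ones_step // => -[].
Qed.

End Flat.

Section Run.
Variables (K B0 ans : nat) (c : cmd).
Hypotheses (K_gt0 : 0 < K) (KB : K <= B0.+2) (ansP : K <= ans < B0.+2) (wfc : wf K B0 c).

(** The last operation reads entry 0 of the track [ans] and jumps to the size of the program, which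
    accepts, or one further, which rejects. *)
Definition prog : seq (op * nat * nat) :=
  (Init, 1, 1) :: comp c 1 (1 + len c) ++ [:: (Get ans 0, len c + 2, len c + 3)].

Lemma wf_comp c' b e : wf K B0 c' -> all (fun x => wfop K B0 x.1.1) (comp c' b e).
Proof.
elim: c' b e => [o|c1 IH1 c2 IH2|o c1 IH1 c2 IH2|i w c' IH|w] b e /=.
- by move=> ->.
- by case/andP => W1 W2; rewrite all_cat IH1 ?IH2.
- by case/and3P => -> W1 W2; rewrite all_cat IH1 ?IH2.
- by case/and5P => i0 iK wK iw /and3P[ic wc Wc]; rewrite all_cat IH //= i0 iK wK K_gt0.
- by move=> ->.
Qed.

Lemma wf_prog : all (fun x => wfop K B0 x.1.1) prog.
Proof. by rewrite /= all_cat wf_comp //=; move: ansP => /andP[-> ->]; rewrite K_gt0. Qed.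

Definition init_st (i : bool * seq bool) : st := St (fun=> 0) (fun _ _ => false) i.


Notation stepm := (step (M := machine K B0 prog)).
Notation home := (home B0 prog).

Lemma sim_flat k pc d s T M : rep K B0 d s T -> (forall v, v < K -> vr s v <= M) -> d <= M ->
  exists t T' d', [/\ iter t stepm (home pc, T) = (home (iter k (fstep prog) (pc, s)).1, T'),
    rep K B0 d' (iter k (fstep prog) (pc, s)).2 T', d' <= M + k,
    (forall v, v < K -> vr (iter k (fstep prog) (pc, s)).2 v <= M + k)
    & t <= k * ((M + k + 3) * (4 * B0.+2))].
Proof.
elim: k pc d s T M => [|k IH] pc d s T M HT Hv Hd.
  by exists 0, T, d; rewrite addn0.
rewrite iterSr; case: (ltnP pc (size prog)) => Hpc; last first.
  have -> : fstep prog (pc, s) = (pc, s) by rewrite /fstep /= ltnNge Hpc.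
  have [t [T' [d' [E1 E2 E3 E4 E5]]]] := IH pc d s T M HT Hv Hd.
  exists t, T', d'; split=> //; first by lia.
    by move=> v /E4; lia.
  by apply: leq_trans E5 _; apply: leq_mul => //; rewrite leq_mul2r; lia.
have [t [T' [d' [E1 E2 E3 E4 E5]]]] := sim_op wf_prog K_gt0 KB Hpc HT Hv Hd.
have -> : fstep prog (pc, s) = (target prog pc (opres (mop prog pc) s), opst (mop prog pc) s).
  by rewrite /fstep /= Hpc.
have [t2 [T2 [d2 [F1 F2 F3 F4 F5]]]] := IH (target prog pc (opres (mop prog pc) s)) d' _ T' M.+1 E2 E4 E3.
exists (t2 + t), T2, d2; split=> //.
- by rewrite iterD E1.
- by rewrite addnS -addSn.
- by move=> v /F4; rewrite addSn addnS.
- rewrite addSn -addnS in F5; rewrite mulSn [t2 + t]addnC leq_add //.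
  by apply: leq_trans E5 _; rewrite leq_mul2r; lia.
Qed.

(** Such an input encodes the empty graph. Phase 0 accepts at once when the home cell holds [false];
    this is never seen again, since that cell is not rewritten. *)
Lemma run_false r : (run (machine K B0 prog) (false :: r) 1).1 = q_acc (machine K B0 prog).
Proof.
have N0 : 0 < size prog by [].
rewrite /run /init_config [map _ _]/= -[q_start _]/(home 0) (homeE B0 N0) iter1_mk.
by rewrite (mdelta_mk wf_prog) // mk_bt.
Qed.

Theorem run_prog b r (s := init_st (b, r)) :
  exists2 t, t <= (tm c s + 5) * (tm c s + 5) * (4 * B0.+2) &
    (run (machine K B0 prog) [:: true, b & r] t).1 =
    if tr (ev c s) ans 0 then q_acc (machine K B0 prog) else q_rej (machine K B0 prog).
Proof.
have sz : size prog = len c + 2 by rewrite /= size_cat size_comp /= addn1 addn2.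
pose m : nat -> sym := fun=> None.
have H0 : at_ 0 m (Some true) (nseq 0 None ++ Some b :: map Some r ++ nseq 0 None)
    ([::], Some true, Some b :: map Some r).
  by split=> [i|]; rewrite ?nth_nil //= cats0.
have mN j k : mm B0 m j k = false by [].
have sw j k : swept K Init (mm B0 m) 0 j k = (j == 0) && (k < K).
  by rewrite /swept leqn0; case: eqP.
have [t1 [T1 [m1 [E1 A1 M1 L1]]]] := @sim_sweep K B0 prog wf_prog KB 0 m _ 0 _
  isT isT H0 (fun j (H : j < 0) => False_ind _ (notF H)) erefl
  (fun j _ => etrans (sw j 0) (etrans (congr1 (andb _) K_gt0) (andbT _))).
rewrite /target /= in E1.
have R1 : rep K B0 0 s T1.
  exists m1, 0; split=> //.
    by move=> j v Hv; rewrite M1 ?sw ?Hv ?andbT //; lia.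
  by move=> j t Ht Ht'; rewrite M1 // sw ltnNge Ht andbF.
have [C1 C2] := @comp_correct K B0 prog c 1 (1 + len c) [:: (Init, 1, 1)]
  [:: (Get ans 0, len c + 2, len c + 3)] s wfc erefl erefl erefl.
have F : iter (tm c s).+1 (fstep prog) (1, s) =
    ((if tr (ev c s) ans 0 then len c + 2 else len c + 3), ev c s).
  rewrite iterS C1.
  rewrite (@fstepE prog ((Init, 1, 1) :: comp c 1 (1 + len c)) (Get ans 0) (len c + 2) (len c + 3) [::]) //.
    by rewrite /= C2.
  by rewrite /= size_comp.
have [t2 [T2 [d2 [E2 _ _ _ L2]]]] := @sim_flat (tm c s).+1 1 0 s T1 0 R1 (fun v _ => leqnn 0) (leqnn 0).
rewrite F /= in E2.
exists (t2 + t1).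
  apply: leq_trans (_ : ((tm c s).+1 * (tm c s + 4) + 2) * (4 * B0.+2) <= _).
    rewrite mulnDl -mulnA addnC (addnC _ (2 * _)); apply: leq_add.
      by apply: leq_trans L1 _; lia.
    by rewrite add0n addSn -addnS in L2.
  by rewrite leq_mul2r; apply/orP; right; rewrite mulSn mulnDr !mulnDl; lia.
have Hacc : home (len c + 2) = inr true by rewrite /Machine.home sz ltnn eqxx.
have Hrej : home (len c + 3) = inr false.
  by rewrite /Machine.home sz ltn_add2l eqn_add2l.
rewrite /run /init_config [map _ _]/= -[q_start _]/(home 0) iterD E1 E2 [fst _]/=.
by case: (tr _ _ _); rewrite ?Hacc ?Hrej.
Qed.

End Run.

End Language.

(** * Threads: the walks through the vertices outside Y, all of degree two *)

Module Threads.

Section Walk.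
Variables (n : nat) (E : {set {set 'I_n}}).
Notation V := 'I_n.
Notation adj := (adj E).

Lemma adjC : symmetric adj.
Proof. by move=> x y; rewrite /Defs.adj setUC. Qed.

Hypothesis simpleE : simple_graph E.

Lemma adj_irr x : adj x x = false.
Proof.
by apply/negP => /simpleE; rewrite setUid cards1.
Qed.

Variable Y : {set V}.

(** The last admissible neighbour is chosen because a program loop that overwrites a variable at
    each hit computes exactly this one. *)
Definition lastnb (P : pred V) (z d : V) : V :=
  foldl (fun acc w => if adj z w && P w then w else acc) d (enum V).

Definition nx (u z : V) : V := lastnb (fun w => w != u) z z.
Definition zn (y : V) : V := lastnb (fun b => b \notin Y) y y.

(** A dart is the previous and the current vertex of the walk; remembering the former determines the
    next step at a vertex of degree two. The walk halts on Y. *)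
Definition wstep (d : V * V) : V * V := if d.2 \in Y then d else (d.2, nx d.1 d.2).
Definition dart (y : V) (j : nat) : V * V := iter j wstep (y, zn y).
Definition th (y : V) (j : nat) : V := (dart y j).2.
Definition port (y : V) : bool := (y \in Y) && (zn y \notin Y).
Definition tlen (y : V) : nat := find (fun j => th y j \in Y) (iota 0 n.+1).
Definition partner (y : V) : V := th y (tlen y).

Lemma lastnbP (P : pred V) z d :
  (adj z (lastnb P z d) && P (lastnb P z d)) ||
  ((lastnb P z d == d) && [forall w, adj z w ==> ~~ P w]).
Proof.
rewrite /lastnb.
have : forall s d, let r := foldl (fun acc w => if adj z w && P w then w else acc) d s in
   (adj z r && P r) || ((r == d) && all (fun w => adj z w ==> ~~ P w) s).
  elim/last_ind => [d'|s x IH d'] /=; first by rewrite eqxx orbT.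
  rewrite foldl_rcons all_rcons; case: ifP => [->//|/negbT Hx].
  by have -> : adj z x ==> ~~ P x by apply/implyP => Ha; rewrite Ha in Hx.
move=> /(_ (enum V) d) /= /orP[->//|/andP[-> /allP H]].
by apply/orP; right; apply/forallP => w; apply: H; rewrite mem_enum.
Qed.

Hypothesis deg2 : forall z, z \notin Y -> exists u w, u != w /\ forall v, adj z v = (v == u) || (v == w).
Hypothesis one_port : forall y b b', y \in Y -> adj y b -> b \notin Y -> adj y b' -> b' \notin Y -> b = b'.

Lemma nxP u z : z \notin Y -> adj z u ->
  [/\ adj z (nx u z), nx u z != u & forall v, adj z v = (v == u) || (v == nx u z)].
Proof.
move=> /deg2 [a [b [ab H]]] zu.
have Hn : adj z (nx u z) && (nx u z != u).
  have /orP[//|/andP[_ /forallP Hall]] := lastnbP (fun w => w != u) z z.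
  have := Hall a; have := Hall b; rewrite !H !eqxx orbT /= !negbK => /eqP eb /eqP ea.
  by rewrite ea eb eqxx in ab.
case/andP: Hn => H1 H2; split=> // v; rewrite H.
move: zu H1 H2; rewrite !H => /orP[] /eqP -> /orP[] /eqP ->; rewrite ?eqxx // => _; by rewrite 1?orbC.
Qed.

Lemma znP y b : y \in Y -> adj y b -> b \notin Y -> zn y = b.
Proof.
move=> yY yb bY; have /orP[/andP[H1 H2]|/andP[_ /forallP/(_ b)]] := lastnbP (fun b => b \notin Y) y y.
  exact: one_port yY H1 H2 yb bY.
by rewrite yb bY.
Qed.

Lemma port_adj y : port y -> adj y (zn y).
Proof.
case/andP => yY zY; have /orP[/andP[]//|/andP[/eqP E1 _]] := lastnbP (fun b => b \notin Y) y y.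
by rewrite /zn E1 yY in zY.
Qed.

Lemma dartS y j : th y j \notin Y -> dart y j.+1 = (th y j, nx (dart y j).1 (th y j)).
Proof. by rewrite /dart /= /wstep -/(dart y j) -/(th y j) => /negbTE ->. Qed.

Lemma dart_stop y j k : th y j \in Y -> j <= k -> dart y k = dart y j.
Proof.
move=> H /subnK <-; elim: (k - j) => // i IH.
by rewrite addSn /dart /= -/(dart y (i + j)) IH /wstep -/(th y j) H.
Qed.

Lemma dart_adj y j : port y -> adj (th y j) (dart y j).1.
Proof.
move=> py; elim: j => [|j IH]; first by rewrite adjC; apply: port_adj.
case: (boolP (th y j \in Y)) => H; first by rewrite /th (dart_stop H (leqnSn _)).
rewrite /th (dartS H) /=; have [H1 _ _] := nxP H IH; by rewrite adjC.
Qed.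

Lemma th0 y : th y 0 = zn y. Proof. by []. Qed.

Definition pth (y : V) (j : nat) : V := if j is j'.+1 then th y j' else y.

Lemma dart_fst y j : (forall i, i < j -> th y i \notin Y) -> (dart y j).1 = pth y j.
Proof. by case: j => // j H; rewrite dartS // H. Qed.

Lemma th_nb y j v : port y -> (forall i, i <= j -> th y i \notin Y) ->
  adj (th y j) v = (v == pth y j) || (v == th y j.+1).
Proof.
move=> py H; rewrite -dart_fst; last by move=> i Hi; apply: H; apply: ltnW.
by have [_ _ ->] := nxP (H j (leqnn _)) (dart_adj j py); rewrite /th dartS ?H.
Qed.

Lemma th_neq2 y j : port y -> (forall i, i <= j -> th y i \notin Y) -> th y j.+1 != pth y j.
Proof.
move=> py H; rewrite -dart_fst; last by move=> i Hi; apply: H; apply: ltnW.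
by have [_ Hn _] := nxP (H j (leqnn _)) (dart_adj j py); rewrite /th (dartS (H j (leqnn _))).
Qed.

(** A first repetition [th y i = th y j.+1] makes [th y j] one of the two walk neighbours of
    [th y i]. This means an earlier repetition, a visit to [y], a loop, or a step straight back, all
    impossible. *)
Lemma th_inj_aux y k : port y -> (forall i, i < k -> th y i \notin Y) ->
  forall i j, i < j < k -> th y i <> th y j.
Proof.
move=> py; elim: k => [|k IH] H i j /andP[Hij Hj]; first by rewrite ltn0 in Hj.
have H' : forall i, i < k -> th y i \notin Y by move=> l Hl; apply: H; apply: ltnW.
case: (ltnP j k) => Hjk; first by apply: IH => //; rewrite Hij.
have {Hj Hjk} Ej : j = k by lia.
subst k; case: j IH H H' Hij => // j IH H H' Hij E1.
have Hj : forall l, l <= j -> th y l \notin Y by move=> l Hl; apply: H; lia.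
have Hi : forall l, l <= i -> th y l \notin Y by move=> l Hl; apply: Hj; lia.
(* the vertex preceding the repetition is a neighbour of [th y i] *)
have : adj (th y i) (th y j) by rewrite E1 adjC th_nb // eqxx orbT.
rewrite th_nb // => /orP[/eqP E2|/eqP E2].
  case: i Hij E1 Hi E2 => [|i] Hij E1 Hi /= E2.
    by have := Hj j (leqnn _); rewrite E2; case/andP: py => ->.
  by case: (IH H' i j) => //; lia.
case: (ltngtP i.+1 j) => Hlt; first by case: (IH H' i.+1 j) => //; lia.
  have Eij : i = j by lia.
  by have := th_nb (th y j.+1) py Hj; rewrite -E1 Eij adj_irr eqxx orbT.
by subst j; have := th_neq2 py Hj; rewrite /= E1 eqxx.
Qed.

(** Otherwise the first n + 1 vertices of the walk would be distinct. *)
Lemma tlen_ex y : port y -> has (fun j => th y j \in Y) (iota 0 n.+1).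
Proof.
move=> py; apply: contraT => /hasPn H.
have H' i : i < n.+1 -> th y i \notin Y by move=> Hi; apply: H; rewrite mem_iota.
have inj : injective (fun i : 'I_n.+1 => th y i).
  move=> i j Eij; apply/val_inj/eqP; case: (ltngtP i j) => //= Hij; exfalso.
    by apply: (th_inj_aux py H' _ Eij); rewrite Hij /=.
  by apply: (th_inj_aux py H' _ (esym Eij)); rewrite Hij /=.
by have := leq_card _ inj; rewrite !card_ord ltnn.
Qed.

Lemma tlen_le y : port y -> tlen y <= n.
Proof. by move=> /tlen_ex; rewrite has_find size_iota. Qed.

Lemma th_tlen y : port y -> th y (tlen y) \in Y.
Proof.
move=> py; have := nth_find 0 (tlen_ex py); rewrite nth_iota //.
by have := tlen_ex py; rewrite has_find size_iota.
Qed.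

Lemma th_lt y j : port y -> j < tlen y -> th y j \notin Y.
Proof.
move=> py Hj; have := before_find 0 Hj; rewrite nth_iota ?add0n => [->//|].
by have := tlen_le py; lia.
Qed.

Lemma tlen_gt0 y : port y -> 0 < tlen y.
Proof.
move=> py; case: (posnP (tlen y)) => // E0; have := th_tlen py; rewrite E0 th0.
by case/andP: py => _ /negbTE ->.
Qed.

Lemma tlen_uniq y j : port y -> th y j \in Y -> (forall i, i < j -> th y i \notin Y) -> tlen y = j.
Proof.
move=> py H1 H2; case: (ltngtP (tlen y) j) => // H.
  by have := H2 _ H; rewrite th_tlen.
by have := th_lt py H; rewrite H1.
Qed.

Lemma th_inj y i j : port y -> i < tlen y -> j < tlen y -> th y i = th y j -> i = j.
Proof.
move=> py Hi Hj; have H := @th_inj_aux y (tlen y) py (fun k => @th_lt y k py).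
case: (ltngtP i j) => // Hij E1; first by case: (H i j) => //; rewrite Hij.
by case: (H j i) => //; rewrite Hij.
Qed.

Lemma th_nbE y j v : port y -> j < tlen y ->
  adj (th y j) v = (v == pth y j) || (v == th y j.+1).
Proof. by move=> py Hj; apply: th_nb => // i Hi; apply: th_lt => //; lia. Qed.

Lemma partner_Y y : port y -> partner y \in Y. Proof. exact: th_tlen. Qed.

Lemma zn_partner y : port y -> zn (partner y) = th y (tlen y).-1.
Proof.
move=> py; have L0 := tlen_gt0 py; apply: znP; first exact: partner_Y.
  by rewrite adjC th_nbE ?prednK // eqxx orbT.
by apply: th_lt => //; rewrite prednK.
Qed.

Lemma port_partner y : port y -> port (partner y).
Proof.
move=> py; rewrite /port partner_Y // zn_partner // th_lt //.
by rewrite prednK // tlen_gt0.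
Qed.

(** The walk from the other port is the same walk reversed. It starts correctly because [one_port]
    leaves the partner a single neighbour outside Y. *)
Lemma dart_partner y j : port y -> j <= tlen y ->
  dart (partner y) j = (pth y (tlen y - j).+1, pth y (tlen y - j)).
Proof.
move=> py; have L0 := tlen_gt0 py; elim: j => [|j IH] Hj.
  rewrite subn0 /dart /= zn_partner //; congr (_, _).
  by case: (tlen y) L0.
have Ej : tlen y - j = (tlen y - j.+1).+1 by lia.
have E1 : th (partner y) j = th y (tlen y - j.+1).
  by rewrite /th IH ?Ej //; lia.
have Hk : tlen y - j.+1 < tlen y by lia.
have Hn : th (partner y) j \notin Y by rewrite E1; apply: th_lt.
rewrite dartS // E1 IH; last by lia.
rewrite Ej /=; congr (_, _).
have [H1 H2 H3] : [/\ adj (th y (tlen y - j.+1)) (nx (th y (tlen y - j.+1).+1) (th y (tlen y - j.+1))),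
    nx (th y (tlen y - j.+1).+1) (th y (tlen y - j.+1)) != th y (tlen y - j.+1).+1 & True].
  have Ha : adj (th y (tlen y - j.+1)) (th y (tlen y - j.+1).+1).
    by rewrite th_nbE // eqxx orbT.
  by have [A1 A2 A3] := nxP (th_lt py Hk) Ha.
by move: H1; rewrite th_nbE // (negbTE H2) orbF => /eqP.
Qed.

Lemma th_partner y j : port y -> j <= tlen y -> th (partner y) j = pth y (tlen y - j).
Proof. by move=> py Hj; rewrite /th dart_partner. Qed.

Lemma tlen_partner y : port y -> tlen (partner y) = tlen y.
Proof.
move=> py; apply: tlen_uniq => [||i Hi]; first exact: port_partner.
  by rewrite th_partner // subnn; case/andP: py.
rewrite th_partner // ?(ltnW Hi) //.
have -> : tlen y - i = (tlen y - i.+1).+1 by lia.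
by apply: th_lt => //; lia.
Qed.

Lemma partnerK y : port y -> partner (partner y) = y.
Proof. by move=> py; rewrite {1}/partner tlen_partner // th_partner // subnn. Qed.

(** Equal ports would have the same outer neighbour, so the thread would start and end with the same
    vertex and have length one; but the two neighbours of that vertex are distinct. *)
Lemma partner_neq y : port y -> partner y != y.
Proof.
move=> py; apply/eqP => E1; have L0 := tlen_gt0 py.
have E2 : th y 0 = th y (tlen y).-1 by rewrite -zn_partner // E1.
have := th_inj py L0 _ E2; rewrite prednK // => /(_ (leqnn _)) E3.
have L1 : tlen y = 1 by lia.
by have := @th_neq2 y 0 py; rewrite -[th y 1]/(th y 1) -{1}L1 /= -/(partner y) E1 eqxx => H; apply: notF; apply: H => i; rewrite leqn0 => /eqP ->; apply: th_lt.
Qed.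

(** The walk is reversible: a dart inside a thread determines the one before it, so two walks with a
    common dart agree back to their ports. *)
Lemma dart_inj y1 y2 i j : port y1 -> port y2 -> i < tlen y1 -> j < tlen y2 ->
  dart y1 i = dart y2 j -> y1 = y2 /\ i = j.
Proof.
move=> p1 p2; elim: i j => [|i IH] [|j] Hi Hj; first by case.
- rewrite (dartS (th_lt p2 (ltnW Hj))) => -[E1 _].
  by have := th_lt p2 (ltnW Hj); rewrite -E1; case/andP: p1 => ->.
- rewrite (dartS (th_lt p1 (ltnW Hi))) => -[E1 _].
  by have := th_lt p1 (ltnW Hi); rewrite E1; case/andP: p2 => ->.
rewrite (dartS (th_lt p1 (ltnW Hi))) (dartS (th_lt p2 (ltnW Hj))) => -[E1 E2].
have [] := IH j (ltnW Hi) (ltnW Hj); last by move=> -> ->.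
have [A1 A2 A3] := nxP (th_lt p1 (ltnW Hi)) (dart_adj i p1).
have := dart_adj j p2; rewrite -E1 A3 => /orP[/eqP E3|/eqP E3].
  by rewrite [dart y1 i]surjective_pairing [dart y2 j]surjective_pairing -E3 -[(dart y1 i).2]/(th y1 i) E1.
have [B1 B2 B3] := nxP (th_lt p2 (ltnW Hj)) (dart_adj j p2).
by rewrite -E2 E3 eqxx in B2.
Qed.

(** Two walks through the same vertex of degree two run in the same direction, and share a dart, or
    in opposite directions, and then the second shares a dart with the reversed first. *)
Lemma th_same y1 y2 i j : port y1 -> port y2 -> i < tlen y1 -> j < tlen y2 ->
  th y1 i = th y2 j -> (y1 = y2 /\ i = j) \/ (y2 = partner y1 /\ j = (tlen y1).-1 - i).
Proof.
move=> p1 p2 Hi Hj E1.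
have A1 : (dart y1 i).1 = pth y1 i by apply: dart_fst => k Hk; apply: th_lt => //; lia.
have A2 : (dart y2 j).1 = pth y2 j by apply: dart_fst => k Hk; apply: th_lt => //; lia.
have : adj (th y1 i) (pth y2 j) by rewrite E1 th_nbE // eqxx.
rewrite th_nbE // => /orP[/eqP E2|/eqP E2].
  left; apply: dart_inj => //.
  by rewrite [dart y1 i]surjective_pairing [dart y2 j]surjective_pairing A1 A2 E2 -/(th y1 i) -/(th y2 j) E1.
right; have pp := port_partner p1.
have Hk : (tlen y1).-1 - i < tlen (partner y1) by rewrite tlen_partner //; lia.
suff E0 : dart (partner y1) ((tlen y1).-1 - i) = dart y2 j.
  by have [<- <-] := dart_inj pp p2 Hk Hj E0.
rewrite dart_partner //; last by lia.
have -> : tlen y1 - ((tlen y1).-1 - i) = i.+1 by lia.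
by rewrite [dart y2 j]surjective_pairing A2 E2 -/(th y2 j) -E1.
Qed.

Definition thr (y : V) : {set V} := [set th y (nat_of_ord j) | j : 'I_(tlen y)].

Lemma thrP y v : reflect (exists2 j, j < tlen y & v = th y j) (v \in thr y).
Proof.
apply: (iffP imsetP) => [[j _ ->]|[j Hj ->]]; first by exists j.
by exists (Ordinal Hj).
Qed.

Lemma thr_partner y : port y -> thr (partner y) = thr y.
Proof.
have sub z : port z -> thr (partner z) \subset thr z.
  move=> pz; apply/subsetP => v /thrP[j]; rewrite tlen_partner // => Hj ->; apply/thrP.
  exists (tlen z - j.+1); first by lia.
  rewrite th_partner ?(ltnW Hj) //.
  by have -> : tlen z - j = (tlen z - j.+1).+1 by lia.
move=> py; apply/eqP; rewrite eqEsubset sub //=.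
by rewrite -{1}(partnerK py) sub // port_partner.
Qed.

Lemma thr_disj y1 y2 v : port y1 -> port y2 -> v \in thr y1 -> v \in thr y2 ->
  y2 = y1 \/ y2 = partner y1.
Proof.
move=> p1 p2 /thrP[i Hi ->] /thrP[j Hj E1].
by case: (th_same p1 p2 Hi Hj E1) => -[]; [left|right].
Qed.

Lemma thr_notY y v : port y -> v \in thr y -> v \notin Y.
Proof. by move=> py /thrP[j Hj ->]; apply: th_lt. Qed.

(** Along a path from [x0], an edge leaving Y enters a thread at its first vertex, and an edge from
    a thread vertex stays on the thread or ends in Y. *)
Lemma thr_cover (x0 : V) : x0 \in Y -> (forall x, connect adj x0 x) ->
  forall v, v \notin Y -> exists2 y, port y & v \in thr y.
Proof.
move=> x0Y conn v; have /connectP[p] := conn v.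
elim/last_ind: p v => [|p w IH] v; first by move=> /= _ ->; rewrite x0Y.
rewrite rcons_path last_rcons => /andP[Hp Ha] -> wY.
set u := last x0 p in Ha; case: (boolP (u \in Y)) => uY.
  have Ez := znP uY Ha wY; have pu : port u by rewrite /port uY Ez.
  by exists u => //; apply/thrP; exists 0; [apply: tlen_gt0|rewrite th0].
have [y py /thrP[j Hj Eu]] := IH u Hp erefl uY; exists y => //.
move: Ha; rewrite Eu th_nbE // => /orP[] /eqP Ew; rewrite Ew.
  case: j Hj Eu Ew => [|j] Hj Eu Ew; first by move: wY; rewrite Ew; case/andP: py => ->.
  by apply/thrP; exists j; [lia|].
case: (ltnP j.+1 (tlen y)) => Hj'; first by apply/thrP; exists j.+1.
have Ej : j.+1 = tlen y by lia.
by move: wY; rewrite Ew Ej th_tlen.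
Qed.

End Walk.

End Threads.

(** * Exchange argument on the loads of bins *)

Module Flow.

Section Flow.
Variables (V Bin : finType) (Q : {set V}) (lb rb : V -> Bin) (base : Bin -> nat) (room : V -> nat).

(** Each [q] distributes [room q] units over the bins at its two ends, [a q] of them to the left. *)
Definition load (a : V -> nat) (x : Bin) : nat :=
  base x + \sum_(q in Q) ((lb q == x) * a q + (rb q == x) * (room q - a q)).

Lemma sum_load a : (forall q, q \in Q -> a q <= room q) ->
  \sum_x load a x = \sum_x base x + \sum_(q in Q) room q.
Proof.
move=> Ha; rewrite /load big_split exchange_big /=; congr (_ + _).
apply: eq_bigr => q Hq; rewrite big_split /= -!big_distrl /=.
have one (y : Bin) : \sum_x (y == x : nat) = 1.
  by rewrite (bigD1 y) //= eqxx big1 ?addn0 // => x /negbTE Hx; rewrite eq_sym Hx.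
by rewrite !one !mul1n subnKC // Ha.
Qed.

Variables (a a' : V -> nat) (p : nat).
Hypothesis a_le : forall q, q \in Q -> a q <= room q.
Hypothesis a'_le : forall q, q \in Q -> a' q <= room q.

(** The bin that loses a unit when [a q] moves one step towards [a' q]; [dst] is the one that gains
    it. *)
Definition src q := if a q < a' q then rb q else lb q.
Definition dst q := if a q < a' q then lb q else rb q.
Definition active q := (q \in Q) && (a q != a' q).
Definition arc (x y : Bin) := [exists q, [&& active q, src q == x & dst q == y]].

(* The bins reachable from [x0] cannot lose load when [a] is replaced by [a'], since no arc
   leaves this set. *)
Lemma deficit_reach x0 : load a' x0 < load a x0 ->
  exists2 y, connect arc x0 y & load a y < load a' y.
Proof.
move=> H0; case: (pickP [pred y | connect arc x0 y && (load a y < load a' y)]) => [y /andP[]|Hn].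
  by exists y.
pose R := [set y | connect arc x0 y].
have lt1 : \sum_(y in R) load a' y < \sum_(y in R) load a y.
  have x0R : x0 \in R by rewrite inE connect0.
  rewrite (bigD1 x0) //= [ltnRHS](bigD1 x0) //= -addSn leq_add //.
  apply: leq_sum => y /andP[]; rewrite inE => Hy _; rewrite leqNgt.
  by have := Hn y; rewrite /= Hy /= => ->.
suff le1 : \sum_(y in R) load a y <= \sum_(y in R) load a' y by rewrite ltnNge le1 in lt1.
rewrite /load !big_split /= leq_add2l exchange_big [leqRHS]exchange_big /=.
apply: leq_sum => q Hq; rewrite !big_split /= -!big_distrl /=.
have one (y : Bin) : \sum_(x in R) (y == x : nat) = (y \in R).
  case: (boolP (y \in R)) => Hy.
    by rewrite (bigD1 y) //= eqxx big1 ?addn0 // => x /andP[_ /negbTE Hx]; rewrite eq_sym Hx.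
  by rewrite big1 // => x Hx; case: eqP Hy => // ->; rewrite Hx.
rewrite !one.
have step : active q -> src q \in R -> dst q \in R.
  move=> Ha; rewrite !inE => H; apply: connect_trans H (connect1 _).
  by apply/existsP; exists q; rewrite Ha !eqxx.
have := a_le Hq; have := a'_le Hq; move: step; rewrite /active Hq /src /dst /=.
case: (ltngtP (a q) (a' q)) => Hlt /= step H1 H2; last by rewrite Hlt.
  by case: (rb q \in R) step => [->//|_]; case: (lb q \in R); lia.
by case: (lb q \in R) step => [->//|_]; case: (rb q \in R); lia.
Qed.

(** Choose one active [q] for each arc of the path. The arcs have distinct sources, so the chosen
    elements are distinct and form a set; at inner bins gains and losses cancel. *)
Lemma path_set x l : uniq (x :: l) -> path arc x l ->
  exists D : {set V}, [/\ forall q, q \in D -> active q,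
    forall q, q \in D -> src q \in x :: l &
    forall z, \sum_(q in D) (dst q == z : nat) + (x == z) =
              \sum_(q in D) (src q == z : nat) + (last x l == z)].
Proof.
elim: l x => [|y l IH] x; first by exists set0; split=> [q|q|z]; rewrite ?inE // !big_set0.
rewrite [uniq _]/= => /andP[xl Hu] /= /andP[/existsP[q0 /and3P[A0 /eqP S0 /eqP D0]] Hp].
have [D [H1 H2 H3]] := IH y Hu Hp.
have q0D : q0 \notin D by apply: contra xl => /H2; rewrite S0.
exists (q0 |: D); split.
- by move=> q; rewrite !inE => /orP[/eqP ->|/H1].
- by move=> q; rewrite in_setU1 => /orP[/eqP ->|/H2 H]; rewrite ?S0 inE ?eqxx // H orbT.
- by move=> z; rewrite !big_setU1 //= S0 D0 [(y == z) + _]addnC H3 addnC addnA.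
Qed.

Definition nudge (D : {set V}) q :=
  if q \in D then (if a q < a' q then (a q).+1 else (a q).-1) else a q.

Lemma load_nudge (D : {set V}) z : (forall q, q \in D -> active q) ->
  load (nudge D) z + \sum_(q in D) (src q == z : nat) =
  load a z + \sum_(q in D) (dst q == z : nat).
Proof.
move=> DA; have DQ : D \subset Q by apply/subsetP => q /DA /andP[].
have ext (F : V -> nat) : \sum_(q in D) F q = \sum_(q in Q) (if q \in D then F q else 0).
  rewrite -big_mkcondr; apply: eq_bigl => q.
  by case: (boolP (q \in D)) => [/(subsetP DQ) ->|]; rewrite ?andbF.
rewrite /load -!addnA; congr (_ + _); rewrite !ext -!big_split /=.
apply: eq_bigr => q Hq; rewrite /nudge; case: (boolP (q \in D)) => //= qD.
have := DA q qD; rewrite /active Hq /= /src /dst; have := a_le Hq; have := a'_le Hq.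
case: (ltngtP (a q) (a' q)) => //= Hlt H1 H2 _.
  by case: (lb q == z); case: (rb q == z); lia.
by case: (lb q == z); case: (rb q == z); lia.
Qed.

(** One unit goes from [x] to [y], whose loads differ by at least 2, so the sum of squares drops. *)
Lemma sum_sq_lt (f g : Bin -> nat) x y : x != y -> g y < p -> p < g x ->
  (forall z, f z + (x == z) = g z + (y == z)) ->
  \sum_z f z ^ 2 < \sum_z g z ^ 2.
Proof.
move=> xy gy gx H.
have sumD2 (h : Bin -> nat) : \sum_z h z = h x + h y + \sum_(z | (z != x) && (z != y)) h z.
  by rewrite (bigD1 x) //= (bigD1 y) ?(eq_sym y) //= addnA.
rewrite !sumD2 (eq_bigr (fun z => g z ^ 2)); last first.
  by move=> z /andP[zx zy]; have := H z; rewrite ![_ == z]eq_sym (negbTE zx) (negbTE zy) !addn0 => ->.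
rewrite ltn_add2r.
have := H x; have := H y; rewrite !eqxx (negbTE xy) eq_sym (negbTE xy) !addn0 addn1 => -> Hx.
have -> : g x = (f x).+1 by lia.
by nia.
Qed.

(** [deficit_reach] supplies a bin below its load under [a'], hence below [p]. Nudging along a
    simple path to it moves one unit from [x0] to that bin and leaves the other loads unchanged. *)
Lemma improve x0 : (forall x, load a' x <= p) -> p < load a x0 ->
  exists D : {set V}, (forall q, q \in D -> active q) /\
    \sum_x load (nudge D) x ^ 2 < \sum_x load a x ^ 2.
Proof.
move=> Hp H0; have [y xy Hy] := deficit_reach (leq_ltn_trans (Hp x0) H0).
have /connectP[l0 P0 E0] := xy; move: E0; case/shortenP: P0 => l Pl Ul _ Ey.
have [D [D1 _ D3]] := path_set Ul Pl.
exists D; split=> //; have Hyp : load a y < p by apply: leq_trans Hy (Hp y).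
apply: (@sum_sq_lt _ _ x0 y) => //.
  by apply/eqP => E1; move: H0; rewrite E1; lia.
by move=> z; have := load_nudge z D1; have := D3 z; rewrite -Ey; lia.
Qed.

End Flow.

End Flow.

(** * Families of equidistant tokens and the effect of shifts on them *)

Module Families.
Import Threads Flow.

Section Moves.
Variables (n : nat) (E : {set {set 'I_n}}) (Y : {set 'I_n}).
Notation V := 'I_n.
Notation adj := (adj E).
Notation zn := (zn E Y).
Notation wstep := (wstep E Y).
Notation dart := (dart E Y).
Notation th := (th E Y).
Notation port := (port E Y).
Notation tlen := (tlen E Y).
Notation partner := (partner E Y).
Notation thr := (thr E Y).

(* One step of a walk leaving a port: the token status of each vertex is handed to the next one,
   the boolean being the status in transit. *)
Definition shstep (x : {set V} * bool * (V * V)) : {set V} * bool * (V * V) :=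
  let: (T, c, d) := x in
  if d.2 \in Y then x
  else (if c then d.2 |: T else T :\ d.2, d.2 \in T, wstep d).

Definition shf (S : {set V}) (y : V) : {set V} :=
  (iter n shstep (S, false, (y, zn y))).1.1.

(* The counter is the number of vertices passed since the last token. *)
Definition ptstep (p : nat) (x : {set V} * nat * (V * V)) : {set V} * nat * (V * V) :=
  let: (T, c, d) := x in
  if d.2 \in Y then x
  else if c == p then (d.2 |: T, 0, wstep d) else (T, c.+1, wstep d).

Definition pat (p : nat) (S : {set V}) (y : V) (c : nat) : {set V} :=
  (iter n (ptstep p) (S, c, (y, zn y))).1.1.

Definition shall (b S : {set V}) : {set V} :=
  foldl (fun S y => if y \in b then shf S y else S) S (enum V).

(** [G1] is the part in Y and [G2] chooses a port for each thread that carries tokens. The counter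
    starts at 0 on [G3], which puts the first token at position [p], and at [p] elsewhere, which
    puts it at position 0. [G4] adds a token next to the far port of a crowded thread. *)
Definition sinit (p : nat) (G1 G2 G3 G4 : {set V}) : {set V} :=
  foldl (fun S y => if y \in G4 then zn y |: S else S)
    (foldl (fun S y => if y \in G2 then pat p S y (if y \in G3 then 0 else p) else S)
      G1 (enum V)) (enum V).

Hypothesis simpleE : simple_graph E.
Hypothesis deg2 : forall z, z \notin Y -> exists u w, u != w /\ forall v, adj z v = (v == u) || (v == w).
Hypothesis one_port : forall y b b', y \in Y -> adj y b -> b \notin Y -> adj y b' -> b' \notin Y -> b = b'.

Let th_lt := th_lt simpleE deg2.
Let th_inj := th_inj simpleE deg2.
Let tlen_le := tlen_le simpleE deg2.
Let th_tlen := th_tlen simpleE deg2.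
Let tlen_gt0 := tlen_gt0 simpleE deg2.

Lemma iter_stop T (f : T -> T) x j k : f (iter j f x) = iter j f x -> j <= k ->
  iter k f x = iter j f x.
Proof.
by move=> H /subnK <-; elim: (k - j) => // i IH; rewrite addSn iterS IH H.
Qed.

Definition prevb (y : V) (S : {set V}) (i : nat) : bool :=
  if i is i'.+1 then th y i' \in S else false.

Lemma shf_iter y S j : port y -> j <= tlen y ->
  let: (S', c, d) := iter j shstep (S, false, (y, zn y)) in
  [/\ c = prevb y S j, d = dart y j,
      forall i, i < j -> (th y i \in S') = prevb y S i &
      forall v, (forall i, i < j -> v <> th y i) -> (v \in S') = (v \in S)].
Proof.
move=> py; elim: j => [|j IH] Hj //=.
case: (iter j _ _) (IH (ltnW Hj)) => [[S' c] d] [-> -> H1 H2] /=.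
rewrite -/(th y j) (negbTE (th_lt py Hj)); split=> //.
- by apply: H2 => i Hi /(th_inj py Hj (ltn_trans Hi Hj)); lia.
- move=> i; rewrite ltnS leq_eqVlt => /orP[/eqP ->|Hi].
    by case: (prevb y S j); rewrite !inE eqxx.
  have Hne : (th y i == th y j) = false.
    by apply/eqP => /(th_inj py (ltn_trans Hi Hj) Hj); lia.
  by case: (prevb y S j); rewrite !inE Hne H1.
- move=> v Hv; have Hne : (v == th y j) = false by apply/eqP; apply: Hv.
  have Hv' i : i < j -> v <> th y i by move=> Hi; apply: Hv; lia.
  by case: (prevb y S j); rewrite !inE Hne H2.
Qed.

Lemma shfE y S : port y ->
  (forall j, j < tlen y -> (th y j \in shf S y) = prevb y S j) /\
  (forall v, v \notin thr y -> (v \in shf S y) = (v \in S)).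
Proof.
move=> py; have := shf_iter S py (leqnn _).
rewrite /shf (@iter_stop _ shstep _ (tlen y) n) ?tlen_le //.
  case: (iter _ _ _) => [[S' c] d] [_ _ H1 H2] /=; split=> // v /thrP Hv.
  by apply: H2 => i Hi Ev; apply: Hv; exists i.
have := shf_iter S py (leqnn _); case: (iter _ _ _) => [[S' c] d] [_ -> _ _] /=.
by rewrite -/(th y (tlen y)) th_tlen.
Qed.

Lemma shf_noport y S : y \in Y -> ~~ port y -> shf S y = S.
Proof.
move=> yY; rewrite /Threads.port yY /= negbK => zY; rewrite /shf.
by rewrite (@iter_stop _ shstep _ 0 n) //= zY.
Qed.

Lemma pat_iter p y S c0 j : port y -> c0 <= p -> j <= tlen y ->
  let: (S', c, d) := iter j (ptstep p) (S, c0, (y, zn y)) in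
  [/\ c = (c0 + j) %% p.+1, d = dart y j,
      forall i, i < j -> (th y i \in S') = (th y i \in S) || ((c0 + i) %% p.+1 == p) &
      forall v, (forall i, i < j -> v <> th y i) -> (v \in S') = (v \in S)].
Proof.
move=> py c0p; elim: j => [|j IH] Hj /=; first by rewrite addn0 modn_small.
case: (iter j _ _) (IH (ltnW Hj)) => [[S' c] d] [-> -> H1 H2] /=.
rewrite -/(th y j) (negbTE (th_lt py Hj)).
have Hm : (c0 + j.+1) %% p.+1 = if (c0 + j) %% p.+1 == p then 0 else ((c0 + j) %% p.+1).+1.
  rewrite addnS -addn1 -modnDml; have := ltn_pmod (c0 + j) (ltn0Sn p).
  by case: eqP => [->|H] Hlt; [rewrite addn1 modnn|rewrite addn1 modn_small //; lia].
have Hjj : (th y j \in S') = (th y j \in S).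
  by apply: H2 => i Hi /(th_inj py Hj (ltn_trans Hi Hj)); lia.
have Hne i : i < j -> (th y i == th y j) = false.
  by move=> Hi; apply/eqP => /(th_inj py (ltn_trans Hi Hj) Hj); lia.
rewrite Hm; case Hc : (_ == p); split=> //.
- move=> i; rewrite ltnS leq_eqVlt => /orP[/eqP ->|Hi]; first by rewrite !inE eqxx Hc orbT.
  by rewrite !inE Hne // H1.
- move=> v Hv; have -> : (v \in th y j |: S') = (v \in S').
    by rewrite !inE; case: eqP => // Ev; case: (Hv j).
  by apply: H2 => i Hi; apply: Hv; lia.
- move=> i; rewrite ltnS leq_eqVlt => /orP[/eqP ->|Hi]; first by rewrite Hc orbF.
  exact: H1.
- by move=> v Hv; apply: H2 => i Hi; apply: Hv; lia.
Qed.

Lemma patE p y S c0 : port y -> c0 <= p ->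
  (forall j, j < tlen y ->
     (th y j \in pat p S y c0) = (th y j \in S) || ((c0 + j) %% p.+1 == p)) /\
  (forall v, v \notin thr y -> (v \in pat p S y c0) = (v \in S)).
Proof.
move=> py c0p; have := pat_iter S py c0p (leqnn _).
rewrite /pat (@iter_stop _ (ptstep p) _ (tlen y) n) ?tlen_le //.
  case: (iter _ _ _) => [[S' c] d] [_ _ H1 H2] /=; split=> // v /thrP Hv.
  by apply: H2 => i Hi Ev; apply: Hv; exists i.
have := pat_iter S py c0p (leqnn _); case: (iter _ _ _) => [[S' c] d] [_ -> _ _] /=.
by rewrite -/(th y (tlen y)) th_tlen.
Qed.

Lemma big_thr y (F : V -> nat) : port y ->
  \sum_(v in thr y) F v = \sum_(j < tlen y) F (th y j).
Proof.
move=> py; rewrite /thr big_imset //= => i j _ _ /th_inj Hij.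
by apply/val_inj/Hij.
Qed.

Lemma card_thr y S : port y -> #|S :&: thr y| = \sum_(j < tlen y) (th y j \in S).
Proof.
move=> py; rewrite -(big_thr (fun v => v \in S : nat)) // -sum1_card big_mkcond [RHS]big_mkcond /=.
by apply: eq_bigr => v _; rewrite inE; case: (v \in S); case: (v \in thr y).
Qed.

(** Only a token on the last vertex is lost. This is how the program notices an illegal shift from
    the cardinality alone. *)
Lemma card_shf y S : port y -> #|shf S y| + (th y (tlen y).-1 \in S) = #|S|.
Proof.
move=> py; have [H1 H2] := shfE S py.
rewrite -(cardsID (thr y) (shf S y)) -(cardsID (thr y) S) !card_thr //.
have -> : shf S y :\: thr y = S :\: thr y.
  by apply/setP => v; rewrite !inE; case: (boolP (v \in thr y)) => //= Hv; rewrite H2.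
rewrite addnAC; congr (_ + _).
have -> : \sum_(j < tlen y) (th y j \in shf S y) = \sum_(j < tlen y) prevb y S j.
  by apply: eq_bigr => j _; rewrite H1.
case: (tlen y) (tlen_gt0 py) => // L _.
by rewrite big_ord_recl [RHS]big_ord_recr.
Qed.

Lemma card_shf_le y S : y \in Y -> #|shf S y| <= #|S|.
Proof.
move=> yY; case: (boolP (port y)) => py; last by rewrite shf_noport.
by rewrite -(card_shf S py) leq_addr.
Qed.

(** [j] is one of the [s] positions a, a + (p + 1), a + 2 (p + 1), ... *)
Definition tok (p a s j : nat) : bool :=
  [&& a <= j, p.+1 %| j - a & (j - a) %/ p.+1 < s].

Section Family.
Variables (p : nat) (A Q : {set V}) (s : V -> nat).
Hypothesis Qport : forall q, q \in Q -> port q.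
Hypothesis Qpart : forall q, q \in Q -> partner q \notin Q.
Hypothesis s_gt0 : forall q, q \in Q -> 0 < s q.
Hypothesis AQ : forall q v, q \in Q -> v \in thr q -> v \notin A.
Hypothesis Afrozen : forall y, port y -> y \notin Q -> partner y \notin Q ->
  (forall v, v \in thr y -> v \notin A) \/ th y (tlen y).-1 \in A.

Definition valid (a : V -> nat) : Prop :=
  forall q, q \in Q -> a q + (s q).-1 * p.+1 < tlen q.

(* [A] together with, on each thread [q] of [Q], [s q] tokens at the positions
   [a q + i * p.+1]. *)
Definition SS (a : V -> nat) : {set V} :=
  A :|: \bigcup_(q in Q) [set th q (nat_of_ord j) | j in [pred j : 'I_(tlen q) | tok p (a q) (s q) j]].

Lemma thr_disjQ q q' v : q \in Q -> q' \in Q -> v \in thr q -> v \in thr q' -> q = q'.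
Proof.
move=> Hq Hq' v1 v2; have [//|E1] := thr_disj simpleE deg2 one_port (Qport Hq) (Qport Hq') v1 v2.
by have := Qpart Hq; rewrite -E1 Hq'.
Qed.

Lemma mem_thr y j : j < tlen y -> th y j \in thr y.
Proof. by move=> Hj; apply/thrP; exists j. Qed.

Lemma in_SS_th a q j : q \in Q -> j < tlen q -> (th q j \in SS a) = tok p (a q) (s q) j.
Proof.
move=> Hq Hj; rewrite inE (negbTE (AQ Hq (mem_thr Hj))) /=.
apply/bigcupP/idP => [[q' Hq' /imsetP[j' Ht Ev]]|Ht].
  have Eq : q = q'.
    by apply: (thr_disjQ Hq Hq' (mem_thr Hj)); rewrite Ev; apply: mem_thr.
  by subst q'; rewrite (th_inj (Qport Hq) Hj (ltn_ord j') Ev).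
by exists q => //; apply/imsetP; exists (Ordinal Hj).
Qed.

Lemma in_SS_out a v : (forall q, q \in Q -> v \notin thr q) -> (v \in SS a) = (v \in A).
Proof.
move=> H; rewrite inE; case: (v \in A) => //=.
apply/bigcupP => -[q Hq /imsetP[j _ Ev]].
by have := H q Hq; rewrite Ev mem_thr.
Qed.

Lemma SS_ext a (S : {set V}) : (forall q j, q \in Q -> j < tlen q -> (th q j \in S) = tok p (a q) (s q) j) ->
  (forall v, (forall q, q \in Q -> v \notin thr q) -> (v \in S) = (v \in A)) -> S = SS a.
Proof.
move=> H1 H2; apply/setP => v.
case: (pickP [pred q | (q \in Q) && (v \in thr q)]) => [q /andP[Hq /thrP[j Hj ->]]|Hn].
  by rewrite H1 // in_SS_th.
have Hv q : q \in Q -> v \notin thr q by move=> Hq; have := Hn q; rewrite /= Hq /= => ->.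
by rewrite H2 // in_SS_out.
Qed.

Definition upda (a : V -> nat) q x : V -> nat := fun q' => if q' == q then x else a q'.

Lemma shf_fwd a y : y \in Q -> shf (SS a) y = SS (upda a y (a y).+1).
Proof.
move=> Hy; have [H1 H2] := shfE (SS a) (Qport Hy); apply: SS_ext.
  move=> q j Hq Hj; rewrite /upda; case: (q =P y) => [Eq|Nq].
    subst q; rewrite H1 //; case: j Hj => [|j] Hj //=.
    by rewrite in_SS_th ?(ltnW Hj) // /tok subSS.
  rewrite H2 ?in_SS_th //; apply/negP => Hv; apply: Nq.
  exact: thr_disjQ Hq Hy (mem_thr Hj) Hv.
by move=> v Hv; rewrite H2 ?Hv // in_SS_out.
Qed.

Lemma tok_end a q : valid a -> q \in Q -> tok p (a q) (s q) (tlen q) = false.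
Proof.
move=> Va Hq; apply/negP => /and3P[H1 /divnK H2 H3].
have := Va q Hq; have := s_gt0 Hq => s0 H.
have : (tlen q - a q) %/ p.+1 * p.+1 <= (s q).-1 * p.+1 by rewrite leq_mul2r; lia.
by rewrite H2; lia.
Qed.

(** Seen from the other port the positions are reversed, so a shift from there lowers the phase. The
    vertex that comes first from that side receives no token, which agrees with [tok_end]. *)
Lemma shf_bwd a q : valid a -> q \in Q -> 0 < a q ->
  shf (SS a) (partner q) = SS (upda a q (a q).-1).
Proof.
move=> Va Hq a0; have pq := Qport Hq.
have pp := port_partner simpleE deg2 one_port pq.
have [H1 H2] := shfE (SS a) pp; apply: SS_ext.
  move=> q' j Hq' Hj; rewrite /upda; case: (q' =P q) => [Eq|Nq].
    subst q'; have Ej : th q j = th (partner q) (tlen q - j.+1).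
      rewrite th_partner //; last by lia.
      by have -> : tlen q - (tlen q - j.+1) = j.+1 by lia.
    have Ht : tok p (a q).-1 (s q) j = tok p (a q) (s q) j.+1.
      by rewrite /tok; have -> : j - (a q).-1 = j.+1 - a q; [lia|congr (_ && _); lia].
    rewrite Ej H1 ?tlen_partner //; last by lia.
    rewrite Ht; case: (ltngtP j.+1 (tlen q)) => Hj'; [|lia|]; last first.
      by rewrite Hj' subnn /= tok_end.
    have -> : tlen q - j.+1 = (tlen q - j.+2).+1 by lia.
    rewrite /= th_partner //; last by lia.
    by have -> : tlen q - (tlen q - j.+2) = j.+2; [lia|rewrite /= in_SS_th].
  rewrite H2 ?in_SS_th // thr_partner //; apply/negP => Hv; apply: Nq.
  exact: thr_disjQ Hq' Hq (mem_thr Hj) Hv.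
by move=> v Hv; rewrite H2 ?thr_partner ?Hv // in_SS_out.
Qed.

Definition Inv (S : {set V}) : Prop := exists2 a, valid a & S = SS a.

Lemma thr_frozen y q v : port y -> y \notin Q -> partner y \notin Q -> v \in thr y -> q \in Q -> v \notin thr q.
Proof.
move=> py yQ pQ vy Hq; apply/negP => vq.
have [E1|E1] := thr_disj simpleE deg2 one_port py (Qport Hq) vy vq.
  by rewrite E1 (negbTE yQ) in Hq.
by rewrite E1 (negbTE pQ) in Hq.
Qed.

(** Equal cardinality means that no token fell off. On a thread of [Q] the new phase is then still
    valid; any other thread is empty or has a token on its last vertex, and in the latter case the
    shift would have lost it. *)
Lemma Inv_shf S y : y \in Y -> Inv S -> #|shf S y| = #|S| -> Inv (shf S y).
Proof.
move=> yY [a Va ->] Ec; case: (boolP (port y)) => py; last first.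
  by rewrite shf_noport //; exists a.
have L0 := tlen_gt0 py.
have Hlast : th y (tlen y).-1 \notin SS a.
  by have := card_shf (SS a) py; rewrite Ec; case: (_ \in _) => //; lia.
case: (boolP (y \in Q)) => yQ.
  rewrite shf_fwd //; eexists; last by [].
  move=> q Hq; rewrite /upda; case: eqP => [Eq|_]; last exact: Va.
  subst q; rewrite addSn; have := Va y yQ; rewrite leq_eqVlt => /orP[/eqP Ey|//].
  move: Hlast; rewrite in_SS_th ?prednK // /tok -Ey /=.
  by rewrite leq_addr addKn dvdn_mull //= mulnK // ltn_predL s_gt0.
case: (boolP (partner y \in Q)) => pQ.
  have pp := port_partner simpleE deg2 one_port py.
  have a0 : 0 < a (partner y).
    case: (posnP (a (partner y))) => // a0; move: Hlast.
    have -> : th y (tlen y).-1 = th (partner y) 0.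
      by rewrite th_partner // subn0; case: (tlen y) L0.
    rewrite in_SS_th ?tlen_partner // /tok a0 subnn dvdn0 div0n /=.
    by rewrite s_gt0.
  have := shf_bwd Va pQ a0; rewrite partnerK // => ->; eexists; last by [].
  move=> q Hq; rewrite /upda; case: eqP => [Eq|_]; last exact: Va.
  by subst q; apply: leq_ltn_trans (Va _ Hq); rewrite leq_add2r leq_pred.
have Hfr v : v \in thr y -> (v \in SS a) = (v \in A).
  by move=> Hv; apply: in_SS_out => q Hq; apply: thr_frozen Hv Hq.
have [HA|HA] := Afrozen py yQ pQ; last first.
  by move: Hlast; rewrite Hfr ?HA // mem_thr // prednK.
have [H1 H2] := shfE (SS a) py; exists a => //; apply/setP => v.
case: (boolP (v \in thr y)) => Hv; last exact: H2.
rewrite Hfr // (negbTE (HA _ Hv)); case/thrP: Hv => j Hj ->; rewrite H1 //.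
case: j Hj => [|j] Hj //=; have Hj' := mem_thr (ltnW Hj).
by rewrite Hfr // (negbTE (HA _ Hj')).
Qed.

(** No shift increases the cardinality, so equality at the end forces equality at every single
    shift. *)
Lemma Inv_shall (b S : {set V}) : b \subset Y -> Inv S -> #|shall b S| = #|S| -> Inv (shall b S).
Proof.
move=> bS; have /subsetP bY := bS; rewrite /shall.
have cle l S' : #|foldl (fun S y => if y \in b then shf S y else S) S' l| <= #|S'|.
  elim: l S' => //= y l IH S'; apply: leq_trans (IH _) _; case: ifP => // Hy.
  exact: card_shf_le (bY _ Hy).
elim: (enum V) S => //= y l IH S IS Ec; apply: IH.
  case: ifP Ec => // Hy Ec; apply: Inv_shf => //; first exact: bY.
  by apply/eqP; rewrite eqn_leq card_shf_le ?bY //= -Ec cle.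
apply/eqP; rewrite eqn_leq cle /=; case: ifP Ec => [Hy ->|_ ->] //.
exact: card_shf_le (bY _ Hy).
Qed.

Definition psi (S : {set V}) : nat := \sum_(v | v \notin S) #|component E S v|.

(** The largest valid phase, and also the number of thread vertices outside the span of the tokens:
    [a q] before it and [room q - a q] after it. *)
Definition room (q : V) : nat := (tlen q).-1 - (s q).-1 * p.+1.

(** The number of tokens at positions up to [j], which indexes the segment of a token-free [j]. *)
Definition idx (a sq j : nat) : nat :=
  if j < a then 0 else minn ((j - a) %/ p.+1).+1 sq.

Lemma idxS a sq j : tok p a sq j.+1 = false -> 0 < sq -> idx a sq j.+1 = idx a sq j.
Proof.
rewrite /tok /idx => Ht s0; case: (ltngtP j.+1 a) Ht => //= H.
- have Ej : j.+1 - a = (j - a).+1 by lia.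
  by rewrite Ej divnS //=; case: (p.+1 %| _) => //= Ht; lia.
- by rewrite H subnn dvdn0 div0n s0.
Qed.

Lemma idx_tok a sq j : tok p a sq j.+1 -> idx a sq j < idx a sq j.+1.
Proof.
rewrite /tok /idx => /and3P[H1 H2 H3]; have -> : (j.+1 < a) = false by lia.
case: (ltnP j a) => H /=; first by rewrite leq_min /=; apply: leq_ltn_trans H3.
have Ej : j.+1 - a = (j - a).+1 by lia.
by move: H2 H3; rewrite Ej divnS // => -> /=; move: (_ %/ _) => z; lia.
Qed.

Lemma idx_mono a sq i j : i <= j -> idx a sq i <= idx a sq j.
Proof.
move=> Hij; rewrite /idx; case: (ltnP i a) => // Hi; have -> : (j < a) = false by lia.
have := leq_div2r p.+1 (leq_sub2r a Hij).
by move: (_ %/ _) (_ %/ _) => x y; lia.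
Qed.

Lemma idx_le a sq j : idx a sq j <= sq.
Proof. by rewrite /idx; case: ifP => // _; rewrite geq_minr. Qed.

Lemma idx0 a sq j : 0 < sq -> (idx a sq j == 0) = (j < a).
Proof. by rewrite /idx; case: (ltnP j a) => // _; move: (_ %/ _) => x; lia. Qed.

Lemma idx_last a sq j : 0 < sq -> (idx a sq j == sq) = (a + sq.-1 * p.+1 <= j).
Proof.
move=> s0; rewrite /idx; case: (ltnP j a) => H; first by lia.
have -> : (minn ((j - a) %/ p.+1).+1 sq == sq) = (sq.-1 <= (j - a) %/ p.+1).
  by move: (_ %/ _) => x; lia.
by rewrite leq_divRL //; lia.
Qed.

Definition hset : {set V} := [set v | (v \notin A) && [forall q in Q, v \notin thr q]].
Definition hadj : rel V := fun u v => [&& u \in hset, v \in hset & adj u v].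
Notation hroot := (root hadj).

Lemma hadj_sym : connect_sym hadj.
Proof. by apply: sym_connect_sym => u v; rewrite /hadj adjC andbCA. Qed.

(* Labels of the components of [G - SS a]: [inl] for one meeting the part of the graph outside
   [A] and the threads of [Q] (given by the root of that part), [inr (q, i)] for the segment of
   the thread [q] after its first [i] tokens (the end segments [i = 0] and [i = s q] only when
   the port next to them lies in [A]).
   The set of labels does not depend on [a]: moving the tokens only moves vertices between
   the labels at the two ends of each thread, which is the setting of the flow argument. *)
Definition bin : finType := (V + V * 'I_n.+1)%type.

Definition lbin q : bin := if q \in A then inr (q, inord 0) else inl (hroot q).
Definition rbin q : bin :=
  if partner q \in A then inr (q, inord (s q)) else inl (hroot (partner q)).
Definition tlab q i : bin :=
  if i == 0 then lbin q else if i == s q then rbin q else inr (q, inord i).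
Definition pos q v : nat := index v [seq th q j | j <- iota 0 (tlen q)].
Definition lab (a : V -> nat) v : bin :=
  if [pick q in Q | v \in thr q] is Some q then tlab q (idx (a q) (s q) (pos q v))
  else inl (hroot v).

Lemma pos_th q j : port q -> j < tlen q -> pos q (th q j) = j.
Proof.
move=> pq Hj; rewrite /pos.
have -> : th q j = nth (th q 0) [seq th q j | j <- iota 0 (tlen q)] j.
  by rewrite (nth_map 0) ?size_iota // nth_iota.
rewrite index_uniq ?size_map ?size_iota // map_inj_in_uniq ?iota_uniq //.
by move=> i k; rewrite !mem_iota /= => Hi Hk /(th_inj pq Hi Hk).
Qed.

Lemma lab_th a q j : q \in Q -> j < tlen q -> lab a (th q j) = tlab q (idx (a q) (s q) j).
Proof.
move=> Hq Hj; rewrite /lab; case: pickP => [q' /andP[Hq' Hv]|/(_ q)].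
  by rewrite (thr_disjQ Hq' Hq Hv (mem_thr Hj)) pos_th // Qport.
by rewrite Hq mem_thr.
Qed.

Lemma hsetP v : reflect (v \notin A /\ forall q, q \in Q -> v \notin thr q) (v \in hset).
Proof.
rewrite inE; apply: (iffP andP) => -[H1 H2]; split=> //.
  by move=> q Hq; have /forall_inP := H2; apply.
by apply/forall_inP.
Qed.

Lemma lab_h a v : v \in hset -> lab a v = inl (hroot v).
Proof.
by move=> /hsetP[_ H]; rewrite /lab; case: pickP => // q /andP[/H/negbTE ->].
Qed.

Lemma h_SS a v : v \in hset -> v \notin SS a.
Proof. by move=> /hsetP[H1 H2]; rewrite in_SS_out. Qed.

Lemma h_port y : y \in Y -> (y \in hset) = (y \notin A).
Proof.
move=> yY; apply/hsetP/idP => [[]//|H]; split=> // q Hq; apply: contraL yY.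
exact: thr_notY (Qport Hq).
Qed.

Lemma SS_case a v : v \notin SS a -> v \in hset \/ exists q j, [/\ q \in Q, j < tlen q & v = th q j].
Proof.
move=> Hv; case: (pickP [pred q | (q \in Q) && (v \in thr q)]) => [q /andP[Hq /thrP[j Hj ->]]|Hn].
  by right; exists q, j.
have Hv' q : q \in Q -> v \notin thr q by move=> Hq; have := Hn q; rewrite /= Hq /= => ->.
by left; apply/hsetP; split=> //; rewrite -(in_SS_out a Hv').
Qed.

Let tokN a q j (Hq : q \in Q) (Hj : j < tlen q) : th q j \notin SS a -> tok p (a q) (s q) j = false.
Proof. by rewrite in_SS_th // => /negbTE. Qed.

(** Along a thread the segment index changes only at a token, and an end segment carries the label
    of its port when that port survives. *)
Lemma lab_edge a u v : valid a -> u \notin SS a -> v \notin SS a -> adj u v -> lab a u = lab a v.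
Proof.
move=> Va; wlog: u v / exists q j, [/\ q \in Q, j < tlen q & u = th q j].
  move=> W Hu Hv Huv.
  case: (SS_case Hu) => [hu|H]; last exact: W.
  case: (SS_case Hv) => [hv|H]; last by apply/esym/W; rewrite // adjC.
  rewrite !lab_h //; congr inl; apply/(rootP hadj_sym)/connect1.
  by rewrite /hadj hu hv.
move=> [q [j [Hq Hj ->]]] Hu Hv; have pq := Qport Hq; have s0 := s_gt0 Hq.
rewrite th_nbE // => /orP[] /eqP Ev; rewrite Ev in Hv *.
  case: j Hj Hu Hv {Ev} => [|j] Hj Hu /= Hv.
    have yY : q \in Y by case/andP: pq.
    have qA : q \notin A by move: Hv; rewrite inE negb_or => /andP[].
    rewrite lab_th // lab_h ?h_port //; have := tokN Hq Hj Hu.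
    rewrite /tok /tlab idx0 //; case: (posnP (a q)) => [->|_ _]; last by rewrite /lbin (negbTE qA).
    by rewrite subnn dvdn0 div0n s0.
  by rewrite !lab_th ?(ltnW Hj) // idxS // (tokN Hq Hj).
case: (ltngtP j.+1 (tlen q)) => Hj'; [|lia|].
  by rewrite !lab_th // idxS // (tokN Hq Hj').
have pY : partner q \in Y by apply: partner_Y.
rewrite Hj' -/(partner q) in Hv *.
have qA : partner q \notin A by move: Hv; rewrite inE negb_or => /andP[].
rewrite lab_th // lab_h ?h_port //.
have /eqP Ei : idx (a q) (s q) j == s q by rewrite idx_last //; have := Va q Hq; lia.
by rewrite Ei /tlab eqxx /rbin (negbTE qA) ifF //; lia.
Qed.

Notation conn a := (connect (adj_minus E (SS a))).

Lemma conn_sym a : connect_sym (adj_minus E (SS a)).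
Proof. by apply: sym_connect_sym => u v; rewrite /adj_minus setUC andbCA. Qed.

Lemma conn_lab a u v : valid a -> u \notin SS a -> conn a u v -> (v \notin SS a) /\ lab a u = lab a v.
Proof.
move=> Va Hu /connectP[l]; elim: l u Hu => [|w l IH] u Hu /= => [_ ->//|].
case/andP => /and3P[_ Hw Ha] Hl El; have [H1 H2] := IH w Hw Hl El.
by split=> //; rewrite -H2; apply: lab_edge.
Qed.

Lemma conn_h a u v : u \in hset -> v \in hset -> hroot u = hroot v -> conn a u v.
Proof.
move=> hu hv /(rootP hadj_sym); apply: connect_sub => x y /and3P[hx hy Hxy].
by apply: connect1; rewrite /adj_minus !h_SS.
Qed.

Lemma conn_seg a q i j : q \in Q -> i <= j -> j < tlen q ->
  th q i \notin SS a -> th q j \notin SS a -> idx (a q) (s q) i = idx (a q) (s q) j ->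
  conn a (th q i) (th q j).
Proof.
move=> Hq; elim: j => [|j IH]; first by rewrite leqn0 => /eqP ->.
rewrite leq_eqVlt => /orP[/eqP -> //|Hij] Hj Hi HSj Eij.
have Tj := tokN Hq Hj HSj; rewrite idxS ?s_gt0 // in Eij.
have HSj' : th q j \notin SS a.
  move: Hij; rewrite ltnS leq_eqVlt => /orP[/eqP <- //|Hij].
  rewrite in_SS_th ?(ltnW Hj) //; apply/negP; case: j IH Hj HSj Eij Tj Hij => // j IH Hj HSj Eij Tj Hij /idx_tok.
  by rewrite -Eij ltnNge idx_mono.
apply: connect_trans (IH _ (ltnW Hj) Hi HSj' Eij) (connect1 _) => //.
rewrite /adj_minus HSj HSj' -/(Defs.adj E _ _) /=.
by rewrite th_nbE ?(ltnW Hj) ?eqxx ?orbT //; apply: Qport.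
Qed.

(** An end segment next to a surviving port is connected to that port, which lies in [hset]; in the
    remaining cases on threads the label names the thread and the segment. Equal labels are compared
    through these representatives. *)
Lemma conn_rep a v : valid a -> v \notin SS a ->
  (exists h, [/\ h \in hset, lab a v = inl (hroot h) & conn a v h]) \/
  (exists q j, [/\ q \in Q, j < tlen q, v = th q j & lab a v = inr (q, inord (idx (a q) (s q) j))]).
Proof.
move=> Va Hv; case: (SS_case Hv) => [hv|[q [j [Hq Hj Ev]]]].
  by left; exists v; rewrite lab_h.
have pq := Qport Hq; have s0 := s_gt0 Hq; subst v.
have yY : q \in Y by case/andP: pq.
have pY : partner q \in Y by apply: partner_Y.
rewrite lab_th // /tlab; case: (idx _ _ j =P 0) => [E0|N0].
  rewrite /lbin; case: ifP => qA; first by right; exists q, j; rewrite E0.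
  left; exists q; rewrite h_port ?qA //; split=> //.
  have ja : j < a q by rewrite -(idx0 _ _ s0) E0.
  have L0 := tlen_gt0 pq; have HS0 : th q 0 \notin SS a.
    by rewrite in_SS_th // /tok; case: (a q) ja.
  rewrite conn_sym; apply: connect_trans (connect1 _) (conn_seg Hq (leq0n j) Hj HS0 Hv _).
    by rewrite /adj_minus HS0 h_SS ?h_port ?qA // -/(Defs.adj E _ _) /= port_adj.
  by rewrite E0; apply/eqP; rewrite idx0 //; lia.
case: (idx _ _ j =P s q) => [E1|N1]; last by right; exists q, j.
rewrite /rbin; case: ifP => qA; first by right; exists q, j; rewrite E1.
left; exists (partner q); rewrite h_port ?qA //; split=> //.
have L0 := tlen_gt0 pq; have Hl : (tlen q).-1 < tlen q by rewrite prednK.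
have El : idx (a q) (s q) (tlen q).-1 = s q.
  have Hjl : j <= (tlen q).-1 by lia.
  apply/eqP; rewrite eqn_leq idx_le /=.
  by have := idx_mono (a q) (s q) Hjl; rewrite {1}E1.
have HSl : th q (tlen q).-1 \notin SS a.
  move: Hj; rewrite -[X in j < X](prednK L0) ltnS leq_eqVlt => /orP[/eqP <- //|Hjl].
  rewrite in_SS_th //; apply/negP; case: (tlen q).-1 Hjl El => // l Hjl El /idx_tok.
  rewrite El; have := idx_mono (a q) (s q) (_ : j <= l); rewrite {1}E1 => H.
  by rewrite ltnNge H //; lia.
apply: connect_trans (conn_seg Hq _ Hl Hv HSl _) (connect1 _); [lia|by rewrite El|].
rewrite /adj_minus HSl h_SS ?h_port ?qA // -/(Defs.adj E _ _) /=.
by rewrite th_nbE // prednK // eqxx orbT.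
Qed.

Lemma s_le a q : valid a -> q \in Q -> s q <= n.
Proof.
move=> Va Hq; have := Va q Hq; have := tlen_le (Qport Hq); have := s_gt0 Hq; rewrite mulnS; lia.
Qed.

Lemma lab_conn a u v : valid a -> u \notin SS a -> v \notin SS a -> lab a u = lab a v -> conn a u v.
Proof.
move=> Va Hu Hv El; have := conn_rep Va Hu; have := conn_rep Va Hv; rewrite El.
case=> [[h [hh -> Ch]]|[q [j [Hq Hj Ev ->]]]]; case=> [[h' [hh' Eh Ch']]|[q' [j' [Hq' Hj' Eu Eh]]]] //.
  case: Eh => Er; apply: connect_trans Ch' _; rewrite conn_sym.
  by apply: connect_trans Ch _; apply: conn_h.
case: Eh => Eq /(congr1 (@nat_of_ord _)); rewrite {}Eq in Hj Ev *.
have sn := s_le Va Hq'; have i1 := idx_le (a q') (s q') j; have i2 := idx_le (a q') (s q') j'.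
rewrite !inordK; try lia.
move=> Ei; subst u v; case: (leqP j j') => Hjj.
  by rewrite conn_sym; apply: conn_seg.
by apply: conn_seg => //; apply: ltnW.
Qed.

Definition cnt a (x : bin) : nat := #|[set v | (v \notin SS a) && (lab a v == x)]|.

Lemma card_component a v : valid a -> v \notin SS a -> #|component E (SS a) v| = cnt a (lab a v).
Proof.
move=> Va Hv; apply: eq_card => u; rewrite [LHS]in_set [RHS]in_set.
apply: andb_id2l => Hu; apply/idP/eqP => [/(conn_lab Va Hv)[_ ->]|H] //.
by apply: lab_conn.
Qed.

(** Labels are components: each of the [cnt a x] vertices with label [x] contributes [cnt a x]. *)
Lemma psi_cnt a : valid a -> psi (SS a) = \sum_x cnt a x ^ 2.
Proof.
move=> Va; rewrite /psi (eq_bigr (fun v => cnt a (lab a v))); last by move=> v; apply: card_component.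
rewrite (partition_big (lab a) xpredT) //=; apply: eq_bigr => x _.
rewrite (eq_bigr (fun=> cnt a x)); last by move=> v /andP[_ /eqP ->].
rewrite sum_nat_const expnS expn1; congr (_ * _).
by apply: eq_card => v; rewrite [RHS]in_set.
Qed.

(** The share of the load that does not depend on the phases: [hset], and the gaps between the first
    and the last token of each thread, computed with the first token at position 0. *)
Definition base (x : bin) : nat :=
  \sum_(v in hset) (inl (hroot v) == x) +
  \sum_(q in Q) \sum_(0 <= k < ((s q).-1 * p.+1).+1)
     (~~ tok p 0 (s q) k && (tlab q (idx 0 (s q) k) == x)).

Lemma sum_split (F : V -> nat) : (forall v, v \in A -> F v = 0) ->
  \sum_v F v = \sum_(v in hset) F v + \sum_(q in Q) \sum_(0 <= j < tlen q) F (th q j).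
Proof.
move=> FA; rewrite (bigID (mem hset)) /=; congr (_ + _).
pose T q := if q \in Q then thr q else set0.
have TP v : reflect (exists2 q, q \in Q & v \in thr q) (v \in \bigcup_q T q).
  apply: (iffP bigcupP) => [[q _]|[q Hq Hv]]; last by exists q; rewrite // /T Hq.
  by rewrite /T; case: (boolP (q \in Q)) => [Hq Hv|_]; [exists q|rewrite inE].
transitivity (\sum_(v in \bigcup_q T q) F v).
  rewrite big_mkcond [RHS]big_mkcond /=; apply: eq_bigr => v _.
  case: (boolP (v \in hset)) => [/hsetP[_ H]|H] /=.
    by rewrite ifF //; apply/negP => /TP[q Hq]; rewrite (negbTE (H q Hq)).
  case: (boolP (v \in \bigcup_q T q)) => // H'; apply: FA.
  move: H; rewrite inE negb_and negbK => /orP[//|/forall_inPn[q Hq]]; rewrite negbK => Hv.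
  by case/TP: H'; exists q.
rewrite partition_disjoint_bigcup; last first.
  move=> q q' Hne; rewrite -setI_eq0; apply/eqP/setP => v; rewrite !inE /T.
  case: (boolP (q \in Q)) => Hq; last by rewrite inE.
  case: (boolP (q' \in Q)) => Hq'; last by rewrite inE andbF.
  by apply/negP => /andP[v1 v2]; rewrite (thr_disjQ Hq Hq' v1 v2) eqxx in Hne.
rewrite [RHS]big_mkcond /=; apply: eq_bigr => q _; rewrite /T.
case: (boolP (q \in Q)) => Hq; last by rewrite big_set0.
by rewrite big_thr ?big_mkord //; apply: Qport.
Qed.

(** The thread is cut before the first and after the last token. The outer pieces have constant
    labels [lbin q] and [rbin q]; the middle piece is a translate of its copy at phase 0. *)
Lemma seg_sum a q (x : bin) : valid a -> q \in Q ->
  \sum_(0 <= j < tlen q) (~~ tok p (a q) (s q) j && (tlab q (idx (a q) (s q) j) == x) : nat) =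
  (lbin q == x) * a q + (rbin q == x) * (room q - a q) +
  \sum_(0 <= k < ((s q).-1 * p.+1).+1)
     (~~ tok p 0 (s q) k && (tlab q (idx 0 (s q) k) == x)).
Proof.
move=> Va Hq; have s0 := s_gt0 Hq; have := Va q Hq; set K := _ * p.+1 => HK.
have H1 : a q <= tlen q by lia.
have H2 : a q + K.+1 <= tlen q by lia.
have H3 : a q <= a q + K.+1 by lia.
rewrite (@big_cat_nat _ _ _ (a q) 0 (tlen q)) // (@big_cat_nat _ _ _ (a q + K.+1) (a q) (tlen q)) //.
rewrite /= [X in _ + X = _]addnC addnA; congr (_ + _); first congr (_ + _).
- rewrite (eq_big_nat _ _ (F2 := fun=> nat_of_bool (lbin q == x))).
    by rewrite sum_nat_const_nat subn0 mulnC.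
  move=> j /= Hj; have /eqP -> : idx (a q) (s q) j == 0 by rewrite idx0.
  by rewrite /tok leqNgt Hj.
- rewrite (eq_big_nat _ _ (F2 := fun=> nat_of_bool (rbin q == x))).
    by rewrite sum_nat_const_nat mulnC /room -/K; congr (_ * _); lia.
  move=> j /= Hj; have /eqP -> : idx (a q) (s q) j == s q by rewrite idx_last //; lia.
  rewrite /tlab eqxx ifF; last by lia.
  rewrite /tok; case: (_ <= j) => //=; case: (boolP (_ %| _)) => //= Hd.
  rewrite ltn_divLR //; have -> : (j - a q < s q * p.+1) = false => //.
  apply/negbTE; rewrite -leqNgt; have /dvdnP[k Hk] := Hd.
  rewrite Hk leq_mul2r /=; have : K < k * p.+1 by rewrite -Hk; lia.
  by rewrite /K ltn_mul2r /=; lia.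
- rewrite -{1}[a q]add0n [a q + _]addnC big_addn addnK; apply: eq_big_nat => k _.
  by rewrite /tok /idx leq_addl addnK ltn0 subn0 leq0n ifF //; lia.
Qed.

Lemma cnt_load a x : valid a -> cnt a x = load Q lbin rbin base room a x.
Proof.
move=> Va; rewrite /cnt -sum1dep_card big_mkcond /=.
rewrite sum_split; last by move=> v HA; rewrite inE HA.
rewrite /load /base -addnA; congr (_ + _).
  by apply: eq_bigr => v Hv; rewrite h_SS // lab_h //=; case: eqP.
rewrite -big_split /=; apply: eq_bigr => q Hq; rewrite addnC -seg_sum //.
by apply: eq_big_nat => j /= Hj; rewrite in_SS_th // lab_th.
Qed.

Lemma valid_room a q : valid a -> q \in Q -> a q <= room q.
Proof. by move=> Va Hq; have := Va q Hq; rewrite /room; lia. Qed.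

(** The surviving vertices are counted by the total load, which is the same for all phases. *)
Lemma card_SS a a' : valid a -> valid a' -> #|SS a| = #|SS a'|.
Proof.
suff H b : valid b -> #|~: SS b| = \sum_x base x + \sum_(q in Q) room q.
  by move=> Va Va'; have := cardsC (SS a); have := cardsC (SS a'); rewrite !H //; lia.
move=> Vb; rewrite -(@sum_load _ _ Q lbin rbin base room b); last by move=> q; apply: valid_room.
rewrite -(eq_bigr _ (fun x _ => cnt_load x Vb)) /cnt -sum1_card.
rewrite (partition_big (lab b) xpredT) //=; apply: eq_bigr => x _.
by rewrite sum1dep_card; apply: eq_card => v; rewrite !in_set.
Qed.

Lemma SS_eq a b : (forall q, q \in Q -> a q = b q) -> SS a = SS b.
Proof.
move=> H; apply: SS_ext => [q j Hq Hj|v Hv]; last exact: in_SS_out.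
by rewrite in_SS_th // H.
Qed.

(** A phase is raised by shifting from its own port and lowered by shifting from the partner, so a
    simultaneous nudge is a shift along one subset of Y. *)
Lemma shall_nudge a a' (D : {set V}) : valid a -> valid a' ->
  (forall q, q \in D -> active Q a a' q) ->
  let b := [set y in Y | (y \in D) && (a y < a' y) || (partner y \in D) && (a' (partner y) < a (partner y)) && port y] in
  shall b (SS a) = SS (nudge a a' D) /\ valid (nudge a a' D).
Proof.
move=> Va Va' DA b; have DQ q : q \in D -> q \in Q by case/DA/andP.
(* The phases reached once the ports in [l] have been treated; each thread of [D] is moved by
   exactly one port. *)
pose part (l : seq V) q := if q \in D then (if a q < a' q then a q + (q \in l) else a q - (partner q \in l)) else a q.
have Vpart l : valid (part l).
  move=> q Hq; have := Va q Hq; have := Va' q Hq; rewrite /part.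
  move: (_ * _) => z; case: ifP => // _.
  by case: (ltnP (a q) (a' q)) => H; [case: (q \in l)|case: (_ \in l)]; lia.
have fold l : uniq l -> foldl (fun S y => if y \in b then shf S y else S) (SS a) l = SS (part l).
  elim/last_ind: l => [|l y IH].
    by move=> _; apply: SS_eq => q _; rewrite /part; case: ifP => // _; rewrite addn0 subn0 if_same.
  rewrite rcons_uniq => /andP[yl Ul]; rewrite foldl_rcons IH //.
  case: ifP => [|/negbT yb].
    rewrite inE => /andP[yY /orP[/andP[yD ya]|/andP[/andP[yD ya] py]]].
      rewrite shf_fwd ?DQ //; apply: SS_eq => q Hq; rewrite /upda /part.
      case: eqP => [->|/eqP Nq]; first by rewrite yD ya (negbTE yl) mem_rcons mem_head addn0 addn1.
      case: ifP => // qD; rewrite !mem_rcons !in_cons (negbTE Nq).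
      case: ifP => // _; case: eqP => // Ep.
      by have := Qpart Hq; rewrite Ep DQ.
    set q0 := partner y in yD ya; have Ey : y = partner q0 by rewrite partnerK.
    have pl : part l q0 = a q0 by rewrite /part yD -Ey (negbTE yl) subn0 [a q0 < _]ltnNge (ltnW ya).
    rewrite {1}Ey shf_bwd ?DQ // ?pl; last by lia.
    apply: SS_eq => q Hq; rewrite /upda; case: eqP => [->|/eqP Nq].
      by rewrite /part yD ltnNge (ltnW ya) /= mem_rcons in_cons -Ey eqxx subn1.
    rewrite /part; case: ifP => // qD; rewrite !mem_rcons !in_cons.
    case: ifP => [Hlt|_].
      case: eqP => // Eq; have := Qpart (DQ _ yD); rewrite -Ey -Eq.
      by rewrite Hq.
    case: eqP => // Eq; move: Nq; rewrite /q0 -Eq partnerK ?eqxx //; exact: Qport.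
  apply: SS_eq => q Hq; rewrite /part; case: ifP => // qD; rewrite !mem_rcons !in_cons.
  have pq := Qport Hq; case: (ltnP (a q) (a' q)) => H.
    case: eqP => // Eq; subst q; move: yb; rewrite inE qD H andbT.
    by case/andP: pq => ->.
  case: eqP => // Eq; move: yb; rewrite inE -Eq partnerK // qD partner_Y // port_partner //=.
  have := DA _ qD; rewrite /active Hq /= => Hne.
  by have -> : a' q < a q; [lia|rewrite orbT].
have Ep q : q \in Q -> part (enum V) q = nudge a a' D q.
  by move=> Hq; rewrite /part /nudge !mem_enum addn1 subn1.
rewrite /shall fold ?enum_uniq //; split; first exact: SS_eq.
by move=> q Hq; rewrite -Ep //; apply: Vpart.
Qed.

(** The loads of the feasible family [a'] are at most [p] and an infeasible [a] has a larger one,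
    which is the situation of [improve]. *)
Theorem local_improve a a' : valid a -> valid a' ->
  (forall v, v \notin SS a' -> #|component E (SS a') v| <= p) ->
  ~ (forall v, v \notin SS a -> #|component E (SS a) v| <= p) ->
  exists b : {set V}, [/\ b \subset Y, #|shall b (SS a)| = #|SS a| & psi (shall b (SS a)) < psi (SS a)].
Proof.
move=> Va Va' Hf Hn.
have [v Hv Hp] : exists2 v, v \notin SS a & p < #|component E (SS a) v|.
  case: (pickP [pred v | (v \notin SS a) && (p < #|component E (SS a) v|)]) => [v /andP[]|H].
    by exists v.
  by case: Hn => v Hv; have := H v; rewrite /= Hv /= ltnNge => /negbFE.
rewrite card_component // cnt_load // in Hp.
have Hload x : load Q lbin rbin base room a' x <= p.
  rewrite -cnt_load //; have [->//|/card_gt0P[u]] := posnP (cnt a' x).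
  by rewrite in_set => /andP[Hu /eqP <-]; rewrite -card_component // Hf.
have [D [D1 D2]] := improve (fun q => @valid_room a q Va) (fun q => @valid_room a' q Va') Hload Hp.
have := shall_nudge Va Va' D1; set b := [set y in Y | _] => /= -[E1 V1].
exists b; split; first by apply/subsetP => y; rewrite inE => /andP[].
  by rewrite E1; apply: card_SS.
rewrite E1 !psi_cnt //.
by rewrite (eq_bigr _ (fun x _ => congr1 (fun k => k ^ 2) (cnt_load x V1)))
  [ltnRHS](eq_bigr _ (fun x _ => congr1 (fun k => k ^ 2) (cnt_load x Va))).
Qed.

End Family.
End Moves.

End Families.

(** * Normalising a feasible deletion set into a family of tokens *)

Module Completeness.
Import Threads Flow Families.

Section Normal.
Variables (n : nat) (E : {set {set 'I_n}}) (Y : {set 'I_n}).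
Notation V := 'I_n.
Notation adj := (adj E).
Notation zn := (zn E Y).
Notation th := (th E Y).
Notation port := (port E Y).
Notation tlen := (tlen E Y).
Notation partner := (partner E Y).
Notation thr := (thr E Y).
Hypothesis simpleE : simple_graph E.
Hypothesis deg2 : forall z, z \notin Y -> exists u w, u != w /\ forall v, adj z v = (v == u) || (v == w).
Hypothesis one_port : forall y b b', y \in Y -> adj y b -> b \notin Y -> adj y b' -> b' \notin Y -> b = b'.
Variable x0 : V.
Hypothesis x0Y : x0 \in Y.
Hypothesis connE : forall x, connect adj x0 x.

Let th_lt := th_lt simpleE deg2.
Let th_inj := th_inj simpleE deg2.
Let tlen_gt0 := tlen_gt0 simpleE deg2.
Let th_nbE := th_nbE simpleE deg2.

Lemma component_closed (S C : {set V}) v : v \in C ->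
  (forall x y, x \in C -> adj x y -> y \notin S -> y \in C) -> component E S v \subset C.
Proof.
move=> vC HC; apply/subsetP => u; rewrite inE => /andP[_ /connectP[l]].
elim: l v vC => [|w l IH] v vC /=; first by move=> _ ->.
case/andP => /and3P[_ wS vw] Hl El; apply: IH Hl El.
exact: HC vC vw wS.
Qed.

(** A walk in G - S that starts in [K] never leaves it, so it avoids [T] as well. *)
Lemma component_mono (S T K : {set V}) v : v \in K -> v \notin S ->
  (forall x y, x \in K -> adj x y -> y \notin S -> y \in K) ->
  (forall x, x \in K -> x \notin T) -> component E S v \subset component E T v.
Proof.
move=> vK vS HK HT; apply/subsetP => u; rewrite !inE => /andP[uS /connectP[l]].
elim: l v vK vS => [|w l IH] v vK vS /=; first by move=> _ ->; rewrite HT //= connect0.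
case/andP => /and3P[_ wS vw] Hl El; have wK := HK v w vK vw wS.
have /andP[-> H] := IH w wK wS Hl El; apply: connect_trans (connect1 _) H.
by rewrite /adj_minus !HT.
Qed.

Lemma gap_component (S : {set V}) q t j u p : port q -> t < j < u -> u < tlen q -> u <= t + p.+1 ->
  th q t \in S -> th q u \in S -> #|component E S (th q j)| <= p.
Proof.
move=> pq /andP[tj ju] uL utp tS uS.
pose C : {set V} := [set th q (t.+1 + nat_of_ord k) | k : 'I_(u - t.+1)].
have CP v : reflect (exists2 i, t < i < u & v = th q i) (v \in C).
  apply: (iffP imsetP) => [[k _ ->]|[i Hi ->]].
    by exists (t.+1 + k) => //; have := ltn_ord k; lia.
  have Hk : i - t.+1 < u - t.+1 by lia.
  by exists (Ordinal Hk) => //=; congr th; lia.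
apply: leq_trans (subset_leq_card (component_closed (C := C) _ _)) _.
- by apply/CP; exists j; rewrite // tj.
- move=> x y /CP[i Hi ->]; rewrite th_nbE //; last by lia.
  case: i Hi => [|i] Hi //= /orP[] /eqP -> yS; apply/CP.
    by exists i => //; case: (ltngtP t i) => Ht; [lia|lia|rewrite -Ht tS in yS].
  by exists i.+2 => //; case: (ltngtP i.+2 u) => Ht; [lia|lia|rewrite Ht uS in yS].
- by apply: leq_trans (leq_imset_card _ _) _; rewrite cardT size_enum_ord; lia.
Qed.

(** Picks one of the two ports of each thread. *)
Definition ori : {set V} := [set y | port y && (y < partner y)].

Lemma ori_port q : q \in ori -> port q. Proof. by rewrite inE => /andP[]. Qed.

Lemma ori_partner q : q \in ori -> partner q \notin ori.
Proof.
by rewrite !inE => /andP[pq Hq]; rewrite partnerK // negb_and -leqNgt (ltnW Hq) orbT.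
Qed.

Lemma ori_or y : port y -> y \in ori \/ partner y \in ori.
Proof.
move=> py; rewrite !inE partnerK // py port_partner //=.
have := partner_neq simpleE deg2 one_port py; rewrite -val_eqE /=.
by case: (ltngtP y (partner y)) => // _ _; [left|right].
Qed.

Lemma ori_disj q q' v : q \in ori -> q' \in ori -> v \in thr q -> v \in thr q' -> q = q'.
Proof.
move=> Hq Hq' v1 v2; have [//|E1] := thr_disj simpleE deg2 one_port (ori_port Hq) (ori_port Hq') v1 v2.
by have := ori_partner Hq; rewrite -E1 Hq'.
Qed.

Lemma ori_cover v : v \notin Y -> exists2 q, q \in ori & v \in thr q.
Proof.
move=> /(thr_cover simpleE deg2 one_port x0Y connE) [y py Hv].
by case: (ori_or py) => Hy; [exists y|exists (partner y); rewrite // thr_partner].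
Qed.

Lemma card_split (S : {set V}) : #|S| = #|S :&: Y| + \sum_(q in ori) #|S :&: thr q|.
Proof.
rewrite -(cardsID Y S); congr (_ + _).
pose T q := if q \in ori then S :&: thr q else set0.
have -> : S :\: Y = \bigcup_q T q.
  apply/setP => v; rewrite in_setD; apply/andP/bigcupP => [[/ori_cover[q Hq Hv] vS]|[q _]].
    by exists q; rewrite // /T Hq inE vS.
  rewrite /T; case: (boolP (q \in ori)) => [Hq|_]; last by rewrite inE.
  by rewrite inE => /andP[-> Hv]; split=> //; apply: thr_notY (ori_port Hq) Hv.
rewrite -sum1_card partition_disjoint_bigcup; last first.
  move=> q q' Hne; rewrite -setI_eq0; apply/eqP/setP => v; rewrite !inE /T.
  case: (boolP (q \in ori)) => Hq; last by rewrite in_set0.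
  case: (boolP (q' \in ori)) => Hq'; last by rewrite in_set0 andbF.
  rewrite !inE; apply/negP => /andP[/andP[_ v1] /andP[_ v2]].
  by rewrite (ori_disj Hq Hq' v1 v2) eqxx in Hne.
rewrite [RHS]big_mkcond /=; apply: eq_bigr => q _; rewrite /T.
by case: (q \in ori); rewrite ?big_set0 // sum1_card.
Qed.

Variables (p : nat) (T : {set V}).
Hypothesis feasT : forall v, v \notin T -> #|component E T v| <= p.

Definition tk q : nat := #|T :&: thr q|.
Definition s0 q : nat := ((tlen q).-1 %/ p.+1).+1.
Definition cut q : bool := (q \in ori) && (0 < tk q).
Definition frozen q : bool := cut q && (s0 q < tk q).
(* [s0 q] tokens at distance [p.+1] suffice on the thread of [q]; when [T] uses more, tokens at all
   the multiples of [p.+1] and at the last vertex do at least as well, and are never moved. *)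
Definition AA : {set V} := [set v | (v \in T) && (v \in Y) ||
  [exists q, [exists j : 'I_(tlen q),
     [&& frozen q, v == th q j & (p.+1 %| j) || (j == (tlen q).-1 :> nat)]]]].
Definition QQ : {set V} := [set q | cut q && (tk q <= s0 q)].
(** Phases of the initial family. Both values are produced by a counter that ignores the length of
    the thread. *)
Definition aa0 q : nat := if tk q == s0 q then 0 else p.
Definition afirst q : nat := find (fun j => th q j \in T) (iota 0 (tlen q)).
Definition roomq q : nat := (tlen q).-1 - (tk q).-1 * p.+1.
(** Phases of the target family: the first token replaces the first vertex of [T] on the thread,
    unless it must be moved forward to make room for the others. *)
Definition aa1 q : nat := minn (afirst q) (roomq q).
Definition blast q : nat := find (fun j => th q ((tlen q).-1 - j) \in T) (iota 0 (tlen q)).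

(** Otherwise p + 1 consecutive thread vertices would survive in one component. *)
Lemma window q i : port q -> i + p < tlen q -> exists2 j, i <= j <= i + p & th q j \in T.
Proof.
move=> pq Hi; case: (pickP [pred k : 'I_p.+1 | th q (i + k) \in T]) => [k Hk|Hn].
  by exists (i + k) => //; have := ltn_ord k; lia.
have HT k : k <= p -> th q (i + k) \notin T.
  by move=> Hk; have /= := Hn (Ordinal (Hk : k < p.+1)) => ->.
have conn k : k <= p -> connect (adj_minus E T) (th q i) (th q (i + k)).
  elim: k => [|k IH] Hk; first by rewrite addn0 connect0.
  apply: connect_trans (IH (ltnW Hk)) (connect1 _).
  rewrite /adj_minus !HT ?(ltnW Hk) //= -/(Defs.adj E _ _) th_nbE ?addnS ?eqxx ?orbT //; lia.
have := feasT (HT 0 isT); rewrite addn0 leqNgt; case/negP.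
pose C : {set V} := [set th q (i + nat_of_ord k) | k : 'I_p.+1].
have <- : #|C| = p.+1.
  rewrite card_imset ?card_ord // => k k' /th_inj => /(_ pq) H.
  by apply/val_inj/eqP; rewrite -(eqn_add2l i) H //; have := ltn_ord k; have := ltn_ord k'; lia.
apply/subset_leq_card/subsetP => v /imsetP[k _ ->].
by rewrite inE HT ?conn // -ltnS.
Qed.

Lemma tkE q : port q -> tk q = \sum_(0 <= j < tlen q) (th q j \in T).
Proof. by move=> pq; rewrite /tk (card_thr simpleE deg2) // big_mkord. Qed.

Lemma tk_has q : port q -> 0 < tk q -> exists2 j, j < tlen q & th q j \in T.
Proof.
move=> pq /card_gt0P[v]; rewrite inE => /andP[vT /thrP[j Hj Ev]].
by exists j; rewrite // -Ev.
Qed.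

Lemma afirstP q : port q -> 0 < tk q ->
  [/\ afirst q < tlen q, th q (afirst q) \in T & forall j, j < afirst q -> th q j \notin T].
Proof.
move=> pq /(tk_has pq) [j Hj jT].
have Hh : has (fun j => th q j \in T) (iota 0 (tlen q)).
  by apply/hasP; exists j; rewrite // mem_iota.
have Hlt : afirst q < tlen q by move: Hh; rewrite has_find size_iota.
split=> // [|i Hi]; first by have := nth_find 0 Hh; rewrite nth_iota.
by have := before_find 0 Hi; rewrite nth_iota ?add0n => [->//|]; apply: ltn_trans Hlt.
Qed.

Lemma blastP q : port q -> 0 < tk q ->
  [/\ blast q < tlen q, th q ((tlen q).-1 - blast q) \in T &
      forall j, (tlen q).-1 - blast q < j < tlen q -> th q j \notin T].
Proof.
move=> pq /(tk_has pq) [j Hj jT].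
have Hh : has (fun j => th q ((tlen q).-1 - j) \in T) (iota 0 (tlen q)).
  apply/hasP; exists ((tlen q).-1 - j); first by rewrite mem_iota; lia.
  by have -> : (tlen q).-1 - ((tlen q).-1 - j) = j by lia.
have Hlt : blast q < tlen q by move: Hh; rewrite has_find size_iota.
split=> // [|i Hi]; first by have := nth_find 0 Hh; rewrite nth_iota.
have Hi' : (tlen q).-1 - i < blast q by lia.
have := before_find 0 Hi'; rewrite nth_iota ?add0n; last by lia.
by have -> : (tlen q).-1 - ((tlen q).-1 - i) = i; [lia|move=> ->].
Qed.

Lemma afirst_le q : port q -> 0 < tk q -> afirst q <= p.
Proof.
move=> pq tq; have [H1 _ H3] := afirstP pq tq; rewrite leqNgt; apply/negP => H.
have [j Hj jT] := @window q 0 pq ltac:(lia).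
by have := H3 j ltac:(lia); rewrite jT.
Qed.

Lemma blast_le q : port q -> 0 < tk q -> blast q <= p.
Proof.
move=> pq tq; have [H1 _ H3] := blastP pq tq; rewrite leqNgt; apply/negP => H.
have [j Hj jT] := @window q (tlen q - p.+1) pq ltac:(lia).
by have := H3 j ltac:(lia); rewrite jT.
Qed.

Lemma window_sum q i k : port q -> i + k * p.+1 <= tlen q ->
  k <= \sum_(i <= j < i + k * p.+1) (th q j \in T).
Proof.
move=> pq; elim: k => // k IH; rewrite mulSn => H.
have H1 : i <= i + k * p.+1 by lia.
have H2 : i + k * p.+1 <= i + (p.+1 + k * p.+1) by lia.
rewrite (@big_cat_nat _ _ _ (i + k * p.+1)) //= -addn1 leq_add ?IH //; first by lia.
have [j Hj jT] := @window q (i + k * p.+1) pq ltac:(lia).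
rewrite (bigD1_seq j) ?iota_uniq ?jT //= mem_index_iota; lia.
Qed.

(** If it failed, [(tk q).-1] disjoint windows would fit strictly between the first and the last
    vertex of [T] on the thread, giving more than [tk q] vertices of [T] in all. *)
Lemma tk_bound q : port q -> 0 < tk q -> (tlen q).-1 <= afirst q + blast q + (tk q).-1 * p.+1.
Proof.
move=> pq tq; have [A1 A2 A3] := afirstP pq tq; have [B1 B2 B3] := blastP pq tq.
rewrite leqNgt; apply/negP => H.
have L1 := tlen_gt0 pq.
have H1 : (afirst q).+1 + (tk q).-1 * p.+1 <= (tlen q).-1 - blast q by lia.
have C4 : (afirst q).+1 + (tk q).-1 * p.+1 <= tlen q by move: (_ * _) H1 => z; lia.
have := @window_sum q (afirst q).+1 (tk q).-1 pq C4.
set W := \sum_(_ <= j < _) _ => HW.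
have : tk q = \sum_(0 <= j < tlen q) (th q j \in T) by apply: tkE.
have C1 : 0 <= afirst q by [].
have C2 : afirst q <= tlen q by lia.
have C3 : (afirst q).+1 <= (afirst q).+1 + (tk q).-1 * p.+1 by apply: leq_addr.
pose f j : nat := th q j \in T.
have D1 : \sum_(0 <= j < tlen q) f j = \sum_(0 <= j < afirst q) f j + \sum_(afirst q <= j < tlen q) f j.
  exact: big_cat_nat.
have D2 : \sum_(afirst q <= j < tlen q) f j = f (afirst q) + \sum_((afirst q).+1 <= j < tlen q) f j.
  exact: big_ltn.
have D3 : \sum_((afirst q).+1 <= j < tlen q) f j =
    W + \sum_((afirst q).+1 + (tk q).-1 * p.+1 <= j < tlen q) f j.
  exact: big_cat_nat.
have D4 : 0 < \sum_((afirst q).+1 + (tk q).-1 * p.+1 <= j < tlen q) f j.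
  rewrite (bigD1_seq ((tlen q).-1 - blast q)) ?iota_uniq //=; last first.
    by rewrite mem_index_iota H1 /=; lia.
  by rewrite /f B2.
have A2' : f (afirst q) = 1 by rewrite /f A2.
rewrite -[\sum_(0 <= j < tlen q) _]/(\sum_(0 <= j < tlen q) f j) D1 D2 D3 A2'.
move: HW D4; clear D1 D2 D3; clearbody W.
by move: (\sum_(_ + _ <= j < _) _) (\sum_(0 <= j < _) _) => x y; lia.
Qed.

Lemma QQP q : q \in QQ -> [/\ q \in ori, port q, 0 < tk q & tk q <= s0 q].
Proof. by rewrite inE => /andP[/andP[Hq H1] H2]; rewrite Hq H1 H2 ori_port. Qed.

(** Both ends of the thread outside the span of [T] have at most [p] vertices, so [tk_bound] leaves
    only the two largest numbers of tokens; the smaller one also needs a remainder below [p]. *)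
Lemma QQ_cases q : q \in QQ ->
  let m := (tlen q).-1 %/ p.+1 in let b := (tlen q).-1 %% p.+1 in
  (tk q = m.+1) \/ [/\ tk q = m, tk q <> s0 q & b < p].
Proof.
move=> /QQP[_ pq tq ts] m b; have := tk_bound pq tq.
have := afirst_le pq tq; have := blast_le pq tq; have := divn_eq (tlen q).-1 p.+1.
move: ts; rewrite /s0 -/m -/b => ts -> H1 H2 H3.
have bp : b <= p by rewrite -ltnS ltn_mod.
case: (ltngtP (tk q) m.+1) ts => // [H _|]; last by left.
right; suff E1 : tk q = m by split=> //; [lia|move: H3; rewrite E1; case: (m) E1 tq => [|k] -> // _; rewrite mulSn; lia].
apply/eqP; rewrite eqn_leq -ltnS H /= leqNgt; apply/negP => H4.
have : (tk q).-1 * p.+1 + 2 * p.+1 <= m * p.+1 by rewrite -mulnDl leq_mul2r; lia.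
lia.
Qed.

Lemma AA_Y v : v \in Y -> (v \in AA) = (v \in T).
Proof.
move=> vY; rewrite inE vY andbT; case: (v \in T) => //=.
apply/existsP => -[q /existsP[j /and3P[/andP[/andP[Hq _] _] /eqP Ev _]]].
by have := th_lt (ori_port Hq) (ltn_ord j); rewrite -Ev vY.
Qed.

Lemma AA_th q j : q \in ori -> j < tlen q ->
  (th q j \in AA) = frozen q && ((p.+1 %| j) || (j == (tlen q).-1)).
Proof.
move=> Hq Hj; rewrite inE (negbTE (th_lt (ori_port Hq) Hj)) andbF /=.
apply/existsP/andP => [[q' /existsP[j' /and3P[Hf /eqP Ev Hd]]]|[Hf Hd]].
  have Hq' : q' \in ori by case/andP: Hf => /andP[].
  have Eq : q = q' by apply: (ori_disj Hq Hq' (v := th q j)); [|rewrite Ev]; apply: mem_thr.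
  by subst q'; rewrite (th_inj (ori_port Hq) Hj (ltn_ord j') Ev).
by exists q; apply/existsP; exists (Ordinal Hj); rewrite Hf eqxx.
Qed.

Lemma Qport q : q \in QQ -> port q. Proof. by case/QQP. Qed.
Lemma Qpart q : q \in QQ -> partner q \notin QQ.
Proof. by case/QQP => /ori_partner H _ _ _; apply: contra H => /QQP[]. Qed.
Lemma s_gt0 q : q \in QQ -> 0 < tk q. Proof. by case/QQP. Qed.
Lemma frozenF q : q \in QQ -> frozen q = false.
Proof. by case/QQP => _ _ _ H; rewrite /frozen ltnNge H andbF. Qed.

Lemma AQ q v : q \in QQ -> v \in thr q -> v \notin AA.
Proof. by move=> Hq /thrP[j Hj ->]; rewrite AA_th ?frozenF //; case/QQP: Hq. Qed.

(** A frozen thread has tokens on both end vertices, so it blocks shifts from either port; any other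
    thread outside [QQ] carries no token. *)
Lemma Afrozen y : port y -> y \notin QQ -> partner y \notin QQ ->
  (forall v, v \in thr y -> v \notin AA) \/ th y (tlen y).-1 \in AA.
Proof.
move=> py yQ pQ; have L0 := tlen_gt0 py.
have [q [Hq Hqy qQ]] : exists q, [/\ q \in ori, q = y \/ y = partner q & q \notin QQ].
  case: (ori_or py) => H; first by exists y; split=> //; left.
  by exists (partner y); split=> //; right; rewrite partnerK.
have pq := ori_port Hq.
case: (boolP (frozen q)) => Hf; last first.
  left => v; have -> : thr y = thr q by case: Hqy => [->|->] //; rewrite thr_partner.
  by move=> /thrP[j Hj ->]; rewrite AA_th // (negbTE Hf).
right; case: Hqy => Ey; first by rewrite -Ey AA_th ?Hf ?eqxx ?orbT // Ey prednK.
have Lq : tlen y = tlen q by rewrite Ey tlen_partner.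
have -> : th y (tlen y).-1 = th q 0.
  by rewrite Ey tlen_partner // th_partner ?leq_pred // -Lq; have -> : tlen y - (tlen y).-1 = 1 by lia.
by rewrite AA_th ?Hf ?dvdn0 // -Lq.
Qed.

Notation VV := (valid E Y p QQ tk).
Notation SSS := (SS E Y p AA QQ tk).

Lemma valid0 : VV aa0.
Proof.
move=> q Hq; have := QQ_cases Hq; have [_ pq tq ts] := QQP Hq; have L0 := tlen_gt0 pq.
have := divn_eq (tlen q).-1 p.+1; rewrite /aa0 /s0 /=; set m := _ %/ _ => Ed.
case=> [->|[E1 E2 E3]]; first by rewrite eqxx /= add0n; lia.
rewrite ifF; last by apply/eqP.
by move: tq; rewrite E1; case: m Ed {E1 E2} => // m; rewrite mulSn /=; lia.
Qed.

Lemma mul_le q : q \in QQ -> (tk q).-1 * p.+1 <= (tlen q).-1.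
Proof.
by move=> Hq; have := valid0 Hq; have := tlen_gt0 (Qport Hq); lia.
Qed.

Lemma valid1 : VV aa1.
Proof.
move=> q Hq; have := mul_le Hq; have := tlen_gt0 (Qport Hq); rewrite /aa1 /roomq; lia.
Qed.

Lemma in_SSS a q j : q \in QQ -> j < tlen q -> (th q j \in SSS a) = tok p (a q) (tk q) j.
Proof.
exact: (in_SS_th simpleE deg2 one_port p tk Qport Qpart AQ).
Qed.

Lemma in_SSS_out a v : (forall q, q \in QQ -> v \notin thr q) -> (v \in SSS a) = (v \in AA).
Proof. exact: in_SS_out. Qed.

Lemma SSS_Y a v : v \in Y -> (v \in SSS a) = (v \in T).
Proof.
move=> vY; rewrite in_SSS_out ?AA_Y // => q Hq; apply: contraL vY.
exact: thr_notY (Qport Hq).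
Qed.

Lemma SSS_th a q j : q \in ori -> q \notin QQ -> j < tlen q ->
  (th q j \in SSS a) = frozen q && ((p.+1 %| j) || (j == (tlen q).-1)).
Proof.
move=> Hq qQ Hj; rewrite in_SSS_out ?AA_th // => q' Hq'.
apply/negP => Hv; have [Hq'o _ _ _] := QQP Hq'.
by move: qQ; rewrite (ori_disj Hq Hq'o (mem_thr Hj) Hv) Hq'.
Qed.

(** Survivors enclosed between two tokens of one thread. Their components are gaps, whereas all
    other survivors are compared with [T]. *)
Definition midv : {set V} := [set v | [exists q, [exists j : 'I_(tlen q),
   [&& q \in ori, v == th q j, th q j \notin SSS aa1 &
     frozen q || (q \in QQ) && (aa1 q <= j < aa1 q + (tk q).-1 * p.+1)]]]].

Lemma midP v : reflect (exists q j, [/\ q \in ori, j < tlen q, v = th q j, th q j \notin SSS aa1 &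
   frozen q || (q \in QQ) && (aa1 q <= j < aa1 q + (tk q).-1 * p.+1)]) (v \in midv).
Proof.
rewrite inE; apply: (iffP existsP) => [[q /existsP[j /and4P[H1 /eqP H2 H3 H4]]]|[q [j [H1 H2 H3 H4 H5]]]].
  by exists q, j.
by exists q; apply/existsP; exists (Ordinal H2); rewrite H1 H3 eqxx H4.
Qed.

Lemma mid_small v : v \in midv -> #|component E (SSS aa1) v| <= p.
Proof.
case/midP => q [j [Hq Hj -> Hn H]]; have pq := ori_port Hq.
case/orP: H => [Hf|/andP[qQ Hj2]].
  have qQ : q \notin QQ by apply/negP => /frozenF; rewrite Hf.
  move: Hn; rewrite SSS_th // Hf /= negb_or => /andP[Hd Hl].
  have Ej := divn_eq j p.+1; have Hm : 0 < j %% p.+1 by rewrite lt0n.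
  have Hm2 : j %% p.+1 < p.+1 by rewrite ltn_mod.
  have Hlt : j < (tlen q).-1 by move/eqP: Hl; lia.
  have Ht : th q (j %/ p.+1 * p.+1) \in SSS aa1 by rewrite SSS_th ?Hf ?dvdn_mull //; lia.
  case: (ltnP (j %/ p.+1 * p.+1 + p.+1) (tlen q)) => Hu.
    apply: (gap_component pq _ Hu (leqnn _) Ht); first by lia.
    by rewrite SSS_th // Hf dvdn_addr ?dvdnn ?dvdn_mull.
  apply: (@gap_component _ q (j %/ p.+1 * p.+1) j (tlen q).-1 p pq) => //; try lia.
  by rewrite SSS_th ?Hf ?eqxx ?orbT //; lia.
move: Hn; rewrite in_SSS // /tok; have [-> Hj3] := andP Hj2; set k := j - aa1 q.
have Hk : k %/ p.+1 < (tk q).-1 by rewrite ltn_divLR //; lia.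
have -> : k %/ p.+1 < tk q by lia.
rewrite andbT /= => Hd.
have Ek := divn_eq k p.+1; have Hm : 0 < k %% p.+1 by rewrite lt0n.
have Hm2 : k %% p.+1 < p.+1 by rewrite ltn_mod.
have V1 := valid1 qQ.
have Hb : (k %/ p.+1).+1 * p.+1 <= (tk q).-1 * p.+1 by rewrite leq_mul2r Hk orbT.
rewrite mulSn in Hb.
apply: (@gap_component _ q (aa1 q + k %/ p.+1 * p.+1) j (aa1 q + (k %/ p.+1 * p.+1 + p.+1)) p pq); try lia.
  by rewrite in_SSS // /tok ?leq_addr ?addKn ?dvdn_mull ?mulnK //=; [lia|lia].
rewrite in_SSS //; last by lia.
rewrite /tok leq_addr addKn dvdn_addr ?dvdnn ?dvdn_mull //=.
by rewrite -mulSnr mulnK //; lia.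
Qed.

Lemma mid_nb x y : x \in midv -> adj x y -> y \notin SSS aa1 -> y \in midv.
Proof.
case/midP => q [j [Hq Hj -> Hn H]] Ha Hy; have pq := ori_port Hq.
have L0 := tlen_gt0 pq.
suff [i Hi [Ey Hf]] : exists2 i, i < tlen q & y = th q i /\
   (frozen q || (q \in QQ) && (aa1 q <= i < aa1 q + (tk q).-1 * p.+1)).
  by apply/midP; exists q, i; rewrite -Ey.
move: Ha; rewrite th_nbE //; case/orP: H => [Hf|/andP[qQ Hj2]].
  have qQ : q \notin QQ by apply/negP => /frozenF; rewrite Hf.
  move: Hn; rewrite SSS_th // Hf /= negb_or => /andP[Hd Hl].
  case: j Hj Hd Hl => [|j] Hj Hd Hl /=; first by rewrite dvdn0 in Hd.
  case/orP => /eqP ->; first by exists j => //; lia.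
  by exists j.+2 => //; move/eqP: Hl; lia.
have V1 := valid1 qQ.
have T1 : th q (aa1 q) \in SSS aa1.
  by rewrite in_SSS /tok ?leqnn ?subnn ?dvdn0 ?div0n ?s_gt0 //; lia.
have T2 : th q (aa1 q + (tk q).-1 * p.+1) \in SSS aa1.
  by rewrite in_SSS // /tok leq_addr addKn dvdn_mull //= mulnK // ltn_predL s_gt0.
have Ja : j <> aa1 q by move=> Ej; rewrite Ej T1 in Hn.
rewrite qQ; case: j Hj Hj2 Ja Hn => [|j] Hj Hj2 Ja Hn /=; first by lia.
case/orP => /eqP Ey; first by exists j; [lia|split=> //; rewrite orbC /=; lia].
have Jb : j.+2 <> aa1 q + (tk q).-1 * p.+1 by move=> Ej; rewrite Ey Ej T2 in Hy.
by exists j.+2; [lia|split=> //; rewrite orbC /=; lia].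
Qed.

(** Before its first token a thread has no vertex of [T], as [aa1 q <= afirst q]. After its last
    token it has none either: by [tk_bound] that token is not before the last vertex of [T], or it
    is the end of the thread. *)
Lemma notmid_T x : x \notin SSS aa1 -> x \notin midv -> x \notin T.
Proof.
move=> Hx Hm; case: (boolP (x \in Y)) => xY; first by rewrite -(SSS_Y aa1).
have [q Hq /thrP[j Hj Ex]] := ori_cover xY; have pq := ori_port Hq; rewrite Ex in Hx Hm *.
case: (boolP (frozen q)) => Hf.
  by case/midP: Hm; exists q, j; rewrite Hf.
case: (boolP (q \in QQ)) => qQ; last first.
  have tq : tk q = 0.
    move: qQ Hf; rewrite inE /frozen /cut Hq /=; case: (posnP (tk q)) => // _ /=.
    by rewrite -ltnNge => ->.
  apply/negP => xT; suff : 0 < tk q by rewrite tq.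
  by apply/card_gt0P; exists (th q j); rewrite inE xT; apply: mem_thr.
have [_ _ tq _] := QQP qQ.
have [A1 A2 A3] := afirstP pq tq; have [B1 B2 B3] := blastP pq tq.
case: (ltnP j (aa1 q)) => Hj1; first by apply: A3; rewrite /aa1 in Hj1; lia.
have V1 := valid1 qQ.
case: (ltnP j (aa1 q + (tk q).-1 * p.+1)) => Hj2.
  by case/midP: Hm; exists q, j; rewrite qQ Hj1 Hj2 orbT.
apply: B3; rewrite Hj andbT.
have Jn : j <> aa1 q + (tk q).-1 * p.+1.
  move=> Ej; move: Hx; rewrite in_SSS // /tok Ej leq_addr addKn dvdn_mull //= mulnK //.
  by rewrite ltn_predL tq.
have := tk_bound pq tq; have := mul_le qQ; move: Jn Hj2; rewrite /aa1 /roomq.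
by move: (_ * _) => z; lia.
Qed.

(** The survivors outside [midv] are closed under adjacency and avoid [T], so their components lie
    inside components of G - T. *)
Theorem feasible1 v : v \notin SSS aa1 -> #|component E (SSS aa1) v| <= p.
Proof.
move=> Hv; case: (boolP (v \in midv)) => [/mid_small//|Hm].
apply: leq_trans (feasT (notmid_T Hv Hm)); apply: subset_leq_card.
apply: (component_mono (K := [set x | (x \notin SSS aa1) && (x \notin midv)])) => //.
- by rewrite in_set Hv.
- move=> x y; rewrite in_set => /andP[Hx Hxm] xy Hy; rewrite in_set Hy /=.
  by apply: contra Hxm => Hym; apply: mid_nb Hym _ Hx; rewrite adjC.
- by move=> x; rewrite in_set => /andP[]; apply: notmid_T.
Qed.

Lemma tok_count a s L : \sum_(0 <= j < L) tok p a s j <= s.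
Proof.
rewrite big_mkord -[X in _ <= X]card_ord.
have -> : \sum_(j < L) tok p a s j = #|[set j : 'I_L | tok p a s j]|.
  by rewrite -sum1dep_card [RHS]big_mkcond /=; apply: eq_bigr => j _; case: (tok _ _ _ _).
case: s => [|s].
  by rewrite card_ord leqn0 cards_eq0; apply/eqP/setP => j; rewrite !inE /tok ltn0 !andbF.
pose g (j : 'I_L) : 'I_s.+1 := inord ((j - a) %/ p.+1).
rewrite -(card_in_imset (f := g)); first exact: max_card.
move=> i j; rewrite !inE => /and3P[i1 /divnK i2 i3] /and3P[j1 /divnK j2 j3] /(congr1 val).
rewrite /= !inordK // => Eij; apply/val_inj => /=; have : i - a = j - a by rewrite -i2 -j2 Eij.
lia.
Qed.

Lemma card_SSS0 : #|SSS aa0| <= #|T|.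
Proof.
rewrite [#|T|]card_split [#|SSS _|]card_split leq_add //.
  apply: subset_leq_card; apply/subsetP => v /setIP[H vY].
  by rewrite inE vY -(SSS_Y aa0 vY) H.
apply: leq_sum => q Hq; have pq := ori_port Hq; rewrite (card_thr simpleE deg2) // -/(tk q).
rewrite -(big_mkord xpredT (fun j => th q j \in SSS aa0 : nat)).
case: (boolP (q \in QQ)) => qQ.
  apply: leq_trans (tok_count (aa0 q) (tk q) (tlen q)).
  by apply: eq_leq; apply: eq_big_nat => j /= Hj; rewrite in_SSS.
rewrite (eq_big_nat _ _ (F2 := fun j => nat_of_bool (frozen q && ((p.+1 %| j) || (j == (tlen q).-1))))); last first.
  by move=> j /= Hj; rewrite SSS_th.
case: (boolP (frozen q)) => Hf; last by rewrite big1.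
(* At most [s0 q] multiples of [p.+1] and the last vertex: no more than [T] has on a frozen
   thread. *)
apply: leq_trans (_ : s0 q + 1 <= _); last by rewrite addn1; case/andP: Hf.
apply: leq_trans (leq_add (tok_count 0 (s0 q) (tlen q)) (leqnn 1)).
have -> : 1 = \sum_(0 <= j < tlen q) (j == (tlen q).-1).
  have L0 := tlen_gt0 pq.
  rewrite (bigD1_seq (tlen q).-1) ?iota_uniq ?mem_index_iota //=; last by lia.
  by rewrite eqxx big1 // => j /negbTE ->.
rewrite -big_split /= !big_nat; apply: leq_sum => j Hj.
rewrite /tok /s0 leq0n subn0 /= ltnS leq_div2r; last by lia.
by rewrite andbT; case: (_ %| _); case: (_ == _).
Qed.

(** [G1] to [G4] are the guesses that match [T]. [G3] holds the threads with one token fewer than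
    [s0], and [G4] the ports opposite to the chosen ports of frozen threads. *)
Definition G1 : {set V} := T :&: Y.
Definition G2 : {set V} := [set q | cut q].
Definition G3 : {set V} := [set q | cut q && (tk q < s0 q)].
Definition G4 : {set V} := [set y | port y && frozen (partner y)].

Lemma G2_ori q : q \in G2 -> q \in ori. Proof. by rewrite inE => /andP[]. Qed.

Definition c0 q : nat := if q \in G3 then 0 else p.

Lemma c0_le q : c0 q <= p. Proof. by rewrite /c0; case: ifP. Qed.

Lemma S1_fold (l : seq V) : uniq l ->
  let R := foldl (fun S y => if y \in G2 then pat E Y p S y (c0 y) else S) G1 l in
  (forall v, v \in Y -> (v \in R) = (v \in T)) /\
  (forall q j, q \in ori -> j < tlen q ->
     (th q j \in R) = [&& q \in l, q \in G2 & (c0 q + j) %% p.+1 == p]).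
Proof.
elim/last_ind: l => [_|l y IH] /=.
  split=> [v vY|q j Hq Hj]; first by rewrite inE vY andbT.
  by rewrite inE (negbTE (th_lt (ori_port Hq) Hj)) andbF.
rewrite rcons_uniq foldl_rcons => /andP[yl /IH]; set R := foldl _ _ _ => /= -[H1 H2].
case: (boolP (y \in G2)) => yG; last first.
  split=> // q j Hq Hj; rewrite H2 // mem_rcons in_cons; case: (q =P y) => // ->.
  by rewrite (negbTE yG) !andbF.
have Hy := G2_ori yG; have py := ori_port Hy.
have [P1 P2] := patE simpleE deg2 R py (c0_le y).
split=> [v vY|q j Hq Hj].
  by rewrite P2 ?H1 //; apply: contraL vY => /(thr_notY simpleE deg2 py).
rewrite mem_rcons in_cons; case: (q =P y) => [Eq|Nq] /=.
  by subst q; rewrite P1 // H2 // (negbTE yl) yG.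
rewrite P2 ?H2 //; apply/negP => Hv; apply: Nq.
exact: ori_disj Hq Hy (mem_thr Hj) Hv.
Qed.

Lemma S2_fold (R : {set V}) (l : seq V) v :
  (v \in foldl (fun S y => if y \in G4 then zn y |: S else S) R l) =
  (v \in R) || has (fun y => (y \in G4) && (v == zn y)) l.
Proof.
elim/last_ind: l => [|l y IH] /=; first by rewrite orbF.
rewrite foldl_rcons has_rcons; case: ifP => yG /=; last by rewrite IH.
by rewrite in_setU1 IH orbCA.
Qed.

Lemma shift_mod j : ((p + j) %% p.+1 == p) = (p.+1 %| j).
Proof.
by rewrite -[X in _ == X](@modn_small p p.+1) // -[X in _ == X %% _]addn0 eqn_modDl mod0n.
Qed.

(** On each thread the periodic pattern, cut off by the end of the thread, contains exactly the
    right number of tokens. *)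
Theorem sinit0 : sinit E Y p G1 G2 G3 G4 = SSS aa0.
Proof.
apply/setP => v; rewrite /sinit S2_fold -/(c0 _).
have [F1 F2] := S1_fold (enum_uniq V).
rewrite -[foldl _ G1 _]/(foldl (fun S y => if y \in G2 then pat E Y p S y (c0 y) else S) G1 (enum V)).
case: (boolP (v \in Y)) => vY.
  rewrite F1 // SSS_Y //; case: hasP => [[y _ /andP[]]|]; last by rewrite orbF.
  by rewrite inE => /andP[/andP[_ /negbTE zY] _] /eqP Ev; rewrite Ev zY in vY.
have [q Hq /thrP[j Hj ->]] := ori_cover vY; have pq := ori_port Hq; have L0 := tlen_gt0 pq.
rewrite F2 // mem_enum /=.
have -> : has (fun y => (y \in G4) && (th q j == zn y)) (enum V) = frozen q && (j == (tlen q).-1).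
  apply/hasP/andP => [[y _ /andP[]]|[Hf /eqP Ej]].
    rewrite inE => /andP[py Hf] /eqP Ev.
    have Hpy : partner y \in ori by case/andP: Hf => /andP[].
    have Ez : zn y = th (partner y) (tlen (partner y)).-1.
      by rewrite -(zn_partner simpleE deg2 one_port) ?port_partner // partnerK.
    have Lp : (tlen (partner y)).-1 < tlen (partner y).
      by rewrite prednK // tlen_gt0 // port_partner.
    have Eq : q = partner y.
      by apply: (ori_disj Hq Hpy (mem_thr Hj)); rewrite Ev Ez; apply: mem_thr.
    rewrite -Eq in Hf Ez Lp; split=> //; apply/eqP; rewrite Ez in Ev.
    exact: th_inj pq Hj Lp Ev.
  exists (partner q); rewrite ?mem_enum // inE port_partner // partnerK // Hf /=.
  by rewrite (zn_partner simpleE deg2 one_port) // Ej.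
case: (boolP (frozen q)) => Hf.
  have qQ : q \notin QQ by apply/negP => /frozenF; rewrite Hf.
  have [Hc Hs] := andP Hf.
  rewrite SSS_th // Hf inE Hc /c0 inE Hc /= ltnNge (ltnW Hs) /=; congr (_ || _).
  exact: shift_mod.
rewrite orbF; case: (boolP (q \in QQ)) => qQ; last first.
  rewrite SSS_th // (negbTE Hf) inE; apply/negbTE; move: qQ Hf.
  by rewrite inE /frozen /cut Hq; case: (0 < tk q) => //=; rewrite -ltnNge => ->.
have [_ _ tq ts] := QQP qQ; rewrite inE /cut Hq tq in_SSS //= /tok.
have Hlt : j %/ p.+1 <= (tlen q).-1 %/ p.+1 by rewrite leq_div2r //; lia.
rewrite /aa0 /c0 inE /cut Hq tq /=; have [E1|[E1 E2 E3]] := QQ_cases qQ.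
  rewrite /s0 E1 ltnn eqxx leq0n subn0 ltnS Hlt andbT /=.
  exact: shift_mod.
have -> : tk q < s0 q by rewrite ltn_neqAle ts andbT; apply/eqP.
have -> : (tk q == s0 q) = false by apply/eqP.
rewrite add0n; case: (leqP p j) => Hpj /=; last by rewrite modn_small //; lia.
(* Here [tk q] is one less than [s0 q]. As the remainder of [(tlen q).-1] is below [p], exactly
   [tk q] of the positions p, 2p + 1, ... lie on the thread. *)
rewrite -[in LHS](subnKC Hpj) shift_mod; case: (boolP (p.+1 %| j - p)) => //= Hd.
rewrite ltn_divLR // E1; have := divn_eq (tlen q).-1 p.+1; lia.
Qed.

Lemma G_sub : [/\ G1 \subset Y, G2 \subset Y, G3 \subset Y & G4 \subset Y].
Proof.
have H q : cut q -> q \in Y by case/andP => /ori_port /andP[].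
split; first exact: subsetIr.
- by apply/subsetP => v; rewrite inE => /H.
- by apply/subsetP => v; rewrite inE => /andP[/H].
- by apply/subsetP => v; rewrite inE => /andP[/andP[]].
Qed.

End Normal.

Section Complete.
Variables (n : nat) (E : {set {set 'I_n}}) (Y : {set 'I_n}) (x0 : 'I_n).
Hypothesis simpleE : simple_graph E.
Hypothesis deg2 : forall z, z \notin Y ->
  exists u w, u != w /\ forall v, adj E z v = (v == u) || (v == w).
Hypothesis one_port : forall y b b', y \in Y ->
  adj E y b -> b \notin Y -> adj E y b' -> b' \notin Y -> b = b'.
Hypothesis x0Y : x0 \in Y.
Hypothesis connE : forall x, connect (adj E) x0 x.

Definition feasible p (S : {set 'I_n}) : Prop :=
  forall v, v \notin S -> #|component E S v| <= p.

(** [P] hides the families: the analysis of the program uses only that the right guess satisfies it,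
    that it survives shifts preserving the cardinality, and that it permits an improvement while
    infeasible. *)
Theorem search_complete (p : nat) (T : {set 'I_n}) : feasible p T ->
  exists (G1 G2 G3 G4 : {set 'I_n}) (P : {set 'I_n} -> Prop),
  [/\ [/\ G1 \subset Y, G2 \subset Y, G3 \subset Y & G4 \subset Y],
      P (sinit E Y p G1 G2 G3 G4),
      forall S, P S -> #|S| <= #|T|,
      forall S, P S -> feasible p S \/
        exists b : {set 'I_n}, [/\ b \subset Y, #|shall E Y b S| = #|S| & psi E (shall E Y b S) < psi E S] &
      forall (S b : {set 'I_n}), b \subset Y -> P S -> #|shall E Y b S| = #|S| -> P (shall E Y b S)].
Proof.
move=> feasT.
exists (G1 Y T), (G2 E Y T), (G3 E Y p T), (G4 E Y p T), (Inv E Y p (AA E Y p T) (QQ E Y p T) (tk E Y T)).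
have V0 := valid0 simpleE deg2 x0Y feasT; have V1 := valid1 simpleE deg2 x0Y feasT.
have H1 := @Qport _ E Y p T; have H2 := @Qpart _ E Y simpleE deg2 one_port p T.
have H3 := @s_gt0 _ E Y p T; have H4 := @AQ _ E Y simpleE deg2 one_port p T.
have H5 := @Afrozen _ E Y simpleE deg2 one_port _ x0Y p T.
split.
- exact: G_sub.
- rewrite (sinit0 simpleE deg2 one_port x0Y connE feasT).
  by exists (aa0 E Y p T).
- move=> S [a Va ->]; apply: leq_trans (card_SSS0 simpleE deg2 one_port x0Y connE p T).
  by apply: eq_leq; apply: (card_SS simpleE deg2 one_port).
- move=> S [a Va ->]; set R := SS _ _ _ _ _ _ a.
  case: (pickP [pred v | (v \notin R) && (p < #|component E R v|)]) => [v /andP[v1 v2]|Hn]; last first.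
    by left=> v Hv; have := Hn v; rewrite /= Hv /= ltnNge => /negbFE.
  right; apply: (local_improve simpleE deg2 one_port H1 H2 H3 H4 Va V1).
    exact: (feasible1 simpleE deg2 one_port x0Y connE feasT).
  by move=> H; have := H v v1; rewrite leqNgt v2.
- by move=> S b bY PS; apply: (Inv_shall simpleE deg2 one_port H1 H2 H3 H4 H5).
Qed.

End Complete.

End Completeness.

(** * Bounding the core by the leaves of a maximum leaf spanning tree *)

Module Core.

Section Trees.
Variables (n : nat) (E : {set {set 'I_n}}).
Notation V := 'I_n.
Hypothesis simpleE : simple_graph E.
Hypothesis connE : connected_graph E.

Definition nb (T : {set {set V}}) (v : V) : {set V} := [set u | adj T v u].

Lemma adj_sym (T : {set {set V}}) : symmetric (adj T).
Proof. by move=> x y; rewrite /adj setUC. Qed.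

Lemma simple_sub (T : {set {set V}}) : T \subset E -> simple_graph T.
Proof. by move=> /subsetP TE e /TE /simpleE. Qed.

Lemma adj_neq (T : {set {set V}}) x y : simple_graph T -> adj T x y -> x != y.
Proof.
by move=> ST; rewrite /adj; case: eqP => [->|//] /ST; rewrite setUid cards1.
Qed.

Lemma set2_inj (v : V) : injective (fun u => [set v; u]).
Proof.
move=> u w /= E1; have : u \in [set v; w] by rewrite -E1 set22.
have : w \in [set v; u] by rewrite E1 set22.
by rewrite !inE => /orP[/eqP -> /orP[]|/eqP ->//] /eqP.
Qed.

Lemma degree_nb (T : {set {set V}}) v : simple_graph T -> degree T v = #|nb T v|.
Proof.
move=> ST; rewrite /degree -(card_imset _ (@set2_inj v)); apply: eq_card => e.
rewrite inE; apply/andP/imsetP => [[eT ve]|[u]]; last first.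
  by rewrite inE => Hu ->; rewrite set21.
have /eqP /cards2P [x [y [xy Ee]]] := ST e eT; move: ve eT; rewrite Ee !inE.
case/orP => /eqP -> eT; first by exists y; rewrite ?inE.
by exists x; rewrite ?inE /adj setUC.
Qed.

Lemma sum_degree (T : {set {set V}}) : simple_graph T -> \sum_v degree T v = 2 * #|T|.
Proof.
move=> ST; rewrite (eq_bigr (fun v : V => \sum_(e in T) (v \in e : nat))); last first.
  move=> v _; rewrite /degree -sum1_card big_mkcond [RHS]big_mkcond /=.
  by apply: eq_bigr => e _; rewrite inE; case: (e \in T); case: (v \in e).
rewrite exchange_big /= (eq_bigr (fun=> 2)) ?sum_nat_const 1?mulnC // => e eT.
by rewrite -(ST e eT) -sum1_card [RHS]big_mkcond /=; apply: eq_bigr => v _; case: (v \in e).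
Qed.

Lemma cross (T : {set {set V}}) (U : {set V}) x y : x \in U -> y \notin U -> connect (adj T) x y ->
  exists u w, [/\ u \in U, w \notin U & adj T u w].
Proof.
move=> xU yU /connectP[l]; elim: l x xU => [|z l IH] x xU /=; first by move=> _ Ey; rewrite Ey xU in yU.
case/andP => xz Hl El; case: (boolP (z \in U)) => zU; first exact: IH zU Hl El.
by exists x, z.
Qed.

Lemma grow (x0 : V) m : 0 < m <= n -> exists (T : {set {set V}}) (U : {set V}),
  [/\ T \subset E, x0 \in U, #|U| = m, #|T|.+1 = m &
   (forall x, x \in U -> connect (adj T) x0 x) /\ (forall e, e \in T -> e \subset U)].
Proof.
elim: m => // -[|m] IH.
  move=> _; exists set0, [set x0]; rewrite sub0set cards0 cards1 inE eqxx; split=> //; split=> x.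
    by rewrite inE => /eqP ->; apply: connect0.
  by rewrite inE.
move=> /andP[_ Hm]; have [|T [U [TE x0U cU cT [HU HT]]]] := IH; first by rewrite (ltnW Hm).
have [y yU] : exists y, y \notin U.
  case: (pickP [pred y | y \notin U]) => [y|H]; first by exists y.
  suff EU : U = setT by move: cU Hm; rewrite EU cardsT card_ord => ->; rewrite ltnn.
  by apply/setP => y; rewrite inE; have := H y => /= /negbFE.
have [u [w [uU wU Huw]]] := cross x0U yU (connE x0 y).
have eT : [set u; w] \notin T.
  by apply: contra wU => /HT /subsetP; apply; rewrite set22.
exists ([set u; w] |: T), (w |: U); split.
- by apply/subsetP => e; rewrite in_setU1 => /orP[/eqP ->//|]; apply/subsetP.
- by rewrite in_setU1 x0U orbT.
- by rewrite cardsU1 wU cU.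
- by rewrite cardsU1 eT add1n cT.
have sub : subrel (connect (adj T)) (connect (adj ([set u; w] |: T))).
  by apply: connect_sub => a b Hab; apply: connect1; rewrite /adj in_setU1 -/(adj T a b) Hab orbT.
split=> [x|e]; rewrite in_setU1 => /orP[/eqP ->|Hx].
- by apply: connect_trans (sub _ _ (HU u uU)) (connect1 _); rewrite /adj in_setU1 eqxx.
- by apply: sub; apply: HU.
- by apply/subsetP => x; rewrite !inE => /orP[/eqP ->|/eqP ->]; rewrite ?uU ?eqxx ?orbT.
- by apply: subset_trans (HT e Hx) (subsetUr _ _).
Qed.

Lemma spanningP (T : {set {set V}}) :
  reflect [/\ T \subset E, forall x y, connect (adj T) x y & #|T|.+1 = n] (spanning_tree E T).
Proof.
apply: (iffP and3P) => [[H1 H2 /eqP H3]|[H1 H2 H3]]; split=> //.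
- by move=> x y; have /forallP/(_ x)/forallP/(_ y) := H2.
- by apply/forallP => x; apply/forallP => y.
- exact/eqP.
Qed.

Lemma tree_exists (x0 : V) : exists T, spanning_tree E T.
Proof.
have n0 : 0 < n by apply: leq_ltn_trans (ltn_ord x0).
have [|T [U [TE x0U cU cT [HU _]]]] := @grow x0 n; first by rewrite n0 leqnn.
have EU : U = setT by apply/eqP; rewrite eqEcard subsetT cardsT card_ord cU leqnn.
exists T; apply/spanningP; split=> // x y.
apply: connect_trans (HU y _); last by rewrite EU inE.
by rewrite (sym_connect_sym (adj_sym T)); apply: HU; rewrite EU inE.
Qed.

Lemma leaves_le T : spanning_tree E T -> leaves T <= max_leaf E.
Proof.
move=> HT; rewrite /max_leaf (bigmax_sup T) // powersetE HT andbT.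
by case/spanningP: HT.
Qed.

Lemma max_tree (x0 : V) : exists2 T, spanning_tree E T &
  forall T', spanning_tree E T' -> leaves T' <= leaves T.
Proof.
have [T1 H1] := tree_exists x0.
by case: (arg_maxnP (@leaves n) H1) => T HT HM; exists T.
Qed.

Section MaxTree.
Variable T : {set {set V}}.
Hypothesis spanT : spanning_tree E T.
Hypothesis maxT : forall T', spanning_tree E T' -> leaves T' <= leaves T.
Notation d := (degree T).

Let TE : T \subset E. Proof. by case/spanningP: spanT. Qed.
Let connT x y : connect (adj T) x y. Proof. by case/spanningP: spanT. Qed.
Let cardT : #|T|.+1 = n. Proof. by case/spanningP: spanT. Qed.
Let ST : simple_graph T. Proof. exact: simple_sub TE. Qed.

Definition swap (e f : {set V}) : {set {set V}} := f |: (T :\ e).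

Lemma degree_swap e f x : e \in T -> f \notin T ->
  degree (swap e f) x + (x \in e) = d x + (x \in f).
Proof.
move=> eT fT; rewrite /degree.
have D (g : {set V}) (F : {set {set V}}) : g \notin F ->
    #|[set h in g |: F | x \in h]| = (x \in g) + #|[set h in F | x \in h]|.
  move=> gF; rewrite -!sum1dep_card big_mkcondr big_setU1 //= -big_mkcondr /=.
  by case: (x \in g).
have eTe : e \notin T :\ e by rewrite !inE eqxx.
have fTe : f \notin T :\ e by rewrite !inE negb_and fT orbT.
by rewrite -{1}(setD1K eT) /swap !D // addnC addnA [RHS]addnAC.
Qed.

(** In T - ab the vertex [c] is on the side of [a] and [e0] on the side of [b], so the edge [f]
    joins the two sides again. *)
Lemma swap_spanning a b c e0 (e := [set a; b]) (f := [set c; e0]) :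
  e \in T -> f \in E -> f \notin T ->
  connect (adj (T :\ e)) c a -> connect (adj (T :\ e)) e0 b -> spanning_tree E (swap e f).
Proof.
move=> eT fE fT ca eb; apply/spanningP; split.
- apply/subsetP => g; rewrite !inE => /orP[/eqP ->//|/andP[_]]; exact/subsetP.
- have sub : subrel (connect (adj (T :\ e))) (connect (adj (swap e f))).
    by apply: connect_sub => x y Hxy; apply: connect1; rewrite /adj /swap in_setU1 -/(adj _ x y) Hxy orbT.
  have csym := sym_connect_sym (adj_sym (swap e f)).
  have ab : connect (adj (swap e f)) a b.
    apply: connect_trans (_ : connect _ c b); first by rewrite csym; apply: sub.
    apply: connect_trans (sub _ _ eb); apply: connect1.
    by rewrite /adj /swap in_setU1 eqxx.
  move=> x y; have := connT x y; apply: connect_sub => u w Huw.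
  case: ([set u; w] =P e) => [E1|/eqP N1]; last first.
    by apply: connect1; rewrite /adj /swap in_setU1 in_setD1 N1 -/(adj T u w) Huw orbT.
  have : u \in e by rewrite -E1 set21.
  have : w \in e by rewrite -E1 set22.
  rewrite !inE => /orP[/eqP ->|/eqP ->] /orP[/eqP ->|/eqP ->]; rewrite ?connect0 //.
  by rewrite csym.
- rewrite /swap cardsU1 !inE negb_and fT orbT /=.
  by rewrite -[RHS]cardT (cardsD1 e T) eT.
Qed.

Lemma connect_avoid (z x : V) (l : seq V) : path (adj T) x l -> z \notin x :: l ->
  forall e : {set V}, z \in e -> connect (adj (T :\ e)) x (last x l).
Proof.
move=> Hp Hz e ze; apply/connectP; exists l => //.
elim: l x Hp Hz => //= y l IH x /andP[xy Hp]; rewrite !inE !negb_or => /and3P[zx zy zl].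
rewrite IH // ?inE ?negb_or ?zy //= andbT /adj in_setD1 -/(adj T x y) xy andbT.
by apply/eqP => Ee; move: ze; rewrite -Ee !inE (negbTE zx) (negbTE zy).
Qed.

(** Let v, q1, q2, ..., w be the tree path. If both q1 and q2 had tree degree two, inserting vw in
    place of an edge at q1 would yield a spanning tree with more leaves. *)
Lemma branch_near v w : d v = 2 -> adj E v w -> ~~ adj T v w ->
  exists q1, adj T v q1 /\ (d q1 <> 2 \/ exists2 q2, adj T q1 q2 & d q2 <> 2).
Proof.
move=> dv vwE vwT; have vw := adj_neq simpleE vwE.
have /connectP[l0 Hl0 El0] := connT v w; move: El0; case/shortenP: Hl0 => l Hl Ul _ El.
case: l Hl Ul El => [|q1 [|q2 l]] Hl Ul El; first by rewrite El eqxx in vw.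
  by move: vwT; rewrite El /=; case/andP: Hl => ->.
case/and3P: Hl => vq1 q12 Hl; exists q1; split=> //.
case: (d q1 =P 2) => d1; last by left.
right; exists q2 => //; case: (d q2 =P 2) => // d2; exfalso.
move: Ul; rewrite /= !inE !negb_or => /and4P[/and3P[nvq1 nvq2 nvl] /andP[nq12 nq1l] nq2l _].
have El' : w = last q2 l by [].
have wl : w \in q2 :: l by rewrite El' mem_last.
have q1w : q1 != w.
  by apply/eqP => E1; move: wl; rewrite -E1 inE (negbTE nq12) (negbTE nq1l).
set f := [set v; w]; have fE : f \in E by []. have fT : f \notin T by [].
(* Replacing v q1 by vw makes q1 a leaf and keeps the degree of v; if w were no leaf of T, a leaf
   would be gained. *)
have leaf1 : d w = 1.
  apply/eqP; apply: contraT => dw; exfalso.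
  have eT : [set v; q1] \in T by [].
  have sp : spanning_tree E (swap [set v; q1] f).
    apply: (@swap_spanning v q1 v w) => //.
    rewrite (sym_connect_sym (adj_sym _)) El'.
    apply: (@connect_avoid v q1 (q2 :: l)); rewrite ?set21 //=; first by rewrite q12.
    by rewrite !inE !negb_or nvq1 nvq2.
  have := maxT sp; rewrite leqNgt => /negP; apply.
  have -> : (leaves T).+1 = #|q1 |: [set x | d x == 1]|.
    by rewrite cardsU1 inE d1.
  apply/subset_leq_card/subsetP => x; rewrite !inE => Hx.
  have := degree_swap x eT fT; rewrite !inE; case/orP: Hx => /eqP Ex.
    rewrite Ex d1 eqxx (negbTE q1w) [q1 == v]eq_sym (negbTE nvq1) /= => H.
    by move: H; rewrite addn0 addn1 => -[->].
  rewrite Ex; case: (x =P v) => [Ev|_]; first by rewrite Ev dv in Ex.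
  case: (x =P q1) => [Ev|_]; first by rewrite Ev d1 in Ex.
  case: (x =P w) => [Ev|_]; first by rewrite -Ev Ex eqxx in dw.
  by rewrite /= !addn0 => ->.
have q2w : q2 != w by apply/eqP => E2; rewrite E2 leaf1 in d2.
(* With w a leaf, q1 q2 is replaced instead: q1 and q2 become leaves and only w stops being one. *)
have eT : [set q1; q2] \in T by [].
have sp : spanning_tree E (swap [set q1; q2] f).
  apply: (@swap_spanning q1 q2 v w) => //.
    apply: connect1; rewrite /adj in_setD1; rewrite -/(adj T v q1) vq1 andbT.
    apply/eqP => Ee; have : v \in [set q1; q2] by rewrite -Ee set21.
    by rewrite !inE (negbTE nvq1) (negbTE nvq2).
  rewrite (sym_connect_sym (adj_sym _)) El'.
  by apply: (@connect_avoid q1 q2 l); rewrite ?set21 // inE negb_or nq12.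
have := maxT sp; rewrite leqNgt => /negP; apply.
apply: leq_trans (_ : #|q1 |: (q2 |: ([set x | d x == 1] :\ w))| <= _).
  have := cardsD1 w [set x | d x == 1]; rewrite inE leaf1 eqxx -/(leaves T) => ->.
  by rewrite !cardsU1 !inE d1 d2 (negbTE nq12) !andbF /= !add1n.
apply/subset_leq_card/subsetP => x; rewrite !inE => Hx.
have := degree_swap x eT fT; rewrite !inE.
case/or3P: Hx => [/eqP Ex|/eqP Ex|/andP[xw /eqP Ex]].
- rewrite Ex d1 eqxx (negbTE q1w) [q1 == v]eq_sym (negbTE nvq1) /= => H.
  by move: H; rewrite addn0 addn1 => -[->].
- rewrite Ex d2 eqxx (negbTE q2w) [q2 == v]eq_sym (negbTE nvq2) orbT /= => H.
  by move: H; rewrite addn0 addn1 => -[->].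
rewrite Ex (negbTE xw); case: (x =P v) => [Ev|_]; first by rewrite Ev dv in Ex.
case: (x =P q1) => [Ev|_]; first by rewrite Ev d1 in Ex.
case: (x =P q2) => [Ev|_]; first by rewrite Ev d2 in Ex.
by rewrite /= !addn0 => ->.
Qed.

Definition nbs (W : {set V}) : {set V} := \bigcup_(u in W) nb T u.

Lemma nbsP (W : {set V}) v : reflect (exists2 u, u \in W & adj T u v) (v \in nbs W).
Proof. by apply: (iffP bigcupP) => -[u Hu]; [rewrite inE|move=> H]; exists u; rewrite ?inE. Qed.

Lemma card_nbs (W : {set V}) : #|nbs W| <= \sum_(u in W) d u.
Proof.
rewrite /nbs; elim/big_rec2: _ => [|u s U _ H]; first by rewrite cards0.
apply: leq_trans (leq_card_setU _ _) _.
by rewrite (degree_nb _ ST) leq_add2l.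
Qed.

Hypothesis n_gt1 : 1 < n.

Lemma d_gt0 v : 0 < d v.
Proof.
have [w vw] : exists w : V, w != v.
  case: (pickP [pred w : V | w != v]) => [w|H]; first by exists w.
  have : #|V| <= #|pred1 v| by apply/subset_leq_card/subsetP => w _; have := H w => /= /negbFE.
  by rewrite card1 card_ord leqNgt n_gt1.
have /connectP[[|u l]] := connT v w; first by move=> _ E1; rewrite E1 eqxx in vw.
case/andP => vu _ _; rewrite (degree_nb _ ST); apply/card_gt0P; exists u.
by rewrite inE.
Qed.

Definition dn2 : {set V} := [set v | d v != 2].

(* In a tree the excess degrees [d - 2] at the branching vertices sum to the number of leaves minus 2. *)
Lemma sum_dn2 : \sum_(v in dn2) d v <= 4 * leaves T /\ #|dn2| <= 2 * leaves T.
Proof.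
have H2 : leaves T = \sum_v (d v == 1 : nat).
  by rewrite /leaves -sum1dep_card big_mkcond /=; apply: eq_bigr => v _; case: (_ == _).
have H3 : \sum_(v in dn2) d v + 6 <= 4 * leaves T.
  have D (k : nat) (F : V -> nat) : \sum_v k * F v = k * \sum_v F v by rewrite big_distrr.
  (* Holds vertex by vertex: the degree, counted when it differs from 2, plus 6 is at most three
     times the degree, plus 4 for a leaf. *)
  have HA : \sum_(v in dn2) d v + #|V| * 6 <= 3 * (2 * #|T|) + 4 * \sum_v (d v == 1 : nat).
    rewrite -(sum_degree ST) -!D -sum_nat_const big_mkcond -!big_split /=.
    apply: leq_sum => v _; rewrite inE; have := d_gt0 v; case: (d v) => [|[|[|k]]] //= _; lia.
  move: HA; rewrite -H2 card_ord; have := cardT; move: (#|T|) => t.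
  move: (\sum_(v in dn2) d v) (leaves T) => a b; clear; lia.
have H4 : 3 * #|dn2| <= \sum_(v in dn2) d v + 2 * leaves T.
  rewrite H2 -sum1_card big_distrr /= big_mkcond [\sum_(v in dn2) d v]big_mkcond big_distrr /= -big_split /=.
  apply: leq_sum => v _; rewrite inE; have := d_gt0 v; case: (d v) => [|[|[|k]]] //= _.
split; lia.
Qed.

Lemma leaves_gt0 : 0 < leaves T.
Proof.
have [H1 H2] := sum_dn2; rewrite lt0n; apply/eqP => E0; rewrite E0 !muln0 in H1 H2.
have all2 v : d v = 2.
  move: H2; rewrite leqn0 cards_eq0 => /eqP /setP /(_ v); rewrite !inE => /negbFE.
  by move/eqP.
have := sum_degree ST; rewrite (eq_bigr (fun=> 2)) // sum_nat_const card_ord.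
by have := cardT; lia.
Qed.

Lemma sum_d_le (W : {set V}) : \sum_(v in W) d v <= 4 * leaves T + 2 * #|W|.
Proof.
have [H1 _] := sum_dn2; rewrite (bigID (mem dn2)) /= leq_add //.
  by apply: leq_trans H1; rewrite [X in _ <= X](bigID (mem W)) /= (eq_bigl (fun v => (v \in dn2) && (v \in W))) ?leq_addr // => v; rewrite andbC.
rewrite mulnC -sum_nat_const [X in _ <= X](bigID (mem dn2)) /=; apply: leq_trans (leq_addl _ _).
by apply: leq_sum => v /andP[_]; rewrite inE negbK => /eqP ->.
Qed.

(** [x0] keeps the core nonempty when the graph is a cycle, so that every other vertex can be
    reached from it. *)
Definition special (x0 : V) : {set V} := [set v | (#|nb E v| != 2) || (v == x0)].
Definition core (x0 : V) : {set V} := special x0 :|: [set v | [exists u in special x0, adj E u v]].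

Lemma nb_sub v : nb T v \subset nb E v.
Proof. by apply/subsetP => u; rewrite !inE; apply: (subsetP TE). Qed.

(** A special vertex other than [x0] with tree degree two has an edge outside the tree, so by
    [branch_near] a vertex of [dn2] is at tree distance at most two. *)
Lemma special_sub x0 :
  special x0 \subset x0 |: (dn2 :|: (nbs dn2 :|: nbs (nbs dn2 :\: dn2))).
Proof.
apply/subsetP => v; rewrite inE in_setU1 => /orP[Hv|->] //.
apply/orP; right; rewrite !in_setU; case: (boolP (v \in dn2)) => //=.
rewrite inE negbK => /eqP dv.
have [w wE wT] : exists2 w, adj E v w & ~~ adj T v w.
  case: (pickP [pred w | adj E v w & ~~ adj T v w]) => [w /andP[]|H]; first by exists w.
  case/negP: Hv; rewrite -dv (degree_nb _ ST); apply/eqP/eq_card => w; rewrite !inE.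
  by apply/idP/idP => [wE|/(subsetP TE)//]; have := H w; rewrite /= wE /= => /negbFE.
have [q1 [a1 H]] := branch_near dv wE wT.
case: (boolP (q1 \in dn2)) => q1d.
  by apply/orP; left; apply/nbsP; exists q1; rewrite // adj_sym.
case: H => [Hq|[q2 a2 Hq]]; first by case/negP: q1d; rewrite inE; apply/eqP.
apply/orP; right; apply/nbsP; exists q1; last by rewrite adj_sym.
rewrite in_setD q1d; apply/nbsP; exists q2; last by rewrite adj_sym.
by rewrite inE; apply/eqP.
Qed.

(** 14 = 2 + 4 + 8: the set [dn2], its tree neighbours, and the at most two tree neighbours of each
    of those outside [dn2]. *)
Lemma card_special x0 : #|special x0| <= 1 + 14 * leaves T.
Proof.
have [H1 H2] := sum_dn2.
apply: leq_trans (subset_leq_card (special_sub x0)) _.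
apply: leq_trans (leq_card_setU _ _) _; rewrite cards1 leq_add2l.
apply: leq_trans (leq_card_setU _ _) _.
apply: leq_trans (leq_add (leqnn _) (leq_card_setU _ _)) _.
have H3 := leq_trans (card_nbs dn2) H1.
have H4 : #|nbs (nbs dn2 :\: dn2)| <= 2 * #|nbs dn2|.
  apply: leq_trans (card_nbs _) _.
  apply: leq_trans (_ : \sum_(u in nbs dn2 :\: dn2) 2 <= _).
    by apply: leq_sum => u; rewrite inE => /andP[]; rewrite inE negbK => /eqP ->.
  by rewrite sum_nat_const mulnC leq_mul2l /= subset_leq_card // subsetDl.
by move: H2 H3 H4; clear; lia.
Qed.

(** A vertex of degree two in the graph and in the tree has only tree edges, so a special neighbour
    is a tree neighbour. *)
Lemma core_sub x0 : core x0 \subset special x0 :|: (dn2 :|: nbs (special x0)).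
Proof.
apply/subsetP => v; rewrite !in_setU; case: (boolP (v \in special x0)) => //= vX.
rewrite inE => /exists_inP[u uX uv].
case: (boolP (v \in dn2)) => //=; rewrite inE negbK => /eqP dv.
apply/nbsP; exists u => //.
have Env : nb T v = nb E v.
  apply/eqP; rewrite eqEcard nb_sub -(degree_nb _ ST) dv.
  by move: vX; rewrite inE negb_or negbK => /andP[/eqP -> _].
have : u \in nb T v by rewrite Env inE adj_sym.
by rewrite inE adj_sym.
Qed.

(** With l leaves: 14 l + 1 for [special], 2 l for [dn2] and 4 l + 2 (14 l + 1) for the tree
    neighbours of [special], hence 48 l + 3 <= 51 l because l > 0. *)
Lemma card_core x0 : #|core x0| <= 51 * leaves T.
Proof.
have [H1 H2] := sum_dn2; have H0 := leaves_gt0.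
apply: leq_trans (subset_leq_card (core_sub x0)) _.
apply: leq_trans (leq_card_setU _ _) _.
apply: leq_trans (leq_add (leqnn _) (leq_card_setU _ _)) _.
have H3 := leq_trans (card_nbs _) (sum_d_le (special x0)).
have H4 := card_special x0.
by move: H0 H2 H3 H4; clear; lia.
Qed.

End MaxTree.

(** The summand 1 covers the one-vertex graph, whose spanning tree has no leaf. *)
Theorem core_bound (x0 : V) : #|core x0| <= 51 * max_leaf E + 1.
Proof.
case: (ltnP 1 n) => n1; last by rewrite (leq_trans (max_card _)) // card_ord addn1 (leq_trans n1).
have [T HT HM] := max_tree x0.
have := card_core HT HM n1 x0; have := leaves_le HT; lia.
Qed.

Lemma core_deg2 x0 z : z \notin core x0 ->
  exists u w, u != w /\ forall v, adj E z v = (v == u) || (v == w).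
Proof.
rewrite in_setU negb_or => /andP[]; rewrite inE negb_or negbK => /andP[/cards2P [u [w [uw H]]] _] _.
by exists u, w; split=> // v; have /setP/(_ v) := H; rewrite !inE.
Qed.

(** This is why the core contains the neighbours of [special]: a vertex with a neighbour outside is
    not special, so it has degree two, and its other neighbour is special. *)
Lemma core_one_port x0 y b b' : y \in core x0 ->
  adj E y b -> b \notin core x0 -> adj E y b' -> b' \notin core x0 -> b = b'.
Proof.
move=> yY yb bY yb' bY'.
have yX : y \notin special x0.
  apply: contra bY => yX; rewrite in_setU [X in _ || X]inE; apply/orP; right.
  by apply/exists_inP; exists y.
move: yY; rewrite in_setU (negbTE yX) /= inE => /exists_inP[u uX uy].
have uY : u \in core x0 by rewrite in_setU uX.
move: yX; rewrite inE negb_or negbK => /andP[/cards2P [s [t [_ H]]] _].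
have Hn v : adj E y v = (v == s) || (v == t) by have /setP/(_ v) := H; rewrite !inE.
have ub : u != b by apply/eqP => Eu; rewrite -Eu uY in bY.
have ub' : u != b' by apply/eqP => Eu; rewrite -Eu uY in bY'.
move: uy yb yb'; rewrite adj_sym !Hn => /orP[] /eqP Eu /orP[] /eqP Eb /orP[] /eqP Eb' //; subst => //.
all: by rewrite ?eqxx in ub ub'.
Qed.

Lemma core_x0 x0 : x0 \in core x0.
Proof. by apply/setUP; left; rewrite inE eqxx orbT. Qed.

End Trees.

End Core.

(** * The search program and proof rules for its loops *)

Module Programs.
Import Machine Simulation Language Threads Families.

(* Variable 0 is constantly 0 and is the index of the flags [tE], [tF], [tC], [tCB],
   [tBad] and [tANS].  vN = n, vW = 2 ^ #|Y| and vNN = n ^ 2 + 1 bound the loops; vK = min k n;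
   vPt points into the adjacency matrix tM; (vPrev, vC) is the dart of a walk and vCt its
   counter; vC1, vPs1 (vC2, vPs2) are the cardinality and the potential of tS1 (tS2). *)
Notation vN := 1. Notation vW := 2. Notation vNN := 3.
Notation vK := 4. Notation vP := 5. Notation vA := 6. Notation vB := 7.
Notation vPt := 8. Notation vI := 9. Notation vJ := 10. Notation vY := 11.
Notation vPrev := 12. Notation vC := 13. Notation vQ := 14. Notation vCt := 15.
Notation vU := 16. Notation vSz := 17. Notation vC1 := 18. Notation vC2 := 19.
Notation vPs1 := 20. Notation vPs2 := 21. Notation vE1 := 22. Notation vE2 := 23.
Notation vE3 := 24. Notation vE4 := 25. Notation vE5 := 26. Notation vR := 27.
Notation tM := 28. Notation tKB := 29. Notation tO := 30. Notation tD1 := 31.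
Notation tD2 := 32. Notation tD3 := 33. Notation tX := 34. Notation tY := 35.
Notation tG1 := 36. Notation tG2 := 37. Notation tG3 := 38. Notation tG4 := 39.
Notation tG5 := 40. Notation tS1 := 41. Notation tS2 := 42. Notation tR := 43.
Notation tE := 44. Notation tF := 45. Notation tC := 46. Notation tCB := 47.
Notation tBad := 48. Notation tANS := 49.

Notation "c1 ;; c2" := (Seq c1 c2) (at level 61, right associativity).
Notation Skip := (Do (Eq 0 0)).
Notation When o c := (If o c Skip).

(** [vPt] advances in step with the two loops, so it points at entry a * n + b of the matrix without
    any multiplication. *)
Definition edges (body : cmd) : cmd :=
  Do (Cpy vPt 0) ;;
  For vA vN (For vB vN (When (Get tM vPt) body ;; Do (Inc vPt))).

Definition copyt (t u : nat) : cmd :=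
  For vI vN (If (Get t vI) (Do (Put u vI true)) (Do (Put u vI false))).

Definition clear (t : nat) : cmd := For vI vN (Do (Put t vI false)).

(** Binary increment of [g] on the positions of [mask], least significant first, with the carry in
    [tC]. *)
Definition inc (g mask : nat) : cmd :=
  Do (Put tC 0 true) ;;
  For vJ vN (When (Get mask vJ) (When (Get tC 0)
    (If (Get g vJ) (Do (Put g vJ false)) (Do (Put g vJ true) ;; Do (Put tC 0 false))))).

Definition znc : cmd :=
  Do (Cpy vC vY) ;;
  edges (When (Eq vA vY) (If (Get tY vB) Skip (Do (Cpy vC vB)))).

Definition nxc : cmd :=
  Do (Cpy vQ vC) ;;
  edges (When (Eq vA vC) (If (Eq vB vPrev) Skip (Do (Cpy vQ vB)))) ;;
  Do (Cpy vPrev vC) ;; Do (Cpy vC vQ).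

Definition walk (act : cmd) : cmd :=
  Do (Cpy vPrev vY) ;; znc ;; For vI vN (If (Get tY vC) Skip (act ;; nxc)).

Definition pat_act : cmd :=
  If (Eq vCt vP) (Do (Put tS2 vC true) ;; Do (Cpy vCt 0)) (Do (Inc vCt)).

Definition shift_act : cmd :=
  If (Get tCB 0)
    (If (Get tS2 vC) Skip (Do (Put tS2 vC true) ;; Do (Put tCB 0 false)))
    (When (Get tS2 vC) (Do (Put tS2 vC false) ;; Do (Put tCB 0 true))).

Definition initc : cmd :=
  copyt tG1 tS2 ;;
  For vY vN (When (Get tG2 vY)
    (If (Get tG3 vY) (Do (Cpy vCt 0)) (Do (Cpy vCt vP)) ;; walk pat_act)) ;;
  For vY vN (When (Get tG4 vY) (znc ;; Do (Put tS2 vC true))).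

Definition shallc : cmd :=
  copyt tS1 tS2 ;;
  For vY vN (When (Get tG5 vY) (Do (Put tCB 0 false) ;; walk shift_act)).

Definition compc : cmd :=
  clear tR ;; Do (Put tR vU true) ;;
  For vJ vN (edges (When (Get tR vA) (If (Get tS2 vB) Skip (Do (Put tR vB true))))).

Definition evalc : cmd :=
  Do (Cpy vC2 0) ;; For vI vN (When (Get tS2 vI) (Do (Inc vC2))) ;;
  Do (Cpy vPs2 0) ;; Do (Put tBad 0 false) ;;
  For vU vN (If (Get tS2 vU) Skip
    (compc ;; Do (Cpy vSz 0) ;;
     For vI vN (When (Get tR vI) (Do (Inc vSz) ;; Do (Inc vPs2))) ;;
     When (Lt vP vSz) (Do (Put tBad 0 true)))) ;;
  If (Get tBad 0) Skip
    (Do (Cpy vSz vC2) ;; For vI vN (When (Lt vI vP) (Do (Inc vSz))) ;;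
     If (Lt vK vSz) Skip (Do (Put tANS 0 true))).

Definition take2 : cmd :=
  copyt tS2 tS1 ;; Do (Cpy vPs1 vPs2) ;; Do (Cpy vC1 vC2).

Definition enumc (g v : nat) (c : cmd) : cmd := clear g ;; For v vW (c ;; inc g tY).

Definition bodyc : cmd :=
  initc ;; evalc ;; take2 ;;
  For vR vNN (enumc tG5 vE5
    (shallc ;; evalc ;; When (Eq vC2 vC1) (When (Lt vPs2 vPs1) take2))).

(** [p] ranges below n because [fullc] answers the case k >= n directly, and otherwise p <= k <
    n. *)
Definition searchc : cmd :=
  For vP vN (enumc tG1 vE1 (enumc tG2 vE2 (enumc tG3 vE3 (enumc tG4 vE4 bodyc)))).

Section Rules.

Lemma for_iter i v c s (P : nat -> st -> Prop) :
  [&& i != v, i \notin mv c & v \notin mv c] ->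
  P 0 (setv s i 0) ->
  (forall j s', j < vr s v -> vr s' i = j ->
     (forall w, w \notin i :: mv c -> vr s' w = vr s w) ->
     (forall t, t \notin mt c -> tr s' t = tr s t) ->
     P j s' -> P j.+1 (opst (Inc i) (ev c s'))) ->
  forall j, j <= vr s v ->
  let s' := iter j (fun s => opst (Inc i) (ev c s)) (setv s i 0) in
  [/\ vr s' i = j, (forall w, w \notin i :: mv c -> vr s' w = vr s w),
     (forall t, t \notin mt c -> tr s' t = tr s t) & P j s'].
Proof.
move=> /and3P[iv ic vc] P0 HP; elim=> [|j IH] Hj.
  split=> //=; first by rewrite eqxx.
  by move=> w; rewrite inE negb_or => /andP[/negbTE ->].
have [H1 H2 H3 H4] := IH (ltnW Hj); split.
- by rewrite iterS /= eqxx ev_vr // H1.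
- move=> w Hw; have := Hw; rewrite iterS /= inE negb_or => /andP[/negbTE -> Hw'].
  by rewrite ev_vr // H2.
- by move=> t Ht; rewrite iterS /= ev_tr // H3.
- by rewrite iterS; apply: HP.
Qed.

Lemma for_rule i v c s (P : nat -> st -> Prop) :
  [&& i != v, i \notin mv c & v \notin mv c] ->
  P 0 (setv s i 0) ->
  (forall j s', j < vr s v -> vr s' i = j ->
     (forall w, w \notin i :: mv c -> vr s' w = vr s w) ->
     (forall t, t \notin mt c -> tr s' t = tr s t) ->
     P j s' -> P j.+1 (opst (Inc i) (ev c s'))) ->
  P (vr s v) (ev (For i v c) s).
Proof. by move=> Hc P0 HP; have [] := for_iter Hc P0 HP (leqnn _). Qed.

Lemma for_tm m i v c s (P : nat -> st -> Prop) :
  [&& i != v, i \notin mv c & v \notin mv c] ->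
  P 0 (setv s i 0) ->
  (forall j s', j < vr s v -> vr s' i = j ->
     (forall w, w \notin i :: mv c -> vr s' w = vr s w) ->
     (forall t, t \notin mt c -> tr s' t = tr s t) ->
     P j s' -> P j.+1 (opst (Inc i) (ev c s'))) ->
  (forall j s', j < vr s v -> (forall w, w \notin i :: mv c -> vr s' w = vr s w) ->
     P j s' -> tm c s' <= m) ->
  tm (For i v c) s <= 2 + vr s v * (m + 2).
Proof.
move=> Hc P0 HP Hm /=; rewrite leq_add2l -[X in X * _]card_ord -sum_nat_const.
apply: leq_sum => j _; rewrite leq_add2r.
by have [_ H1 _ H2] := for_iter Hc P0 HP (ltnW (ltn_ord j)); apply: (Hm j).
Qed.

Variable n : nat.
Notation V := 'I_n.

Lemma for_ord i c s (P : seq V -> st -> Prop) :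
  [&& i != vN, i \notin mv c & vN \notin mv c] -> vr s vN = n ->
  P [::] (setv s i 0) ->
  (forall done (v : V) s', v \notin done -> size done = v -> vr s' i = v ->
     (forall w, w \notin i :: mv c -> vr s' w = vr s w) ->
     (forall t, t \notin mt c -> tr s' t = tr s t) ->
     P done s' -> P (rcons done v) (opst (Inc i) (ev c s'))) ->
  P (enum V) (ev (For i vN c) s).
Proof.
move=> Hc Hn P0 HP.
have := @for_rule i vN c s (fun j s' => P (take j (enum V)) s') Hc.
rewrite take0 => /(_ P0); rewrite Hn take_oversize ?size_enum_ord //; apply.
move=> j s' Hj Hi F1 F2 HPj; pose v := Ordinal Hj.
have Ej : nth v (enum V) j = v by apply/val_inj; rewrite /= nth_enum_ord.
rewrite (take_nth v) ?size_enum_ord // Ej; apply: HP => //; last first.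
  by rewrite size_take size_enum_ord Hj.
rewrite -Ej; apply/negP => /(nthP v) [k]; rewrite size_take size_enum_ord Hj => Hk.
rewrite nth_take // => /eqP; rewrite nth_uniq ?enum_uniq ?size_enum_ord //.
  by move=> /eqP Ek; rewrite Ek ltnn in Hk.
exact: (ltn_trans Hk Hj).
Qed.

Variable E : {set {set V}}.
Notation adj := (adj E).

Definition base (s : st) : Prop :=
  [/\ vr s 0 = 0, vr s vN = n & forall a b : V, tr s tM (a * n + b) = adj a b].

Lemma base_frame s s' : base s -> vr s' 0 = vr s 0 -> vr s' vN = vr s vN ->
  tr s' tM = tr s tM -> base s'.
Proof. by case=> H1 H2 H3 E1 E2 E3; split=> [||a b]; rewrite ?E1 ?E2 ?E3. Qed.

Definition okc (c : cmd) : bool := [&& 0 \notin mv c, vN \notin mv c & tM \notin mt c].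

Lemma base_ev c s : okc c -> base s -> base (ev c s).
Proof.
by case/and3P => H1 H2 H3 Hs; apply: (base_frame Hs); rewrite ?ev_vr ?ev_tr.
Qed.

Definition stable (P : st -> Prop) : Prop :=
  forall s v x, v \in [:: vA; vB; vPt] -> P s -> P (setv s v x).

Definition pairs : seq (V * V) := [seq (a, b) | a <- enum V, b <- enum V].

(** Stability under the loop variables lets the invariant speak only of the pairs already treated;
    the position of [vPt] is tracked inside the proof. *)
Lemma edges_rule body s (P : seq (V * V) -> st -> Prop) :
  okc body -> [&& vA \notin mv body, vB \notin mv body & vPt \notin mv body] -> base s ->
  (forall done, stable (P done)) -> P [::] s ->
  (forall done a b s', adj a b -> vr s' vA = a -> vr s' vB = b -> base s' ->
     (forall w, w \notin [:: vA, vB, vPt & mv body] -> vr s' w = vr s w) ->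
     (forall t, t \notin mt body -> tr s' t = tr s t) ->
     P done s' -> P (rcons done (a, b)) (ev body s')) ->
  (forall done a b s', ~~ adj a b -> P done s' -> P (rcons done (a, b)) s') ->
  P pairs (ev (edges body) s).
Proof.
move=> Hok Hbody Hs HP P0 P1 P2; have [s0 sN sM] := Hs.
have [ok1 ok2 ok3] := and3P Hok; have [bA bB bP] := and3P Hbody.
rewrite /edges; set c1 := When _ _ ;; _; set s1 := opst (Cpy vPt 0) s.
rewrite [ev _ _]/= -/s1.
have mv1 w : (w \in mv c1) = (w \in mv body) || (w == vPt).
  by rewrite /= !mem_cat !inE /= orbF.
have mt1 t : (t \in mt c1) = (t \in mt body) by rewrite /= !mem_cat /= !orbF.
have c1ok : [&& vB != vN, vB \notin mv c1 & vN \notin mv c1].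
  by rewrite !mv1 !negb_or bB ok2.
have c2ok : [&& vA != vN, vA \notin mv (For vB vN c1) & vN \notin mv (For vB vN c1)].
  by rewrite !inE !mv1 !negb_or bA ok2.
pose row (a : V) (l : seq V) : seq (V * V) := [seq (a, b) | b <- l].
pose rows (l : seq V) : seq (V * V) := [seq (a, b) | a <- l, b <- enum V].
pose Q (l : seq V) s' := P (rows l) s' /\ vr s' vPt = size l * n.
have s1E : P [::] s1 /\ base s1.
  by split; [apply: HP => //; rewrite !inE eqxx ?orbT|apply: (base_frame Hs)].
have [Ps1 Bs1] := s1E.
have s1F w : w \notin [:: vA, vB, vPt & mv body] -> vr s1 w = vr s w.
  by rewrite /s1 /= !inE => /norP[_ /norP[_ /norP[/negbTE -> _]]].
suff [] : Q (enum V) (ev (For vA vN (For vB vN c1)) s1) by [].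
apply: (for_ord (P := Q) c2ok); first by case: Bs1.
  by split; [apply: HP => //; rewrite !inE eqxx|rewrite /= s0].
move=> doneA a sa aN szA Ea Fa Ta [Pa Pta].
have sNa : vr sa vN = n.
  by rewrite Fa; [case: Bs1|rewrite !inE !mv1 !negb_or ok2].
pose R (l : seq V) s' := P (rows doneA ++ row a l) s' /\ vr s' vPt = size doneA * n + size l.
have : R (enum V) (ev (For vB vN c1) sa).
  apply: (for_ord (P := R) c1ok) => //.
    by split; [rewrite cats0; apply: HP => //; rewrite !inE eqxx orbT|rewrite /= Pta addn0].
  move=> doneB b sb bN szB Eb Fb Tb [Pb Ptb].
  have Fsb w : w \notin [:: vA, vB, vPt & mv body] -> vr sb w = vr s w.
    rewrite !inE => /norP[wA /norP[wB /norP[wP wb]]].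
    rewrite Fb ?inE ?mv1 ?negb_or ?wB ?wP ?wb // Fa ?inE ?mv1 ?negb_or ?wA ?wB ?wP ?wb //.
    by apply: s1F; rewrite !inE !negb_or wA wB wP wb.
  have Tsb t : t \notin mt body -> tr sb t = tr s t.
    by move=> Ht; rewrite Tb ?mt1 // Ta ?mt1.
  have Bsb : base sb.
    by apply: (base_frame Hs); rewrite ?Fsb ?Tsb // !inE !negb_or ?ok1 ?ok2.
  have Ea' : vr sb vA = a.
    by rewrite Fb // !inE mv1 !negb_or bA.
  have Hget : tr sb tM (vr sb vPt) = adj a b.
    by rewrite Ptb szA szB; case: Bsb => _ _ ->.
  have Prc sc : P (rcons (rows doneA ++ row a doneB) (a, b)) sc ->
      vr sc vPt = vr sb vPt -> R (rcons doneB b) (opst (Inc vB) (opst (Inc vPt) sc)).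
    move=> Psc Esc; split.
      apply: (HP _ _ vB); first by rewrite !inE eqxx orbT.
      apply: (HP _ _ vPt); first by rewrite !inE eqxx !orbT.
      by rewrite /row map_rcons -rcons_cat.
    by rewrite /= Esc Ptb size_rcons addnS.
  rewrite [ev c1 sb]/= Hget; case: ifP => Hab; last first.
    by apply: Prc => //; apply: P2; rewrite ?Hab.
  by apply: Prc; [apply: P1|rewrite ev_vr].
move=> [Pe Pte]; split.
  apply: (HP _ _ vA); first by rewrite !inE eqxx.
  by rewrite /rows map_rcons flatten_rcons.
by rewrite /= Pte size_enum_ord size_rcons mulSn addnC.
Qed.

Definition trk (s : st) (t : nat) (S : {set V}) : Prop := forall v : V, tr s t v = (v \in S).

Definition tset (s : st) (t : nat) : {set V} := [set v : V | tr s t v].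

Lemma trk_tset s t : trk s t (tset s t). Proof. by move=> v; rewrite inE. Qed.

Lemma in_take (l : seq V) (v w : V) : (w \in rcons l v) = (w == v) || (w \in l).
Proof. by rewrite mem_rcons in_cons. Qed.

Lemma copyt_ok t u s S : vr s vN = n -> t != u -> trk s t S -> trk (ev (copyt t u) s) u S.
Proof.
move=> sN tu HS.
have : (fun done s' => (forall v : V, v \in done -> tr s' u v = (v \in S)) /\ tr s' t = tr s t)
    (enum V) (ev (copyt t u) s).
  apply: (for_ord (P := fun done s' => (forall v : V, v \in done -> tr s' u v = (v \in S)) /\ tr s' t = tr s t)) => //.
  move=> done v s' vN' _ Ei F1 F2 [H1 H2]; rewrite /= H2 Ei HS.
  by case: ifP => HvS; split=> [w|] /=; rewrite ?(negbTE tu) // in_take eqxx /= (inj_eq val_inj);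
    case: eqP => [->|_] //= /H1.
by case=> H _ v; apply: H; rewrite mem_enum.
Qed.

Lemma clear_ok t s : vr s vN = n -> trk (ev (clear t) s) t set0.
Proof.
move=> sN.
have : (fun done s' => (forall v : V, v \in done -> tr s' t v = false)) (enum V) (ev (clear t) s).
  apply: (for_ord (P := fun done s' => (forall v : V, v \in done -> tr s' t v = false))) => //.
  move=> done v s' vN' _ Ei F1 F2 H1 w /=; rewrite in_take Ei eqxx /= (inj_eq val_inj).
  by case: eqP => //= _ /H1.
by move=> H v; rewrite inE; apply: H; rewrite mem_enum.
Qed.

End Rules.

End Programs.

(** * Enumerating subsets by binary counting; computing a component *)

Module Counting.
Import Machine Simulation Language Threads Families Programs.

Section Counter.
Variable n : nat.
Notation V := 'I_n.
Variable M : {set V}.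

Definition incF (x : {set V} * bool) (v : V) : {set V} * bool :=
  if (v \in M) && x.2 then (if v \in x.1 then (x.1 :\ v, true) else (v |: x.1, false)) else x.

Definition incS (S : {set V}) : {set V} := (foldl incF (S, true) (enum V)).1.
Definition ovf (S : {set V}) : bool := (foldl incF (S, true) (enum V)).2.

Fixpoint valL (l : seq V) (S : {set V}) : nat :=
  if l is v :: l' then (v \in S) + 2 * valL l' S else 0.

Lemma valL_ext (l : seq V) (S S' : {set V}) : {in l, forall v, (v \in S) = (v \in S')} -> valL l S = valL l S'.
Proof.
elim: l => //= v l IH H; rewrite H ?mem_head // IH // => w wl.
by apply: H; rewrite inE wl orbT.
Qed.

Lemma valL_lt (l : seq V) (S : {set V}) : valL l S < 2 ^ size l.
Proof. by elim: l => //= v l IH; rewrite expnS; case: (v \in S); lia. Qed.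

Lemma valL_inj (l : seq V) (S S' : {set V}) : valL l S = valL l S' -> {in l, forall v, (v \in S) = (v \in S')}.
Proof.
elim: l => // v l IH /= H w; rewrite inE => /orP[/eqP ->|].
  by move: H; case: (v \in S); case: (v \in S'); lia.
by apply: IH; move: H; case: (v \in S); case: (v \in S'); lia.
Qed.

Lemma incF_filter (l : seq V) x : foldl incF x l = foldl incF x [seq v <- l | v \in M].
Proof.
elim: l x => //= v l IH x; rewrite IH; case: (boolP (v \in M)) => //= vM.
by rewrite /incF (negbTE vM).
Qed.

Lemma incF_false (l : seq V) (S : {set V}) : foldl incF (S, false) l = (S, false).
Proof. by elim: l => //= v l IH; rewrite /incF andbF. Qed.

Lemma incF_out (l : seq V) x v : v \notin l -> (v \in (foldl incF x l).1) = (v \in x.1).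
Proof.
elim: l x => //= w l IH x; rewrite inE negb_or => /andP[vw vl]; rewrite IH // /incF.
by case: ifP => // _; case: ifP => _ /=; rewrite !inE ?vw // (negbTE vw).
Qed.

(** Carry propagation: a present element is removed and the carry goes on; an absent one is added
    and the carry dies, after which nothing changes. *)
Lemma incF_val (l : seq V) (S : {set V}) : uniq l -> {in l, forall v, v \in M} ->
  valL l (foldl incF (S, true) l).1 + (foldl incF (S, true) l).2 * 2 ^ size l = (valL l S).+1.
Proof.
elim: l S => // v l IH S /= /andP[vl Ul] HM.
have vM : v \in M by apply: HM; rewrite mem_head.
have HM' : {in l, forall v, v \in M} by move=> w wl; apply: HM; rewrite inE wl orbT.
have [E1|E1] : (v \in S /\ incF (S, true) v = (S :\ v, true)) \/ (v \notin S /\ incF (S, true) v = (v |: S, false)).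
    by rewrite /incF vM /=; case: (boolP (v \in S)); [left|right].
  case: E1 => vS ->; rewrite incF_out //= !inE eqxx vS /= expnS.
  have := IH (S :\ v) Ul HM'; rewrite (@valL_ext l (S :\ v) S); last first.
    by move=> w wl; rewrite !inE; case: eqP vl => [<-|]; rewrite ?wl.
  move: (valL l S) (valL l _) (foldl _ _ _).2 (2 ^ size l) => x y c z.
  by case: c; lia.
case: E1 => vS ->; rewrite incF_false /= !inE eqxx (negbTE vS) (@valL_ext l (v |: S) S) ?mul0n; first by lia.
by move=> w wl; rewrite !inE; case: eqP vl => [<-|]; rewrite ?wl.
Qed.

Definition elts : seq V := [seq v <- enum V | v \in M].

Lemma size_elts : size elts = #|M|.
Proof. by rewrite cardE /elts enumT. Qed.

Lemma incS_val S : valL elts (incS S) + ovf S * 2 ^ #|M| = (valL elts S).+1.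
Proof.
rewrite /incS /ovf incF_filter -size_elts; apply: incF_val; first exact/filter_uniq/enum_uniq.
by move=> v; rewrite mem_filter => /andP[].
Qed.

Definition sub (i : nat) : {set V} := iter i incS set0.

Lemma sub_sub i : sub i \subset M.
Proof.
elim: i => [|i IH]; first by rewrite sub0set.
apply/subsetP => v; apply: contraLR => vM.
rewrite /= /incS incF_filter incF_out ?mem_filter ?(negbTE vM) //=.
by apply: contra vM; apply/subsetP.
Qed.

Lemma sub_val i : i < 2 ^ #|M| -> valL elts (sub i) = i.
Proof.
elim: i => [|i IH] Hi.
  by rewrite /=; elim: elts => //= v l ->; rewrite inE.
have := incS_val (sub i); rewrite IH; last by lia.
rewrite -[sub i.+1]/(incS (sub i)); move: Hi; move: (2 ^ _) (valL _ _) (ovf _) => z y [] Hi; lia.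
Qed.

(** The index is the binary value of [G], and the value determines a subset of [M]. *)
Lemma sub_surj (G : {set V}) : G \subset M -> exists2 i, i < 2 ^ #|M| & sub i = G.
Proof.
move=> GM; have Hlt := valL_lt elts G; rewrite size_elts in Hlt.
exists (valL elts G) => //; have := valL_inj (sub_val Hlt).
move=> H; apply/setP => v; case: (boolP (v \in M)) => vM.
  by apply: H; rewrite mem_filter vM mem_enum.
have S1 := sub_sub (valL elts G).
by apply/idP/idP => Hv; move: vM; rewrite ?(subsetP S1 _ Hv) ?(subsetP GM _ Hv).
Qed.

End Counter.

Section Eval.
Variables (n : nat) (E : {set {set 'I_n}}).
Notation V := 'I_n.
Notation adj := (adj E).
Notation base := (base E).

Lemma evS c1 c2 s : ev (c1 ;; c2) s = ev c2 (ev c1 s). Proof. by []. Qed.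
Lemma evD o s : ev (Do o) s = opst o s. Proof. by []. Qed.

Lemma inc_ok g mask s (G M : {set V}) : vr s 0 = 0 -> vr s vN = n ->
  [&& g != tC, mask != tC & mask != g] -> trk s g G -> trk s mask M ->
  trk (ev (inc g mask) s) g (incS M G) /\ tr (ev (inc g mask) s) tC 0 = ovf M G.
Proof.
move=> s0 sN /and3P[gC mC mg] HG HM; rewrite /inc evS; set s1 := ev (Do _) s.
pose P (done : seq V) s' := [/\ trk s' g (foldl (incF M) (G, true) done).1,
  tr s' tC 0 = (foldl (incF M) (G, true) done).2, trk s' mask M & vr s' 0 = 0].
set c := For _ _ _.
suff [] : P (enum V) (ev c s1) by [].
apply: (for_ord (P := P)) => //.
  by split=> // [v||v]; rewrite /= ?s0 ?eqxx ?(negbTE gC) ?(negbTE mC) /= ?HG ?HM.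
move=> done v s' vN' _ Ei F1 F2 [H1 H2 H3 H4].
rewrite /P foldl_rcons; move: H1 H2; case: (foldl _ _ done) => xs [] /= H1 H2; last first.
  rewrite /incF andbF /= Ei H3 H4 H2; case: (v \in M) => /=; rewrite ?H2 ?H4 //.
rewrite /incF andbT /= Ei H3 H4 H2; case: (v \in M) => /=; rewrite ?H2 ?H4 //=.
rewrite ?Ei H1; case: ifP => vx /=; rewrite ?Ei /=.
  split=> //=; rewrite ?(negbTE gC) ?[tC == g]eq_sym ?(negbTE gC) //=.
    move=> w /=; rewrite eqxx (inj_eq val_inj) !inE -H1.
    by case: eqP => [->|] //=.
  by move=> w /=; rewrite (negbTE mg) H3.
split=> //=; rewrite ?H4 ?eqxx //.
  move=> w /=; rewrite (negbTE gC) eqxx (inj_eq val_inj) !inE -H1.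
  by case: eqP => [->|].
by move=> w /=; rewrite (negbTE mC) (negbTE mg) H3.
Qed.

Lemma count_card (S : {set V}) : count (mem S) (enum V) = #|S|.
Proof. by rewrite cardE -size_filter enumT. Qed.

Lemma component_path (S : {set V}) u v : u \notin S ->
  reflect (exists l, [/\ path (adj_minus E S) u l, last u l = v & size l < n]) (v \in component E S u).
Proof.
move=> uS; rewrite inE; apply: (iffP andP) => [[vS /connectP[l0 P0 E0]]|[l [P1 E1 _]]].
  move: E0; case/shortenP: P0 => l Pl Ul _ El; exists l; split=> //.
  by have := max_card (mem (u :: l)); rewrite card_ord (card_uniqP Ul).
split; last by apply/connectP; exists l.
rewrite -E1; case/lastP: l P1 {E1} => [|l w] //; rewrite last_rcons rcons_path.
by case/andP => _ /and3P[].
Qed.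

Lemma base_setv s v x : v \in [:: vA; vB; vPt] -> base s -> base (setv s v x).
Proof. by rewrite !inE => /or3P[] /eqP -> Hs; apply: base_frame Hs _ _ _. Qed.

(** After [j] rounds the track holds every vertex at distance at most [j] and only vertices of the
    component. A round may reach further ahead, so the invariant is two inclusions; simple paths are
    shorter than n. *)
Lemma compc_ok s (u : V) : base s -> vr s vU = u -> u \notin tset n s tS2 ->
  trk (ev compc s) tR (component E (tset n s tS2) u).
Proof.
move=> Bs Eu uS; rewrite /compc !evS; set s1 := ev (clear tR) s; set s2 := ev (Do _) s1.
set S := tset n s tS2 in uS *.
have N1 : vr s vN = n by case: Bs.
have R1 : trk s1 tR set0 := clear_ok tR N1.
have B2 : base s2 by apply: (base_frame Bs); rewrite /s2 ?evD /= ?ev_vr // ev_tr.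
have U2 : vr s1 vU = u by rewrite /s1 ev_vr.
have S2 (v : V) : tr s2 tS2 v = (v \in S) by rewrite /s2 evD /= ev_tr // inE.
pose P j s' := [/\ base s', tset n s' tS2 = S, tset n s' tR \subset component E S u &
  forall l, path (adj_minus E S) u l -> size l <= j -> tr s' tR (last u l)].
set c := For _ _ _.
suff [_ _ H1 H2] : P (vr s2 vN) (ev c s2).
  move=> v; apply/idP/idP => [Hv|]; first by apply: (subsetP H1); rewrite inE.
  case/component_path => // l [Hl <- sz]; apply: H2 => //.
  by case: B2 => _ -> _; apply: ltnW.
apply: for_rule => //.
  split=> [||| l].
  - by apply: base_frame B2 _ _ _.
  - by apply/setP => v; rewrite in_set; apply: S2.
  - apply/subsetP => v; rewrite inE /s2 /= U2 (inj_eq val_inj) R1 inE.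
    by case: eqP => // -> _; rewrite inE uS connect0.
  - by case: l => // _ _; rewrite /s2 /= U2 eqxx.
move=> j s' Hj Ej F1 F2 [B' S' R' D'].
set body := When _ _.
have ES (v : V) : tr s' tS2 v = (v \in S) by rewrite -S' inE.
pose Q (done : seq (V * V)) s'' := [/\ base s'', tset n s'' tS2 = S, tset n s'' tR \subset component E S u,
  forall v : V, tr s' tR v -> tr s'' tR v &
  forall a b : V, (a, b) \in done -> adj a b -> tr s' tR a -> b \notin S -> tr s'' tR b].
have : Q (pairs n) (ev (edges body) s').
  apply: (edges_rule (E := E) (P := Q)) => //.
  - move=> done s'' v x vin [Q1 Q2 Q3 Q4 Q5]; split=> //.
    exact: base_setv.
  - move=> done a b s'' ab Ea Eb B'' FF1 FF2 [Q1 Q2 Q3 Q4 Q5].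
    rewrite /body /= Ea Eb; have ES'' : tr s'' tS2 b = (b \in S) by rewrite -Q2 inE.
    case: (boolP (tr s'' tR a)) => aR; last first.
      split=> // a' b'; rewrite mem_rcons inE xpair_eqE => /orP[/andP[/eqP -> /eqP ->]|]; last exact: Q5.
      by move=> _ /Q4; rewrite (negbTE aR).
    rewrite /= ?Eb ES''; case: (boolP (b \in S)) => bS.
      split=> // a' b'; rewrite mem_rcons inE xpair_eqE => /orP[/andP[/eqP -> /eqP ->]|]; last exact: Q5.
      by rewrite bS.
    split=> //=.
    + apply/subsetP => v; rewrite in_set /= (inj_eq val_inj).
      case: eqP => [-> _|_ Hv]; last by apply: (subsetP Q3); rewrite inE.
      have : a \in component E S u by apply: (subsetP Q3); rewrite inE.
      rewrite ![_ \in component _ _ _]in_set bS => /andP[aS ua] /=; apply: connect_trans ua (connect1 _).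
      by rewrite /adj_minus aS bS.
    + by move=> v /Q4 Hv; rewrite Hv; case: ifP.
    + move=> a' b'; rewrite mem_rcons inE xpair_eqE (inj_eq val_inj).
      by case: (b' =P b) => //= _; rewrite andbF; apply: Q5.
  - move=> done a b s'' ab [Q1 Q2 Q3 Q4 Q5]; split=> // a' b'.
    rewrite mem_rcons inE xpair_eqE => /orP[/andP[/eqP -> /eqP ->]|]; last exact: Q5.
    by rewrite (negbTE ab).
case=> Q1 Q2 Q3 Q4 Q5; split=> //.
move=> l; case/lastP: l => [|l w] Hl.
  by move=> _ /=; apply: Q4; have := D' [::] isT isT.
rewrite size_rcons last_rcons ltnS => Hs /=; move: Hl; rewrite rcons_path => /andP[Hl /and3P[lS wS Ha]].
apply: (Q5 (last u l)) => //; last exact: D'.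
by apply/allpairsP; exists (last u l, w); rewrite !mem_enum.
Qed.

End Eval.

End Counting.

(** * Evaluating a deletion set; walking along threads *)

Module Evaluation.
Import Machine Simulation Language Threads Families Programs Counting.

Section Eval.
Variables (n : nat) (E : {set {set 'I_n}}).
Notation V := 'I_n.
Notation adj := (adj E).
Notation base := (base E).

Lemma evI o c1 c2 s :
  ev (If o c1 c2) s = if opres o s then ev c1 (opst o s) else ev c2 (opst o s).
Proof. by []. Qed.

Definition feasb (p : nat) (S : {set V}) : bool :=
  [forall v, (v \notin S) ==> (#|component E S v| <= p)].

Lemma count_lt p : p <= n -> count (fun v : V => v < p) (enum V) = p.
Proof.
move=> pn; rewrite -sum1_count -[RHS]card_ord -sum1_card big_enum_cond /=.
rewrite -(big_ord_narrow_cond pn (P := xpredT) (F := fun=> 1)).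
by apply: eq_bigl => i.
Qed.

(** The answer is raised only for a set whose components have been measured, whatever [tS2]
    contains; soundness of the search rests on this. *)
Lemma evalc_ok s (S : {set V}) p : base s -> trk s tS2 S -> vr s vP = p -> p <= n ->
  [/\ vr (ev evalc s) vC2 = #|S|, vr (ev evalc s) vPs2 = psi E S &
   tr (ev evalc s) tANS 0 = tr s tANS 0 || feasb p S && (#|S| + p <= vr s vK)].
Proof.
move=> Bs HS Ep pn; rewrite /evalc !evS.
have [s0 sN _] := Bs.
set s1 := ev (Do (Cpy vC2 0)) s.
set c2 := For vI vN (When (Get tS2 vI) (Do (Inc vC2))); set s2 := ev c2 s1.
have C2 : vr s2 vC2 = #|S|.
  rewrite -count_card.
  apply: (for_ord (n := n) (P := fun done s' => vr s' vC2 = count (mem S) done)) => //.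
  move=> done v s' _ _ Ei F1 F2 IH; rewrite -cats1 count_cat /= Ei F2 //.
  by rewrite HS; case: ifP => _ /=; rewrite IH ?addn0 ?addn1.
set s3 := ev (Do (Put tBad 0 false)) (ev (Do (Cpy vPs2 0)) s2).
have B3 : base s3 by apply: (base_frame Bs) => //; rewrite /s3 !evD /= ?ev_vr ?ev_tr.
have [s30 s3N _] := B3.
have P3 : vr s3 vP = p by rewrite /s3 /= ev_vr.
have S3 : trk s3 tS2 S by move=> v; rewrite /s3 /= ev_tr // HS.
have C3 : vr s3 vC2 = #|S| by rewrite /s3 /= C2.
set c4 := For vU vN _; set s4 := ev c4 s3.
pose P (done : seq V) s' :=
  vr s' vPs2 = \sum_(v <- done | v \notin S) #|component E S v| /\
  tr s' tBad 0 = has (fun v => (v \notin S) && (p < #|component E S v|)) done.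
have [PsE BadE] : P (enum V) s4.
  apply: (for_ord (P := P)) => //.
    have s20 : vr s2 0 = 0 by rewrite ev_vr.
    by split; rewrite ?big_nil /s3 /= ?s20 ?eqxx.
  move=> done u s' _ _ Ei F1 F2 [IH1 IH2].
  have SE : \sum_(v <- rcons done u | v \notin S) #|component E S v| =
      \sum_(v <- done | v \notin S) #|component E S v| + (if u \in S then 0 else #|component E S u|).
    by rewrite -cats1 big_cat /= big_cons big_nil addn0; case: (u \in S).
  rewrite /P SE has_rcons orbC -IH1 -IH2.
  have B' : base s' by apply: (base_frame B3); rewrite ?F1 ?F2.
  have S' : trk s' tS2 S by move=> v; rewrite F2 // S3.
  have TS : tset n s' tS2 = S by apply/setP => v; rewrite inE S'.
  rewrite evI [opres _ _]/= Ei S' [opst (Get _ _) _]/=; case: (boolP (u \in S)) => uS.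
    by rewrite /= addn0 orbF.
  rewrite !evS; set sa := ev compc s'.
  have Ra : trk sa tR (component E S u) by rewrite -TS; apply: compc_ok => //; rewrite TS.
  have B'a : base sa by apply: base_ev.
  have sb0 : vr sa 0 = 0 by case: B'a.
  set sb := ev (Do (Cpy vSz 0)) sa.
  pose P' (done : seq V) s'' := vr s'' vSz = count (mem (component E S u)) done /\
      vr s'' vPs2 = vr s' vPs2 + count (mem (component E S u)) done.
  set cl := For vI vN _.
  have [Q1 Q2] : P' (enum V) (ev cl sb).
    apply: (for_ord (n := n) (P := P')) => //.
    - by case: B'a.
    - by split; rewrite //= ?sb0 // ev_vr // addn0.
    - move=> dn v s'' _ _ Ei' G1 G2 [J1 J2]; rewrite /P' -cats1 count_cat /= Ei' G2 //.
      by rewrite Ra; case: ifP => _ /=; rewrite J1 J2 ?addn0 ?addn1 ?addnS.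
  rewrite evI [opst (Lt _ _) _]/= [opres _ _]/=; rewrite count_card in Q1 Q2.
  set sc := ev cl sb in Q1 Q2 *.
  have Pc : vr sc vP = p by rewrite /sc !ev_vr // F1 // P3.
  have c0 : vr sc 0 = 0 by rewrite /sc !ev_vr //; case: B'.
  have Tc : tr sc tBad = tr s' tBad by rewrite /sc !ev_tr.
  by rewrite Pc Q1 /=; case: ifP => _ /=; rewrite ?Q2 ?c0 ?eqxx ?Tc ?orbT ?orbF.
have BadF : tr s4 tBad 0 = ~~ feasb p S.
  rewrite BadE; apply/hasP/forallPn => [[v _ /andP[v1 v2]]|[v]].
    by exists v; rewrite negb_imply v1 -ltnNge.
  by rewrite negb_imply -ltnNge => Hv; exists v; rewrite ?mem_enum.
have PsE' : vr s4 vPs2 = psi E S by rewrite PsE /psi big_enum_cond.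
have C4 : vr s4 vC2 = #|S| by rewrite ev_vr.
have s40 : vr s4 0 = 0 by rewrite ev_vr.
have A4 : tr s4 tANS = tr s tANS by rewrite !ev_tr.
have K4 : vr s4 vK = vr s vK by rewrite !ev_vr.
have P4 : vr s4 vP = p by rewrite !ev_vr.
have N4 : vr s4 vN = n by rewrite !ev_vr.
rewrite evI [opst (Get _ _) _]/= [opres _ _]/= s40 BadF.
case: (boolP (feasb p S)) => Hf; last by rewrite /= C4 PsE' A4 orbF.
rewrite !evS [~~ true]/=; set s5 := ev (Do (Cpy vSz vC2)) s4.
set c6 := For vI vN _; set s6 := ev c6 s5.
have E6 : vr s6 vSz = #|S| + p.
  rewrite -[p in RHS](count_lt pn).
  pose P6 (done : seq V) s' := vr s' vSz = #|S| + count (fun v : V => v < p) done.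
  apply: (for_ord (n := n) (P := P6)) => //.
    by rewrite /P6 /= C4 addn0.
  move=> dn v s'' _ _ Ei' G1 G2 J1; rewrite /P6 -cats1 count_cat /= Ei' G1 //= P4.
  by case: ifP => _ /=; rewrite J1 ?addn0 // addn1 addnS.
rewrite evI [opst (Lt _ _) _]/= [opres _ _]/=.
have K6 : vr s6 vK = vr s vK by rewrite ev_vr.
have s60 : vr s6 0 = 0 by rewrite ev_vr.
have C6 : vr s6 vC2 = #|S| by rewrite ev_vr.
have Ps6 : vr s6 vPs2 = psi E S by rewrite ev_vr.
have A6 : tr s6 tANS = tr s tANS by rewrite ev_tr.
by rewrite E6 K6 ltnNge; case: leqP => _ /=; rewrite ?s60 ?eqxx ?C6 ?Ps6 ?A6 ?orbT ?orbF.
Qed.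


End Eval.
Section Walk.
Variables (n : nat) (E : {set {set 'I_n}}) (Y : {set 'I_n}).
Notation V := 'I_n.
Notation adj := (adj E).
Notation base := (base E).
Notation zn := (zn E Y).
Notation nx := (nx E).

Definition scan (rg : nat) (o : op) (dst : nat) : cmd :=
  edges (When (Eq vA rg) (If o Skip (Do (Cpy dst vB)))).

(** Only the row of [y] has an effect, and there the last admissible neighbour wins. *)
Lemma foldl_row (P : pred V) (y d : V) :
  foldl (fun acc ab => if [&& adj ab.1 ab.2, ab.1 == y & P ab.2] then ab.2 else acc) d (pairs n)
  = lastnb E P y d.
Proof.
pose f acc (ab : V * V) := if [&& adj ab.1 ab.2, ab.1 == y & P ab.2] then ab.2 else acc.
have row (l : seq V) a d' : foldl f d' [seq (a, b) | b <- l] =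
    if a == y then foldl (fun acc w => if adj y w && P w then w else acc) d' l else d'.
  elim: l d' => /= [|b l IH] d'; first by case: ifP.
  by rewrite IH /f /=; case: (a =P y) => [->|_] //=; rewrite andbF.
have H (l : seq V) d' : uniq l -> foldl f d' [seq (a, b) | a <- l, b <- enum V] =
    if y \in l then lastnb E P y d' else d'.
  elim: l d' => //= a l IH d' /andP[al Ul].
  rewrite foldl_cat row IH // inE (eq_sym y); case: (a =P y) => [ay|] //=.
  by rewrite -ay (negbTE al).
by rewrite [LHS]H ?enum_uniq // mem_enum.
Qed.

Lemma scan_ok rg o dst (P : pred V) (y d : V) s : base s ->
  [&& dst != 0, dst != vN, dst \notin [:: vA; vB; vPt; rg] & rg \notin [:: vA; vB; vPt]] ->
  opmv o = [::] -> opmt o = [::] -> (forall s', opst o s' = s') ->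
  vr s rg = y -> vr s dst = d ->
  (forall s' (b : V), vr s' vB = b -> (forall t, tr s' t = tr s t) ->
    (forall w, w \notin [:: vA; vB; vPt; dst] -> vr s' w = vr s w) -> opres o s' = ~~ P b) ->
  vr (ev (scan rg o dst) s) dst = lastnb E P y d.
Proof.
move=> Bs /and4P[d0 dN dd rr] mvo mto sto Ey Ed Ho.
pose f acc (ab : V * V) := if [&& adj ab.1 ab.2, ab.1 == y & P ab.2] then ab.2 else acc.
pose Q (done : seq (V * V)) s' := vr s' dst = foldl f d done.
move: dd rr; rewrite !inE !negb_or => /and4P[dA dB dP dr] /and3P[rA rB rP].
suff H : Q (pairs n) (ev (scan rg o dst) s) by rewrite H foldl_row.
apply: (edges_rule (E := E) (P := Q)) => //.
- by rewrite /okc /= mvo mto /= !inE !(eq_sym _ dst) d0 dN.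
- by rewrite /= mvo /= !inE ![_ == dst]eq_sym dA dB dP.
- move=> done s' v x Hv; rewrite /Q /= ifF //; move: Hv; rewrite !inE.
  by case/or3P => /eqP ->; apply/negbTE.
- move=> done a b s' ab Ea Eb B' F1 F2; rewrite /Q foldl_rcons => IH.
  have Er : vr s' rg = y.
    by rewrite F1 //= mvo !inE (negbTE rA) (negbTE rB) (negbTE rP) /= eq_sym (negbTE dr).
  have Hb : opres o s' = ~~ P b.
    apply: Ho => // [t|w Hw]; first by rewrite F2 //= mto.
    by apply: F1; move: Hw; rewrite /= mvo !inE.
  rewrite evI [opst _ _]/= [opres (Eq _ _) _]/= Ea Er (inj_eq val_inj) {1}/f /= ab /=.
  by case: (a == y) => //=; rewrite Hb sto; case: (P b) => //=; rewrite eqxx.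
- by move=> done a b s' /negbTE ab; rewrite /Q foldl_rcons /= {2}/f /= ab.
Qed.

Lemma znc_ok s (y : V) : base s -> trk s tY Y -> vr s vY = y -> vr (ev znc s) vC = zn y.
Proof.
move=> Bs HY Ey; rewrite /znc evS; apply: scan_ok => //.
- by move=> s' b Eb Ht Hv; rewrite /= Eb Ht /= HY negbK.
Qed.

Lemma nxc_ok s (u z : V) : base s -> vr s vPrev = u -> vr s vC = z ->
  vr (ev nxc s) vPrev = z /\ vr (ev nxc s) vC = nx u z.
Proof.
move=> Bs Eu Ez; rewrite /nxc 3!evS; set s1 := ev (Do (Cpy vQ vC)) s.
set s2 := ev (edges _) s1.
have E2 : vr s2 vQ = nx u z.
  apply: scan_ok => //.
  move=> s' b Eb Ht Hv; rewrite /= Eb Hv //= Eu (inj_eq val_inj).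
  by rewrite negbK.
have C2 : vr s2 vC = z by rewrite /s2 ev_vr.
by split.
Qed.

Section Act.
Variables (X : Type) (f : X -> V -> X) (R : X -> st -> Prop) (act : cmd).
Hypothesis Rfr : forall x s s', (forall t, tr s' t = tr s t) ->
  (forall w, w \notin [:: vI; vQ; vPt; vA; vB; vPrev; vC] -> vr s' w = vr s w) -> R x s -> R x s'.
Hypothesis Ract : forall x s (z : V), z \notin Y -> base s -> vr s vC = z -> R x s -> R (f x z) (ev act s).
Hypothesis okact : okc act.
Hypothesis mact : all (fun v => v \notin mv act) [:: vI; vPrev; vC] && (tY \notin mt act).

Definition wst (x : X * (V * V)) : X * (V * V) :=
  if x.2.2 \in Y then x else (f x.1 x.2.2, wstep E Y x.2).

(** [R] is insensitive to the variables of the walk and the action leaves the walk alone, so one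
    proof serves both shifts and patterns. *)
Lemma walk_ok x s (y : V) : base s -> trk s tY Y -> vr s vY = y -> R x s ->
  R (iter n wst (x, (y, zn y))).1 (ev (walk act) s).
Proof.
move=> Bs HY Ey Rx; have [/and3P[mI mP /andP[mC _]] mY] := andP mact.
have [o1 o2 o3] := and3P okact.
rewrite /walk 2!evS; set s1 := ev (Do (Cpy vPrev vY)) s; set s2 := ev znc s1.
have B1 : base s1 by apply: base_frame Bs _ _ _.
have C2 : vr s2 vC = zn y by apply: znc_ok.
have B2 : base s2 by apply: base_ev.
have P2 : vr s2 vPrev = y by rewrite /s2 ev_vr.
have Y2 : trk s2 tY Y by move=> v; rewrite /s2 ev_tr //= HY.
have R2 : R x s2.
  apply: Rfr Rx => [t|w Hw]; first by rewrite /s2 ev_tr.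
  rewrite /s2 ev_vr; last by move: Hw; rewrite /= !inE; do 7![case: eqP => //= _].
  by move: Hw; rewrite /= !inE; do 7![case: eqP => //= _].
pose W := fun j => iter j wst (x, (y, zn y)).
pose P j s' := [/\ R (W j).1 s', vr s' vPrev = (W j).2.1 & vr s' vC = (W j).2.2].
set c := For _ _ _.
have N2 : vr s2 vN = n by case: B2.
suff [] : P n (ev c s2) by [].
rewrite -{1}N2; apply: for_rule => //.
- by rewrite /= !mem_cat /= !inE /= !(negbTE mI, negbTE o2).
- by split=> //; apply: Rfr R2 => // w; rewrite /= !inE; case: eqP.
move=> j s' Hj Ej F1 F2 [Rj Pj Cj].
have Y' : trk s' tY Y.
  by move=> v; rewrite F2 ?Y2 //= !mem_cat /= negb_or mY.
have B' : base s'.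
  by apply: (base_frame B2); rewrite ?F1 ?F2 //= ?inE ?mem_cat /= ?negb_or ?o1 ?o2 ?o3.
have Rinc x' s'' : R x' s'' -> R x' (opst (Inc vI) s'').
  by apply: Rfr => // w; rewrite /= !inE; case: eqP.
rewrite /P [W j.+1]/= -/(W j) /wst evI [opst (Get _ _) _]/= [opres _ _]/= Cj Y'.
case: (boolP ((W j).2.2 \in Y)) => HW.
  by split=> //; apply: Rinc.
rewrite evS; set sa := ev act s'.
have Ba : base sa by apply: base_ev.
have Ra : R (f (W j).1 (W j).2.2) sa by apply: Ract.
have [] := @nxc_ok sa (W j).2.1 (W j).2.2 Ba; [by rewrite /sa ev_vr|by rewrite /sa ev_vr|].
move=> N1 N3; split; last 2 first.
- by rewrite opst_vr // N1 /= /wstep (negbTE HW).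
- by rewrite opst_vr // N3 /= /wstep (negbTE HW).
apply: Rinc; apply: Rfr Ra => [t|w Hw]; first by rewrite ev_tr.
by rewrite ev_vr //=; move: Hw; rewrite /= !inE; do 7![case: eqP => //= _].
Qed.

End Act.
End Walk.

End Evaluation.

(** * Programs for the shifts and for the initial family *)

Module Moves.
Import Machine Simulation Language Threads Families Programs Counting Evaluation.

Section Moves.
Variables (n : nat) (E : {set {set 'I_n}}) (Y : {set 'I_n}).
Notation V := 'I_n.
Notation base := (base E).

Definition shf_act (x : {set V} * bool) (z : V) : {set V} * bool :=
  (if x.2 then z |: x.1 else x.1 :\ z, z \in x.1).

Definition pat_act_fun (p : nat) (x : {set V} * nat) (z : V) : {set V} * nat :=
  if x.2 == p then (z |: x.1, 0) else (x.1, x.2.+1).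

Lemma shfE S y : shf E Y S y = (iter n (wst E Y shf_act) ((S, false), (y, zn E Y y))).1.1.
Proof.
rewrite /shf; congr (_.1.1); apply: eq_iter => -[[T c] d] /=.
by rewrite /wst /shf_act /=.
Qed.

Lemma patE p S y c :
  pat E Y p S y c = (iter n (wst E Y (pat_act_fun p)) ((S, c), (y, zn E Y y))).1.1.
Proof.
rewrite /pat; congr (_.1.1); apply: eq_iter => -[[T c'] d] /=.
by rewrite /wst /pat_act_fun /=; case: ifP => //; case: ifP.
Qed.

Lemma trk_put s t v b (S : {set V}) (z : V) : trk s t S -> vr s v = z ->
  trk (opst (Put t v b) s) t (if b then z |: S else S :\ z).
Proof.
move=> HS Ez w; rewrite /= eqxx Ez (inj_eq val_inj) /= HS.
by case: b; rewrite !inE; case: (w == z).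
Qed.

Lemma shallc_ok s (b S : {set V}) : base s -> trk s tY Y -> trk s tS1 S -> trk s tG5 b ->
  trk (ev shallc s) tS2 (shall E Y b S).
Proof.
move=> Bs HY HS Hb; rewrite /shallc evS; set s1 := ev (copyt _ _) s.
have B1 : base s1 by apply: base_ev.
have S1 : trk s1 tS2 S by apply: copyt_ok => //; case: Bs.
pose P (done : seq V) s' :=
  trk s' tS2 (foldl (fun S y => if y \in b then shf E Y S y else S) S done).
apply: (for_ord (P := P)) => //; first by case: B1.
move=> done y s' _ _ Ey F1 F2; rewrite /P foldl_rcons; set T := foldl _ _ done => IH.
have B' : base s' by apply: (base_frame B1); rewrite ?F1 ?F2.
have Y' : trk s' tY Y by move=> v; rewrite F2 // /s1 ev_tr // HY.
rewrite evI [opst (Get _ _) _]/= [opres _ _]/= Ey F2 // /s1 ev_tr // Hb.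
case: (y \in b) => //; rewrite evS shfE; set s2 := ev (Do (Put tCB 0 false)) s'.
have s'0 : vr s' 0 = 0 by case: B'.
pose R (x : {set V} * bool) s := [/\ trk s tS2 x.1, tr s tCB 0 = x.2 & vr s 0 = 0].
suff [] : R (iter n (wst E Y shf_act) (T, false, (y, zn E Y y))).1 (ev (walk shift_act) s2) by [].
apply: walk_ok => //.
- move=> x sa sb Ht Hv [R1 R2 R3]; split; rewrite ?Ht ?Hv //.
  by move=> v; rewrite Ht R1.
- move=> [U c] sa z zY Ba Ez [/= R1 R2 R3]; rewrite R3 R2 /shf_act /=.
  case: c R2 => R2 /=; rewrite Ez R1; case: (boolP (z \in U)) => zU.
  (* [shift_act] skips the write when the status in transit equals the one it finds. *)
  + by split=> //=; rewrite (setUidPr _) ?sub1set.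
  + split=> //=.
    have := trk_put (t := tS2) (v := vC) true R1 Ez; rewrite /= Ez => H w; exact: (H w).
  + split=> //=.
    have := trk_put (t := tS2) (v := vC) false R1 Ez; rewrite /= Ez => H w; exact: (H w).
  + split=> //=; suff -> : U :\ z = U by [].
    by apply/setP => w; rewrite !inE; case: eqP => // ->; rewrite (negbTE zU).
- by split; rewrite /s2 /= ?s'0.
Qed.

Lemma initc_ok s p (G1 G2 G3 G4 : {set V}) : base s -> trk s tY Y -> vr s vP = p ->
  trk s tG1 G1 -> trk s tG2 G2 -> trk s tG3 G3 -> trk s tG4 G4 ->
  trk (ev initc s) tS2 (sinit E Y p G1 G2 G3 G4).
Proof.
move=> Bs HY Ep H1 H2 H3 H4; rewrite /initc 2!evS; set s1 := ev (copyt _ _) s.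
have B1 : base s1 by apply: base_ev.
have S1 : trk s1 tS2 G1 by apply: copyt_ok => //; case: Bs.
set s2 := ev (For vY vN _) s1.
have S2 : trk s2 tS2
   (foldl (fun S y => if y \in G2 then pat E Y p S y (if y \in G3 then 0 else p) else S) G1 (enum V)).
  pose P (done : seq V) s' :=
    trk s' tS2 (foldl (fun S y => if y \in G2 then pat E Y p S y (if y \in G3 then 0 else p) else S) G1 done).
  apply: (for_ord (P := P)) => //; first by case: B1.
  move=> done y s' _ _ Ey F1 F2; rewrite /P foldl_rcons; set T := foldl _ _ done => IH.
  have B' : base s' by apply: (base_frame B1); rewrite ?F1 ?F2.
  have Y' : trk s' tY Y by move=> v; rewrite F2 // /s1 ev_tr // HY.
  have P' : vr s' vP = p by rewrite F1 // /s1 ev_vr.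
  rewrite evI [opst (Get _ _) _]/= [opres _ _]/= Ey F2 // /s1 ev_tr // H2.
  case: (y \in G2) => //; rewrite evS patE; set sc := ev (If _ _ _) s'.
  have s'0 : vr s' 0 = 0 by case: B'.
  have Cc : vr sc vCt = if y \in G3 then 0 else p.
    rewrite /sc evI [opst (Get _ _) _]/= [opres _ _]/= Ey F2 // /s1 ev_tr // H3.
    by case: ifP => _ /=; rewrite ?s'0.
  pose R (x : {set V} * nat) s := [/\ trk s tS2 x.1, vr s vCt = x.2, vr s vP = p & vr s 0 = 0].
  suff [] : R (iter n (wst E Y (pat_act_fun p)) (T, if y \in G3 then 0 else p, (y, zn E Y y))).1
    (ev (walk pat_act) sc) by [].
  apply: walk_ok => //.
  - move=> x sa sb Ht Hv [R1 R2 R3 R4]; split; rewrite ?Ht ?Hv //.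
    by move=> v; rewrite Ht R1.
  - move=> [U c] sa z zY Ba Ez [/= R1 R2 R3 R4]; rewrite R2 R3 /pat_act_fun /=.
    case: (c == p); split=> //=; rewrite ?R2 //.
    by have := trk_put (t := tS2) (v := vC) true R1 Ez; rewrite /= Ez.
  - by apply: base_ev.
  - by move=> v; rewrite /sc ev_tr.
  - by rewrite /sc ev_vr.
  - split=> //; rewrite /sc ?ev_vr //.
    by move=> v; rewrite ev_tr // IH.
have B2 : base s2 by apply: base_ev.
pose P (done : seq V) s' := trk s' tS2 (foldl (fun S y => if y \in G4 then zn E Y y |: S else S)
   (foldl (fun S y => if y \in G2 then pat E Y p S y (if y \in G3 then 0 else p) else S) G1 (enum V)) done).
apply: (for_ord (P := P)) => //; first by case: B2.
move=> done y s' _ _ Ey F1 F2; rewrite /P foldl_rcons; set T := foldl _ _ done => IH.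
have B' : base s' by apply: (base_frame B2); rewrite ?F1 ?F2.
have Y' : trk s' tY Y by move=> v; rewrite F2 // /s2 /s1 !ev_tr // HY.
rewrite evI [opst (Get _ _) _]/= [opres _ _]/= Ey F2 // /s2 /s1 !ev_tr // H4.
case: (y \in G4) => //; rewrite evS; set sz := ev znc s'.
have Cz : vr sz vC = zn E Y y by apply: znc_ok.
have Sz : trk sz tS2 T by move=> v; rewrite /sz ev_tr // IH.
by have := trk_put true Sz Cz.
Qed.

End Moves.

End Moves.

(** * Soundness and completeness of the search *)

Module Search.
Import Machine Simulation Language Threads Families Completeness Programs Counting Evaluation Moves.

Section Search.
Variables (n : nat) (E : {set {set 'I_n}}) (Y : {set 'I_n}) (k : nat).
Notation V := 'I_n.
Notation base := (base E).

Definition good : Prop := exists p (S : {set V}), feasb E p S && (#|S| + p <= k).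

(** The flag [a] promises that the answer has been raised. Soundness keeps [a] fixed and
    completeness turns it into [true], so one invariant serves both. *)
Definition ctx (a : bool) (s : st) : Prop :=
  [/\ base s, trk s tY Y, vr s vW = 2 ^ #|Y|, vr s vNN = (n * n).+1 &
   [/\ vr s vK = k, (tr s tANS 0 -> good) & (a -> tr s tANS 0)]].

Definition ctxp (a : bool) (p : nat) (s : st) : Prop := ctx a s /\ vr s vP = p.

Lemma ctx_frame a s s' : (forall v, v \in [:: 0; vN; vW; vNN; vK] -> vr s' v = vr s v) ->
  (forall t, t \in [:: tM; tY; tANS] -> tr s' t = tr s t) -> ctx a s -> ctx a s'.
Proof.
move=> Hv Ht [H1 H2 H3 H4 [H5 H6 H7]]; split.
- by apply: base_frame H1 _ _ _; rewrite ?Hv ?Ht.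
- by move=> v; rewrite Ht.
- by rewrite Hv.
- by rewrite Hv.
- by rewrite Hv // !Ht.
Qed.

Lemma ctxp_frame a p s s' : (forall v, v \in [:: 0; vN; vW; vNN; vK; vP] -> vr s' v = vr s v) ->
  (forall t, t \in [:: tM; tY; tANS] -> tr s' t = tr s t) -> ctxp a p s -> ctxp a p s'.
Proof.
move=> Hv Ht [H1 H2]; split; last by rewrite Hv.
by apply: ctx_frame H1 => // v vin; apply: Hv; rewrite -[[:: 0; _; _; _; _; _]]/([:: 0; vN; vW; vNN; vK] ++ [:: vP]) mem_cat vin.
Qed.

Definition okp (c : cmd) : bool :=
  all (fun v => v \notin mv c) [:: 0; vN; vW; vNN; vK; vP] &&
  all (fun t => t \notin mt c) [:: tM; tY; tANS].

Lemma ctxp_ev a p c s : okp c -> ctxp a p s -> ctxp a p (ev c s).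
Proof.
case/andP => /allP H1 /allP H2; apply: ctxp_frame => [v /H1|t /H2] H.
  by rewrite ev_vr.
by rewrite ev_tr.
Qed.

Lemma ctxp_setv a p s v x : v \notin [:: 0; vN; vW; vNN; vK; vP] -> ctxp a p s -> ctxp a p (setv s v x).
Proof.
move=> Hv; apply: ctxp_frame => // w Hw /=.
by case: eqP => // Ew; rewrite -Ew Hw in Hv.
Qed.

Lemma ctxp_inc a p s v : v \notin [:: 0; vN; vW; vNN; vK; vP] -> ctxp a p s -> ctxp a p (opst (Inc v) s).
Proof. exact: ctxp_setv. Qed.

Lemma ctxp_evalc a p s : p <= n -> ctxp a p s -> ctxp a p (ev evalc s).
Proof.
move=> pn [[H1 H2 H3 H4 [H5 H6 H7]] H8].
have [_ _ EA] := evalc_ok H1 (trk_tset (n := n) s tS2) H8 pn.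
split; last by rewrite ev_vr.
split; rewrite ?ev_vr //.
- exact: base_ev.
- by move=> v; rewrite ev_tr.
- split=> //; last by move=> /H7 aH; rewrite EA aH.
  rewrite EA => /orP[/H6 //|H].
  by exists p, (tset n s tS2); rewrite -H5.
Qed.

Definition trks (s : st) (L : seq (nat * {set V})) : Prop :=
  forall x, x \in L -> trk s x.1 x.2.

Definition oke (g v : nat) (c : cmd) : bool :=
  [&& v \notin mv c, v \notin [:: 0; vN; vW; vNN; vK; vP; vJ; vI], g \notin mt c,
      g \notin [:: tM; tY; tANS; tC], vW \notin mv c & tY \notin mt c].

(** [I] must ignore what the enumeration itself overwrites: the loop variables, the track of the
    guess and the carry. *)
Lemma enum_rule g v c s (I : nat -> st -> Prop) : oke g v c -> 0 \notin mv c -> vN \notin mv c ->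
  vr s 0 = 0 -> vr s vN = n -> vr s vW = 2 ^ #|Y| -> trk s tY Y ->
  (forall i s s', (forall w, w \notin [:: v; vI; vJ] -> vr s' w = vr s w) ->
    (forall t, t \notin [:: g; tC] -> tr s' t = tr s t) -> I i s -> I i s') ->
  I 0 s ->
  (forall i s', i < 2 ^ #|Y| -> trk s' g (sub Y i) ->
    (forall t, t \notin [:: g, tC & mt c] -> tr s' t = tr s t) ->
    I i s' -> I i.+1 (ev c s')) ->
  I (2 ^ #|Y|) (ev (enumc g v c) s).
Proof.
case/and5P => vc vs gc gs /andP[wc yc] c0 cN s0 sN sW HY HI I0 IS.
move: vs gs; rewrite !inE !negb_or.
case/and5P => v0 vN' vW' vNN' /and4P[vK' vP' vJ' vI'] /and4P[gM gY gA gC].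
rewrite /enumc evS; set s1 := ev (clear g) s.
have N1 : vr s1 vN = n by rewrite ev_vr.
have s10 : vr s1 0 = 0 by rewrite ev_vr.
have R1 : trk s1 g set0 := clear_ok g sN.
have I1 : I 0 s1.
  apply: HI I0 => [w|t]; first by rewrite !inE => /norP[_ /norP[wI _]]; rewrite ev_vr //= inE.
  by rewrite !inE => /norP[tg _]; rewrite ev_tr //= inE.
pose P i s' := I i s' /\ trk s' g (sub Y i).
rewrite -sW (_ : vr s vW = vr s1 vW); last by rewrite ev_vr.
suff [] : P (vr s1 vW) (ev (For v vW (c ;; inc g tY)) s1) by [].
have mvi : mv (inc g tY) = [:: vJ] by [].
apply: (for_rule (P := P)).
- by rewrite /= vW' !mem_cat /= !inE !negb_or vc wc vJ'.
- split=> //; apply: HI I1 => //= w; rewrite !inE => /norP[/negbTE -> _] //.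
move=> i s' Hi Ei F1 F2 [Ii Gi].
have Hi' : i < 2 ^ #|Y| by rewrite -sW -[vr s vW](_ : vr s1 vW = _) // ev_vr.
have s1g t : t != g -> tr s1 t = tr s t by move=> tg; rewrite ev_tr //= inE.
have mti t : (t \in mt (inc g tY)) = (t \in [:: g; tC]).
  by rewrite /= !inE; case: (t == tC); case: (t == g).
have Fs' t : t \notin [:: g, tC & mt c] -> tr s' t = tr s t.
  rewrite !inE => /norP[tg /norP[tC' tc]]; rewrite F2 ?s1g //.
  by rewrite [mt _]/= mem_cat negb_or tc -/(mt (inc g tY)) mti !inE negb_or tg.
have Y' : trk s' tY Y by move=> u; rewrite Fs' ?HY // !inE !negb_or eq_sym gY.
rewrite evS; set s2 := ev c s'.
have I2 : I i.+1 s2 by apply: IS.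
have s20 : vr s2 0 = 0.
  by rewrite /s2 ev_vr // F1 // [mv _]/= inE mem_cat !negb_or eq_sym v0 c0.
have N2 : vr s2 vN = n.
  by rewrite /s2 ev_vr // F1 // [mv _]/= inE mem_cat !negb_or eq_sym vN' cN.
have Y2 : trk s2 tY Y by move=> u; rewrite /s2 ev_tr.
have G2 : trk s2 g (sub Y i) by move=> u; rewrite /s2 ev_tr.
have [H1 _] := inc_ok (g := g) (mask := tY) s20 N2 ltac:(by rewrite gC [tY == g]eq_sym gY) G2 Y2.
split; last by move=> u; rewrite /= -/(ev (inc g tY) s2) H1.
apply: HI I2 => [w|t].
  by rewrite !inE => /norP[wv /norP[wI wJ]]; rewrite opst_vr ?inE // ev_vr ?mvi ?inE.
by rewrite opst_tr // => Ht; rewrite ev_tr // mti.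
Qed.

Lemma enum_sound g v c p : oke g v c -> 0 \notin mv c -> vN \notin mv c ->
  (forall a s, ctxp a p s -> ctxp a p (ev c s)) ->
  forall a s, ctxp a p s -> ctxp a p (ev (enumc g v c) s).
Proof.
move=> Hok c0 cN Hc a s Hs; have [[[s0 sN _] HY HW _ _] _] := Hs.
apply: (enum_rule (I := fun _ s => ctxp a p s)) => // [_ s1 s2 F1 F2|i s' _ _ _]; last exact: Hc.
case/and5P: Hok => _ + _ + _; rewrite !inE !negb_or.
case/and5P => v0 vN' vW' vNN' /and4P[vK' vP' vJ' vI'] /and4P[gM gY gA gC].
apply: ctxp_frame => [w|t]; rewrite !inE => Hw.
  by apply: F1; rewrite !inE; move: Hw; do 5?[case/orP]; move/eqP => ->;
   rewrite negb_or eq_sym ?(v0, vN', vW', vNN', vK', vP').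
by apply: F2; rewrite !inE; move: Hw; do 2?[case/orP]; move/eqP => ->;
   rewrite negb_or eq_sym ?(gM, gY, gA).
Qed.

(** [G] occurs as [sub Y i0]. The flag [a || (i0 < i)] is raised in round [i0], and the other rounds
    preserve it. [L] lists the guesses fixed by the outer loops. *)
Lemma enum_compl g v c p L (G : {set V}) : oke g v c -> 0 \notin mv c -> vN \notin mv c ->
  G \subset Y -> all (fun x => x.1 \notin [:: g, tC & mt c]) L ->
  (forall a s, ctxp a p s -> ctxp a p (ev c s)) ->
  (forall a s, ctxp a p s -> trks s ((g, G) :: L) -> ctxp true p (ev c s)) ->
  forall a s, ctxp a p s -> trks s L -> ctxp true p (ev (enumc g v c) s).
Proof.
move=> Hok c0 cN GY /allP HL Hc Hc2 a s Hs HsL; have [[[s0 sN _] HY HW _ _] _] := Hs.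
have [i0 Hi0 Ei0] := sub_surj GY.
have := enum_rule (I := fun i s => ctxp (a || (i0 < i)) p s) Hok c0 cN s0 sN HW HY.
rewrite Hi0 orbT orbF; apply=> // [i s1 s2 F1 F2|i s' _ Hg Fs' Hs'].
  case/and5P: Hok => _ + _ + _; rewrite !inE !negb_or.
  case/and5P => v0 vN' vW' vNN' /and4P[vK' vP' vJ' vI'] /and4P[gM gY gA gC].
  apply: ctxp_frame => [w|t]; rewrite !inE => Hw.
    by apply: F1; rewrite !inE; move: Hw; do 5?[case/orP]; move/eqP => ->;
     rewrite negb_or eq_sym ?(v0, vN', vW', vNN', vK', vP').
  by apply: F2; rewrite !inE; move: Hw; do 2?[case/orP]; move/eqP => ->;
     rewrite negb_or eq_sym ?(gM, gY, gA).
have [Ei|Ni] := eqVneq i0 i; last by rewrite ltnS leq_eqVlt (negbTE Ni) /=; apply: Hc.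
rewrite ltnS Ei leqnn orbT; apply: Hc2 Hs' _ => x; rewrite inE => /orP[/eqP ->|xL] /=.
  by rewrite -Ei0 Ei.
by move=> u; rewrite Fs' ?HsL //; apply: HL.
Qed.


Definition innerc : cmd :=
  shallc ;; evalc ;; When (Eq vC2 vC1) (When (Lt vPs2 vPs1) take2).

Lemma innerc_sound a p s : p <= n -> ctxp a p s -> ctxp a p (ev innerc s).
Proof.
move=> pn Hs; rewrite /innerc 2!evS.
by apply: ctxp_ev => //; apply: ctxp_evalc => //; apply: ctxp_ev.
Qed.

Lemma passc_sound a p s : p <= n -> ctxp a p s -> ctxp a p (ev (enumc tG5 vE5 innerc) s).
Proof. by move=> pn; apply: enum_sound => // {}a {}s; apply: innerc_sound. Qed.

Lemma bodyc_sound a p s : p <= n -> ctxp a p s -> ctxp a p (ev bodyc s).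
Proof.
move=> pn Hs; rewrite /bodyc 3!evS -/innerc; set s1 := ev take2 _.
have Hs1 : ctxp a p s1.
  by apply: ctxp_ev => //; apply: ctxp_evalc => //; apply: ctxp_ev.
apply: (for_rule (P := fun _ => ctxp a p)); [by []|by apply: ctxp_setv|].
by move=> j s' _ _ _ _ H; apply: ctxp_inc => //; apply: passc_sound.
Qed.

Hypothesis simpleE : simple_graph E.
Hypothesis deg2 : forall z, z \notin Y -> exists u w, u != w /\ forall v, adj E z v = (v == u) || (v == w).
Hypothesis one_port : forall y b b', y \in Y -> adj E y b -> b \notin Y -> adj E y b' -> b' \notin Y -> b = b'.
Variable x0 : V.
Hypothesis x0Y : x0 \in Y.
Hypothesis connE : forall x, connect (adj E) x0 x.

Section Complete.
Variables (p : nat) (T : {set V}) (P : {set V} -> Prop).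
Hypothesis pn : p <= n.
Hypothesis Tk : #|T| + p <= k.
Hypothesis P_card : forall S, P S -> #|S| <= #|T|.
Hypothesis P_improve : forall S, P S -> feasible E p S \/
  exists b : {set V}, [/\ b \subset Y, #|shall E Y b S| = #|S| & psi E (shall E Y b S) < psi E S].
Hypothesis P_shall : forall (S b : {set V}), b \subset Y -> P S -> #|shall E Y b S| = #|S| -> P (shall E Y b S).

Lemma feasP (S : {set V}) : reflect (feasible E p S) (feasb E p S).
Proof. by apply: (iffP forallP) => H v; [move/implyP: (H v)|apply/implyP/H]. Qed.

Lemma psi_le (S : {set V}) : psi E S <= n * n.
Proof.
rewrite /psi; apply: leq_trans (_ : \sum_(v : V) n <= _); last by rewrite sum_nat_const card_ord.
by rewrite big_mkcond; apply: leq_sum => v _; case: ifP => // _; rewrite -[X in _ <= X]card_ord max_card.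
Qed.

Definition cur (S : {set V}) (s : st) : Prop :=
  [/\ trk s tS1 S, P S, ~~ feasb E p S, vr s vC1 = #|S| & vr s vPs1 = psi E S].

(** After [r] passes the potential is at least [r] below [n * n]; beyond [n * n] passes only a
    raised answer is left. *)
Definition level (r : nat) (s : st) : Prop :=
  ctxp true p s \/ (exists a, ctxp a p s) /\ exists2 S, cur S s & psi E S + r <= n * n.

Lemma cur_frame S s s' : (forall v, v \in [:: vC1; vPs1] -> vr s' v = vr s v) ->
  tr s' tS1 = tr s tS1 -> cur S s -> cur S s'.
Proof.
move=> Hv Ht [H1 H2 H3 H4 H5]; split; rewrite ?Hv //.
by move=> v; rewrite Ht.
Qed.

Lemma take2_cur S s : vr s vN = n -> trk s tS2 S -> P S -> ~~ feasb E p S -> vr s vC2 = #|S| ->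
  vr s vPs2 = psi E S -> cur S (ev take2 s).
Proof.
move=> sN HS PS HF HC Hp; rewrite /take2 2!evS; set s1 := ev (copyt _ _) s.
have H1 : trk s1 tS1 S by apply: copyt_ok.
have C1 : vr s1 vC2 = #|S| by rewrite ev_vr.
have P1 : vr s1 vPs2 = psi E S by rewrite ev_vr.
by split=> //=.
Qed.

Lemma ctxp_true (S : {set V}) a s : ctxp a p s -> trk s tS2 S -> feasb E p S -> P S ->
  ctxp true p (ev evalc s).
Proof.
move=> Hs HS HF PS; have [[H1 H2 H3 H4 [H5 H6 H7]] H8] := Hs.
have [[K1 K2 K3 K4 [K5 K6 K7]] K8] := ctxp_evalc pn Hs.
have [_ _ EA] := evalc_ok H1 HS H8 pn.
split=> //; split=> //; split=> // _.
by rewrite EA HF H5 (leq_trans _ Tk) ?leq_add2r ?P_card // orbT.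
Qed.

(** The set is replaced only by one with equal cardinality and smaller potential, to which [P_shall]
    applies; if it is kept, [b] was no improving shift. *)
Lemma innerc_step (S b : {set V}) a s : b \subset Y -> ctxp a p s -> trk s tG5 b -> cur S s ->
  ctxp true p (ev innerc s) \/
  ctxp a p (ev innerc s) /\ exists2 S', cur S' (ev innerc s) &
    (psi E S' < psi E S) || (S' == S) && ~~ ((#|shall E Y b S| == #|S|) && (psi E (shall E Y b S) < psi E S)).
Proof.
move=> bY Hs Hb HC; have [C1 PS nF C2 C3] := HC; have [[B1 Y1 _ _ _] _] := Hs.
rewrite /innerc 2!evS; set s1 := ev shallc s; set s2 := ev evalc s1.
set S2 := shall E Y b S.
have H1 : ctxp a p s1 by apply: ctxp_ev.
have T1 : trk s1 tS2 S2 by apply: shallc_ok.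
have HC1 : cur S s1 by apply: cur_frame HC => [v Hv|]; rewrite ?ev_tr //; move: Hv; rewrite !inE => /orP[] /eqP ->; rewrite ev_vr.
have H2 : ctxp a p s2 by apply: ctxp_evalc.
have HC2 : cur S s2 by apply: cur_frame HC1 => [v Hv|]; rewrite ?ev_tr //; move: Hv; rewrite !inE => /orP[] /eqP ->; rewrite ev_vr.
have T2 : trk s2 tS2 S2 by move=> v; rewrite ev_tr.
have [[B2 _ _ _ [K2 _ _]] P2] := H1.
have [E1 E2 _] := evalc_ok B2 T1 P2 pn.
have [_ _ _ D1 D2] := HC2.
rewrite evI [opst (Eq _ _) _]/= [opres _ _]/= E1 D1 -/s2.
case: (#|S2| =P #|S|) => [EC|_]; last by right; split=> //; exists S => //; rewrite eqxx orbT.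
rewrite evI [opst (Lt _ _) _]/= [opres _ _]/= E2 D2; case: (ltnP (psi E S2) (psi E S)) => Hpsi; last first.
  by right; split=> //; exists S => //; rewrite eqxx orbT.
have PS2 : P S2 by apply: P_shall.
case: (boolP (feasb E p S2)) => HF.
  by left; apply: ctxp_ev => //; apply: (@ctxp_true S2 a s1).
right; split; first exact: ctxp_ev.
exists S2; last by rewrite Hpsi.
by apply: take2_cur => //; rewrite ev_vr //; case: B2.
Qed.

(** Improvements are adopted at once, so the set may change during a pass. If it has not changed
    before the round [i0] of the subset given by [P_improve], that round improves it. *)
Lemma passc_step r s : level r s -> level r.+1 (ev (enumc tG5 vE5 innerc) s).
Proof.
case=> [H|[[a Ha] [S HC Hr]]]; first by left; apply: passc_sound.
have [C1 PS nF C2 C3] := HC; have [[[s0 sN _] HY HW _ _] _] := Ha.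
have [b [bY Eb Pb]] : exists b : {set V}, [/\ b \subset Y, #|shall E Y b S| = #|S| & psi E (shall E Y b S) < psi E S].
  by case: (P_improve PS) => // /feasP HF; rewrite HF in nF.
have [i0 Hi0 Ei0] := sub_surj bY.
pose I i s' := ctxp true p s' \/ ctxp a p s' /\
  exists2 S', cur S' s' & (psi E S' < psi E S) || (S' == S) && (i <= i0).
have : I (2 ^ #|Y|) (ev (enumc tG5 vE5 innerc) s).
  apply: (enum_rule (I := I)) => //.
  - move=> i s1 s2 F1 F2 [H|[H [S' HS' H']]]; [left|right; split; last exists S'] => //.
    + by apply: ctxp_frame H => [v|t]; rewrite !inE => Hv; [apply: F1|apply: F2];
       move: Hv; do 5?[case/orP]; move/eqP => ->.
    + by apply: ctxp_frame H => [v|t]; rewrite !inE => Hv; [apply: F1|apply: F2];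
       move: Hv; do 5?[case/orP]; move/eqP => ->.
    + by apply: cur_frame HS' => [v|]; rewrite ?F2 // !inE => Hv; apply: F1; move: Hv; case/orP => /eqP ->.
  - by right; split=> //; exists S => //; rewrite eqxx orbT.
  move=> i s' Hi Hg _ [H|[H [S' HS' H']]]; first by left; apply: innerc_sound.
  have [H1|[H1 [S'' HC'' HS'']]] := innerc_step (sub_sub Y i) H Hg HS'; first by left.
  right; split=> //; exists S'' => //.
  case/orP: H' => [H'|/andP[/eqP ES Hii]].
    by case/orP: HS'' => [H2|/andP[/eqP -> _]]; rewrite ?H' // (ltn_trans H2 H').
  case/orP: HS'' => [|/andP[/eqP -> H3]]; first by rewrite ES => ->.
  rewrite ES eqxx /= (ltn_neqAle i) Hii andbT orbC; apply/orP; left; apply/eqP => Ei.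
  by move: H3; rewrite ES Ei Ei0 Eb eqxx Pb.
case=> [H|[H [S' HS' H']]]; first by left.
right; split; first by exists a.
exists S' => //; case/orP: H' => [H'|/andP[_ H']]; last by rewrite leqNgt Hi0 in H'.
by rewrite addnS; apply: leq_trans Hr; rewrite ltn_add2r.
Qed.

Lemma bodyc_complete (G1 G2 G3 G4 : {set V}) a s : P (sinit E Y p G1 G2 G3 G4) ->
  ctxp a p s -> trks s [:: (tG4, G4); (tG3, G3); (tG2, G2); (tG1, G1)] ->
  ctxp true p (ev bodyc s).
Proof.
set S := sinit _ _ _ _ _ _ _ => PS Hs HG; rewrite /bodyc 3!evS -/innerc.
have [[B0 Y0 _ _ _] P0] := Hs.
set s1 := ev initc s; set s2 := ev evalc s1.
have T1 : trk s1 tS2 S.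
  apply: initc_ok => //; [apply: (HG (_, _))|apply: (HG (_, _))|apply: (HG (_, _))|apply: (HG (_, _))];
  by rewrite !inE eqxx ?orbT.
have H1 : ctxp a p s1 by apply: ctxp_ev.
have [[B1 _ _ _ [K1 _ _]] P1] := H1.
have [E1 E2 _] := evalc_ok B1 T1 P1 pn.
have H2 : ctxp a p s2 by apply: ctxp_evalc.
have L0 : level 0 (ev take2 s2).
  case: (boolP (feasb E p S)) => HF.
    by left; apply: ctxp_ev => //; apply: (@ctxp_true S a s1).
  right; split; first by exists a; apply: ctxp_ev.
  exists S; last by rewrite addn0 psi_le.
  apply: take2_cur => //; first by rewrite ev_vr //; case: B1.
  by move=> v; rewrite ev_tr.
have EN : vr (ev take2 s2) vNN = (n * n).+1.
  by rewrite ev_vr //; case: H2 => -[].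
have : level (n * n).+1 (ev (For vR vNN (enumc tG5 vE5 innerc)) (ev take2 s2)).
  rewrite -[in X in level X]EN; apply: for_rule; first by [].
    case: L0 => [H|[[b Hb] [S' HS' HP]]]; first by left; apply: ctxp_setv.
    by right; split; [exists b; apply: ctxp_setv|exists S' => //; apply: cur_frame HS' => // v; rewrite !inE => /orP[] /eqP ->].
  move=> j s' _ _ _ _ /passc_step [H|[[b Hb] [S' HS' HP]]]; first by left; apply: ctxp_inc.
  by right; split; [exists b; apply: ctxp_inc|exists S' => //; apply: cur_frame HS' => // v; rewrite !inE => /orP[] /eqP ->].
by case=> // -[_ [S' _ HP]]; move: HP; rewrite addnS ltnNge leq_addl.
Qed.

End Complete.

Definition guessc : cmd :=
  enumc tG1 vE1 (enumc tG2 vE2 (enumc tG3 vE3 (enumc tG4 vE4 bodyc))).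

Lemma guess4_sound p : p <= n -> forall a s, ctxp a p s -> ctxp a p (ev (enumc tG4 vE4 bodyc) s).
Proof. by move=> pn; apply: enum_sound => // a s; apply: bodyc_sound. Qed.

Lemma guess3_sound p : p <= n ->
  forall a s, ctxp a p s -> ctxp a p (ev (enumc tG3 vE3 (enumc tG4 vE4 bodyc)) s).
Proof. by move=> pn; apply: enum_sound => //; apply: guess4_sound. Qed.

Lemma guess2_sound p : p <= n ->
  forall a s, ctxp a p s -> ctxp a p (ev (enumc tG2 vE2 (enumc tG3 vE3 (enumc tG4 vE4 bodyc))) s).
Proof. by move=> pn; apply: enum_sound => //; apply: guess3_sound. Qed.

Lemma guessc_sound p : p <= n -> forall a s, ctxp a p s -> ctxp a p (ev guessc s).
Proof. by move=> pn; apply: enum_sound => //; apply: guess2_sound. Qed.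

Lemma guessc_complete p (T : {set V}) : p <= n -> feasible E p T -> #|T| + p <= k ->
  forall a s, ctxp a p s -> ctxp true p (ev guessc s).
Proof.
move=> pn HT Tk a s Hs.
have [G1 [G2 [G3 [G4 [P [[Y1 Y2 Y3 Y4] P0 Pc Pi Ps]]]]]] :=
  search_complete simpleE deg2 one_port x0Y connE HT.
have HB b s' := @bodyc_complete p T P pn Tk Pc Pi Ps G1 G2 G3 G4 b s' P0.
have H4 := enum_compl (L := [:: (tG3, G3); (tG2, G2); (tG1, G1)])
  (isT : oke tG4 vE4 bodyc) isT isT Y4 isT (fun a s => @bodyc_sound a p s pn) HB.
have H3 := enum_compl (L := [:: (tG2, G2); (tG1, G1)])
  (isT : oke tG3 vE3 (enumc tG4 vE4 bodyc)) isT isT Y3 isT (guess4_sound pn) H4.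
have H2 := enum_compl (L := [:: (tG1, G1)])
  (isT : oke tG2 vE2 (enumc tG3 vE3 (enumc tG4 vE4 bodyc))) isT isT Y2 isT (guess3_sound pn) H3.
have H1 := enum_compl (L := [::])
  (isT : oke tG1 vE1 (enumc tG2 vE2 (enumc tG3 vE3 (enumc tG4 vE4 bodyc)))) isT isT Y1 isT (guess2_sound pn) H2.
by apply: (H1 a s).
Qed.

Lemma searchc_ok s : ctx false s ->
  (tr (ev searchc s) tANS 0 -> good) /\
  forall p (T : {set V}), p < n -> feasible E p T -> #|T| + p <= k -> tr (ev searchc s) tANS 0.
Proof.
move=> Hs; have [B0 _ _ _ _] := Hs.
have sN : vr s vN = n by case: B0.
have cs v x a s' : v \notin [:: 0; vN; vW; vNN; vK] -> ctx a s' -> ctx a (setv s' v x).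
  move=> Hv; apply: ctx_frame => // w Hw /=; case: eqP => // Ew.
  by rewrite -Ew Hw in Hv.
have ci v a s' : v \notin [:: 0; vN; vW; vNN; vK] -> ctx a s' -> ctx a (opst (Inc v) s').
  exact: cs.
have sound a s' : ctx a s' -> ctx a (ev searchc s').
  move=> Hs'; rewrite /searchc -/guessc; have [[_ N' _] _ _ _ _] := Hs'.
  apply: (for_rule (P := fun _ s => ctx a s)); [by []|by apply: cs|].
  move=> j s1 Hj Ej _ _ H1; apply: ci => //.
  have jn : j <= n by apply: ltnW; rewrite -N'.
  by have [] := guessc_sound jn (conj H1 Ej).
split; first by have [_ _ _ _ []] := sound _ _ Hs.
move=> p T pn HT Tk.
(* The answer must be raised in the round of [p] and stay raised afterwards. *)
pose P j s' := ctx (p < j) s'.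
suff : P (vr s vN) (ev searchc s).
  by rewrite sN /P pn => -[_ _ _ _ [_ _ ->]].
rewrite /searchc -/guessc; apply: for_rule; [by []|by apply: cs|].
move=> j s1 Hj Ej _ _ H1; rewrite /P.
have jn : j <= n by apply: ltnW; rewrite -sN.
apply: ci => //.
have [Ep|Np] := eqVneq j p; last first.
  have -> : (p < j.+1) = (p < j) by rewrite ltnS leq_eqVlt eq_sym (negbTE Np).
  by have [] := guessc_sound jn (conj H1 Ej).
have -> : (p < j.+1) = true by rewrite Ep ltnSn.
rewrite Ep in Ej H1.
by case: (guessc_complete (ltnW pn) HT Tk (conj H1 Ej)).
Qed.

End Search.

End Search.

(** * Reading the input and computing the core *)

Module Loading.
Import Machine Simulation Language Threads Families Core Programs Counting Evaluation.

Fixpoint val2 (l : seq bool) : nat := if l is b :: l' then b + 2 * val2 l' else 0.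

Lemma bits_fuelP f k : k <= f ->
  val2 (bits_fuel f k) = k /\ (0 < k -> 2 ^ size (bits_fuel f k) <= 2 * k).
Proof.
elim: f k => [|f IH] k kf /=; first by rewrite (eqP (_ : k == 0)) // -leqn0.
case: (k =P 0) => [-> //|/eqP k0] /=.
have Ek := odd_double_half k; rewrite -mul2n in Ek.
have [] := IH k./2; first by move: Ek kf k0; case: (odd k) => /=; lia.
move=> -> H; split=> // _; rewrite expnS leq_mul2l /=.
case: (posnP k./2) => [Ek0|/H]; last by move: Ek; case: (odd k) => /=; lia.
by rewrite Ek0 (_ : bits_fuel f 0 = [::]) //=; [lia|case: (f)].
Qed.

Lemma val2_bin k : val2 (Defs.bin k) = k.
Proof. by have [] := bits_fuelP (leqnn k). Qed.

(** The top bit of a positive number is set, so n + 1 bits give n <= 2 ^ n <= k. Bits beyond the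
    first n therefore settle that the minimum of k and n is n. *)
Lemma size_bin k n : n < size (Defs.bin k) -> n <= k.
Proof.
move=> Hn; case: (posnP k) => [Ek|k0]; first by rewrite Ek in Hn.
have [_ /(_ k0)] := bits_fuelP (leqnn k); rewrite -/(Defs.bin k) => H.
have : 2 ^ n.+1 <= 2 * k by apply: leq_trans H; rewrite leq_exp2l.
by rewrite expnS leq_mul2l /=; apply: leq_trans; apply: ltnW; apply: ltn_expl.
Qed.

Lemma val2_neg l : val2 (map negb l) + val2 l + 1 = 2 ^ size l.
Proof. by elim: l => //= b l IH; rewrite expnS; case: b => /=; lia. Qed.

Lemma val2_pad l m : size l <= m -> val2 (mkseq (nth false l) m) = val2 l.
Proof.
elim: l m => [|b l IH] m /=.
  move=> _; have -> : mkseq (nth false [::]) m = nseq m false.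
    apply: (@eq_from_nth _ false) => [|i]; rewrite size_mkseq ?size_nseq // => Hi.
    by rewrite nth_mkseq // nth_nseq Hi nth_nil.
  by elim: m => //= m ->.
case: m => // m Hm; rewrite /mkseq /= -[1]addn0 iotaDl -map_comp.
by rewrite -(IH m).
Qed.

Definition pr (l : seq bool) : bool * seq bool := (head false l, behead l).

Lemma adv_pr s l : inp s = pr l -> inp (opst Adv s) = pr (behead l).
Proof. by move=> /= ->; case: l => [|b [|c l]]. Qed.

Lemma ones_ok v s m l : inp s = pr (nseq m true ++ false :: l) ->
  let s' := ev (Ones v) s in
  [/\ vr s' v = vr s v + m, inp s' = pr (false :: l) & tr s' = tr s].
Proof.
move=> Hs; rewrite /= (_ : ones _ = m); last first.
  have F : find negb (nseq m true ++ false :: l) = m by elim: m {Hs} => //= m ->.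
  by rewrite Hs -[RHS]F /ones; case: (m).
elim: m s Hs => [|m IH] s Hs; first by rewrite addn0.
rewrite iterSr; have [|-> -> ->] := IH (opst (Inc v) (opst Adv s)).
  by rewrite -[inp _]/(inp (opst Adv s)) (adv_pr Hs).
by rewrite /= eqxx addnS.
Qed.

Definition bitM : cmd :=
  If Cur (Do (Put tM vPt true)) Skip ;; If Adv (Do (Put tE 0 true)) Skip ;; Do (Inc vPt).

Definition readM : cmd := For vA vN (For vB vN bitM).

(* The bits of [k] are stored complemented, so that incrementing this counter until it
   overflows counts up to [k]. *)
Definition bitK : cmd :=
  If (Get tE 0) (Do (Put tKB vI true))
    (If Cur Skip (Do (Put tKB vI true)) ;; If Adv (Do (Put tE 0 true)) Skip).

Definition readK : cmd := For vI vN bitK.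

(** The complemented bits have value 2 ^ n - 1 - k and overflow in step k + 1; [vK] counts the steps
    before, so n steps leave the minimum of k and n in it. *)
Definition stepK : cmd :=
  inc tKB tO ;; When (Get tC 0) (Do (Put tF 0 true)) ;; If (Get tF 0) Skip (Do (Inc vK)).

Definition countK : cmd :=
  For vI vN (Do (Put tO vI true)) ;; For vA vN stepK.

(** [vN] starts at 1 because the home cell holds the first bit of the unary n. [tE] reports the end
    of the input; if it is not reached after n bits of k, then k >= n. *)
Definition loadc : cmd :=
  Do (Inc vN) ;; Ones vN ;; Do Adv ;; readM ;; Do (Cpy vNN vPt) ;; Do (Inc vNN) ;;
  readK ;; If (Get tE 0) countK (Do (Cpy vK vN)).

Section Load.
Variables (n : nat) (L B : seq bool).
Hypothesis szL : size L = n * n.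

Definition QM j (s : st) : Prop :=
  [/\ vr s vPt = j, inp s = pr (drop j (L ++ B)), tr s tE 0 = (size (L ++ B) <= j),
   (forall i, tr s tM i = (i < j) && nth false L i) & vr s 0 = 0].

Lemma bitM_step j s : j < n * n -> QM j s -> QM j.+1 (ev bitM s).
Proof.
move=> Hj [H1 H2 H3 H4 H5].
have jL : j < size (L ++ B) by rewrite size_cat szL ltn_addr.
have Ed : drop j (L ++ B) = nth false L j :: drop j.+1 (L ++ B).
  by rewrite (drop_nth false) // nth_cat szL Hj.
have I1 : (inp s).1 = nth false L j by rewrite H2 Ed.
have I2 : nilp (inp s).2 = (size (L ++ B) <= j.+1).
  by rewrite H2 Ed /= /nilp size_drop subn_eq0.
have I3 s' : inp s' = inp s -> inp (opst Adv s') = pr (drop j.+1 (L ++ B)).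
  by move=> E; rewrite (@adv_pr _ (drop j (L ++ B))) ?E // Ed.
have jL' : (size (L ++ B) <= j) = false by rewrite leqNgt jL.
rewrite /bitM 2!evS (evI Cur) [opst Cur _]/= [opres _ _]/= I1.
set s1 := (if _ then _ else _).
have [E1 E2 E3 E4] : [/\ vr s1 = vr s, inp s1 = inp s, tr s1 tE = tr s tE &
   forall i, tr s1 tM i = (i < j.+1) && nth false L i].
  rewrite /s1; case Eb : (nth false L j); split=> //= i; rewrite ltnS leq_eqVlt ?H1 H4.
    by case: (i =P j) => [->|_ /=]; rewrite ?Eb.
  by case: (i =P j) => [->|_ /=]; rewrite ?Eb ?andbF.
rewrite (evI Adv) [opres _ _]/= E2 I2; set s2 := (if _ then _ else _).
have [F1 F2 F3 F4] : [/\ vr s2 = vr s, inp s2 = pr (drop j.+1 (L ++ B)),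
   tr s2 tE 0 = (size (L ++ B) <= j.+1) & tr s2 tM = tr s1 tM].
  rewrite /s2; case: leqP => Hle; split=> //=; rewrite ?E1 ?H5 ?eqxx //.
  - exact: I3.
  - exact: I3.
  - by rewrite E3 H3 jL'.
split=> //=; rewrite ?F1 ?H1 ?H5 //.
by move=> i; rewrite F4 E4.
Qed.

Lemma readM_ok s : vr s vN = n -> QM 0 s -> QM (n * n) (ev readM s).
Proof.
move=> sN Q0; rewrite /readM.
have QV s' v x j : v \in [:: vA; vB] -> QM j s' -> QM j (setv s' v x).
  by rewrite !inE => /orP[] /eqP -> [H1 H2 H3 H4 H5].
have QI s' v j : v \in [:: vA; vB] -> QM j s' -> QM j (opst (Inc v) s') by apply: QV.
rewrite -[X in QM X _]/(n * n) -{1}sN.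
apply: (for_rule (P := fun j => QM (j * n))); [by []|exact: (QV)|].
move=> j s' Hj Ej F1 F2 Qj; apply: (QI) => //.
have N' : vr s' vN = n by rewrite F1.
rewrite mulSn addnC -{2}N'.
apply: (for_rule (P := fun i => QM (j * n + i))); [by []|by rewrite addn0; apply: (QV)|].
move=> i s2 Hi Ei G1 G2 Qi; apply: (QI) => //; rewrite addnS; apply: bitM_step => //.
rewrite N' in Hi; rewrite sN in Hj.
by apply: leq_trans (_ : j.+1 * n <= _); [rewrite mulSn addnC ltn_add2r|rewrite leq_mul2r Hj orbT].
Qed.

Definition QK j (s : st) : Prop :=
  [/\ inp s = pr (drop j B), tr s tE 0 = (size B <= j),
   forall i, tr s tKB i = (i < j) && ~~ nth false B i & vr s 0 = 0].

Lemma bitK_step j s : vr s vI = j -> QK j s -> QK j.+1 (ev bitK s).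
Proof.
move=> Ej [H1 H2 H3 H4]; rewrite /bitK evI [opst (Get _ _) _]/= [opres _ _]/= H4 H2.
case: leqP => Hj.
  split=> //=.
  - by rewrite H1 !drop_oversize // (leq_trans Hj).
  - by rewrite H2 Hj (leqW Hj).
  - move=> i; rewrite Ej; case: eqP => [->|/eqP ij]; first by rewrite ltnSn nth_default.
    by rewrite H3 ltnS [in RHS]leq_eqVlt (negbTE ij).
have Ed : drop j B = nth false B j :: drop j.+1 B by rewrite (drop_nth false).
have I1 : (inp s).1 = nth false B j by rewrite H1 Ed.
have I2 : nilp (inp s).2 = (size B <= j.+1) by rewrite H1 Ed /= /nilp size_drop subn_eq0.
have I3 s' : inp s' = inp s -> inp (opst Adv s') = pr (drop j.+1 B).
  by move=> E; rewrite (@adv_pr _ (drop j B)) ?E // Ed.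
rewrite evS (evI Cur) [opst Cur _]/= [opres _ _]/= I1.
set s1 := (if _ then _ else _).
have [E1 E2 E3 E4] : [/\ vr s1 = vr s, inp s1 = inp s, tr s1 tE = tr s tE &
   forall i, tr s1 tKB i = (i < j.+1) && ~~ nth false B i].
  rewrite /s1; case Eb : (nth false B j); split=> //= i; rewrite ltnS leq_eqVlt ?Ej H3.
    by case: (i =P j) => [->|_ /=]; rewrite ?Eb ?andbF.
  by case: (i =P j) => [->|_ /=]; rewrite ?Eb.
rewrite (evI Adv) [opres _ _]/= E2 I2; case: leqP => Hle; split=> //=; rewrite ?E1 ?H4 ?eqxx //.
- exact: I3.
- exact: I3.
- by rewrite E3 H2 leqNgt Hj leqNgt Hle.
Qed.

Lemma readK_ok s : vr s vN = n -> QK 0 s -> QK n (ev readK s).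
Proof.
move=> sN Q0; rewrite /readK -sN; apply: (for_rule (P := QK)); [by []|by case: Q0|].
by move=> j s' Hj Ej _ _ /(bitK_step Ej) [].
Qed.

End Load.

(** After [j <= val2 l] rounds the counter is its initial value plus [j]; [tF] is set exactly when
    [j] exceeds [val2 l]. *)
Lemma countK_ok n s (l : seq bool) : vr s 0 = 0 -> vr s vN = n -> vr s vK = 0 -> tr s tF 0 = false ->
  size l = n -> (forall i : 'I_n, tr s tKB i = ~~ nth false l i) ->
  vr (ev countK s) vK = minn (val2 l) n.
Proof.
move=> s0 sN sK sF szl Hl; rewrite /countK evS; set s1 := ev _ s.
have O1 : trk s1 tO [set: 'I_n].
  pose P (done : seq 'I_n) s' := forall v : 'I_n, v \in done -> tr s' tO v.
  suff H : P (enum 'I_n) s1 by move=> v; rewrite inE; apply: H; rewrite mem_enum.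
  apply: (for_ord (P := P)) => //.
  move=> done v s' _ _ Ei F1 F2 IH w; rewrite mem_rcons in_cons /= Ei (inj_eq val_inj).
  by case: eqP => //= _ /IH.
pose G0 : {set 'I_n} := [set v : 'I_n | ~~ nth false l v].
have T1 : trk s1 tKB G0 by move=> v; rewrite inE ev_tr.
pose W (S : {set 'I_n}) := valL (elts [set: 'I_n]) S.
have WE : W G0 = 2 ^ n - 1 - val2 l.
  have El : elts [set: 'I_n] = enum 'I_n.
    by apply/all_filterP/allP => v _; rewrite inE.
  have VL (t : seq 'I_n) : valL t G0 = val2 [seq ~~ nth false l (nat_of_ord v) | v <- t].
    by elim: t => //= v t ->; rewrite inE.
  have := val2_neg l; rewrite szl => <-; rewrite /W El VL.
  have -> : [seq ~~ nth false l (nat_of_ord v) | v <- enum 'I_n] = map negb l.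
    by rewrite -[in RHS](mkseq_nth false l) szl /mkseq -val_enum_ord -!map_comp.
  by lia.
have Vl : val2 l < 2 ^ n by have := val2_neg l; rewrite szl; lia.
pose Q j s' := [/\ vr s' 0 = 0, trk s' tO [set: 'I_n], vr s' vK = minn (val2 l) j,
  tr s' tF 0 = (val2 l < j) & j <= val2 l -> exists2 G : {set 'I_n}, trk s' tKB G & W G = W G0 + j].
have N1 : vr s1 vN = n by rewrite ev_vr.
suff [] : Q (vr s1 vN) (ev (For vA vN stepK) s1) by rewrite N1.
apply: for_rule; [by []| |].
  have V1 v : v != vI -> vr s1 v = vr s v by move=> vI'; rewrite ev_vr // mem_seq1.
  split=> //; first by rewrite /= V1.
  - by rewrite minn0 /= V1.
  - by rewrite [tr _ _]/= ev_tr // sF ltn0.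
  - by move=> _; exists G0; rewrite ?addn0.
move=> j s' Hj Ej F1 F2 [R1 R2 R3 R4 R5]; rewrite /stepK 2!evS.
set s2 := ev (inc _ _) s'.
have N' : vr s' vN = n by rewrite F1.
have s'20 : vr s2 0 = 0 by rewrite ev_vr.
have K2 : vr s2 vK = vr s' vK by rewrite ev_vr.
have F2' : tr s2 tF 0 = (val2 l < j) by rewrite ev_tr.
have [I1 I2] := inc_ok (g := tKB) (mask := tO) R1 N' isT (trk_tset (n := n) s' tKB) R2.
have O2 : trk s2 tO [set: 'I_n] by move=> v; rewrite ev_tr.
set s3 := ev (When _ _) s2.
have [V3 T3 F3] : [/\ vr s3 = vr s2, (forall t, t != tF -> tr s3 t = tr s2 t) &
    tr s3 tF 0 = (val2 l < j.+1) ].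
  have EF : tr s2 tC 0 || (val2 l < j) = (val2 l < j.+1).
    rewrite I2 ltnS; case: (ltnP (val2 l) j) => Hv; first by rewrite orbT (ltnW Hv).
    rewrite orbF; have [G TG WG] := R5 Hv.
    have EG : tset n s' tKB = G by apply/setP => v; rewrite inE TG.
    have := incS_val [set: 'I_n] G; rewrite cardsT card_ord -/(W G) WG WE -EG.
    have : W (incS [set: 'I_n] (tset n s' tKB)) < 2 ^ n.
      by have := valL_lt (elts [set: 'I_n]) (incS [set: 'I_n] (tset n s' tKB)); rewrite size_elts cardsT card_ord.
    rewrite /W; move: (valL _ _) (ovf _ _) (val2 l) (2 ^ n) Hv Vl => w b x y.
    by case: b => /= *; apply/esym; [lia|apply/negbTE; lia].
  rewrite /s3 evI [opst (Get _ _) _]/= [opres _ _]/= s'20; move: EF; case: (tr s2 tC 0) => EF.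
    by split=> [//|t tF' /=|]; rewrite /= ?s'20 -?EF // (negbTE tF').
  by split=> //=; rewrite F2' -EF.
have R5' : j.+1 <= val2 l -> exists2 G : {set 'I_n}, trk s3 tKB G & W G = W G0 + j.+1.
  move=> Hv; have [G TG WG] := R5 (ltnW Hv).
  have EG : tset n s' tKB = G by apply/setP => v; rewrite inE TG.
  exists (incS [set: 'I_n] G); first by move=> v; rewrite T3 // I1 EG.
  have := incS_val [set: 'I_n] G; rewrite cardsT card_ord -/(W G) WG WE -/(W _).
  move: (W _) (ovf _ _) (val2 l) (2 ^ n) Hv Vl => w b x y.
  by case: b => /= *; lia.
rewrite evI [opst (Get _ _) _]/= [opres _ _]/= V3 s'20 F3.
have O3 : trk s3 tO [set: 'I_n] by move=> v; rewrite T3.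
case: (ltnP (val2 l) j.+1) => Hv; split=> //=; rewrite ?V3 ?K2 ?R3 ?F3 //; try lia.
Qed.

Section Setup.
Variables (n : nat) (E : {set {set 'I_n}}).
Notation V := 'I_n.
Notation adj := (adj E).
Notation base := (base E).

(** Degrees are counted in unary on three tracks and saturate at 3, enough to tell whether a degree
    is 2. *)
Definition degc : cmd :=
  edges (If (Get tD2 vA) (Do (Put tD3 vA true))
    (If (Get tD1 vA) (Do (Put tD2 vA true)) (Do (Put tD1 vA true)))).

Definition specc : cmd :=
  For vI vN (If (Get tD2 vI) (If (Get tD3 vI) (Do (Put tX vI true)) Skip) (Do (Put tX vI true))) ;;
  Do (Put tX 0 true).

Definition corec : cmd :=
  copyt tX tY ;; edges (When (Get tX vA) (Do (Put tY vB true))).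

Definition powc : cmd :=
  Do (Inc vW) ;;
  For vI vN (When (Get tY vI) (Do (Cpy vQ vW) ;; For vJ vQ (Do (Inc vW)))).

Definition setupc : cmd := degc ;; specc ;; corec ;; powc.

Definition thr3 (c : nat) (s : st) (a : nat) : Prop :=
  [/\ tr s tD1 a = (0 < c), tr s tD2 a = (1 < c) & tr s tD3 a = (2 < c)].

Lemma count_pairs (a : V) : count (fun ab => (ab.1 == a) && adj ab.1 ab.2) (pairs n) = #|nb E a|.
Proof.
pose f := fun ab : V * V => (ab.1 == a) && adj ab.1 ab.2.
have H (l : seq V) : uniq l ->
    count f [seq (x, y) | x <- l, y <- enum V] = if a \in l then #|nb E a| else 0.
  elim: l => //= x l IH /andP[xl Ul].
  rewrite count_cat IH // inE (eq_sym a) count_map.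
  case: (x =P a) => [xa|xa] /=.
    rewrite -xa (negbTE xl) addn0 /nb cardsE cardE size_filter -enumT.
    by apply: eq_count => y; rewrite /f /= -xa eqxx.
  rewrite (eq_count (a2 := pred0)) ?count_pred0 // => y; rewrite /f /=.
  by case: eqP.
by rewrite [LHS]H ?enum_uniq // mem_enum.
Qed.

Lemma degc_ok s : base s -> (forall t i, t \in [:: tD1; tD2; tD3] -> tr s t i = false) ->
  forall a : V, thr3 #|nb E a| (ev degc s) a.
Proof.
move=> Bs H0 a; rewrite -count_pairs; move: a.
pose f a := fun ab : V * V => (ab.1 == a) && adj ab.1 ab.2.
pose P (done : seq (V * V)) s' := forall a : V, thr3 (count (f a) done) s' a.
apply: (edges_rule (E := E) (P := P)) => //.
- by move=> done s' v x _ IH a; have [] := IH a.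
- by move=> a; split; rewrite H0.
- move=> done a b s' ab Ea Eb B' F1 F2 IH c.
  rewrite -cats1 count_cat /= addn0 /f /= ab andbT.
  have [D1 D2 D3] := IH a.
  have [ac|ac] := eqVneq a c; last first.
    rewrite addn0; have := IH c; have Nc : (nat_of_ord c == a) = false by rewrite eq_sym; apply/negbTE.
    rewrite /thr3 => -[C1 C2 C3]; rewrite Ea.
    by case: (tr s' tD2 a) => /=; [|case: (tr s' tD1 a)]; rewrite /= ?Ea ?Nc ?andbF.
  rewrite -ac addn1 /thr3 Ea D1 D2.
  move: D1 D2 D3; rewrite -/(f a); case: (count (f a) done) => [|[|c']] /= D1 D2 D3;
    by rewrite /= ?Ea ?eqxx ?D1 ?D2 ?D3.
- by move=> done a b s' /negbTE ab IH c; rewrite -cats1 count_cat /= /f /= ab andbF !addn0; apply: IH.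
Qed.

Lemma specc_ok s (x0 : V) : base s -> nat_of_ord x0 = 0 -> (forall a : V, thr3 #|nb E a| s a) ->
  (forall i, tr s tX i = false) -> trk (ev specc s) tX (special E x0).
Proof.
move=> Bs Ex HD HX; rewrite /specc evS; set c1 := For _ _ _; set s1 := ev c1 s.
have N : vr s vN = n by case: Bs.
pose P (done : seq V) s' := forall v : V, tr s' tX v = (v \in done) && (#|nb E v| != 2).
have P1 : P (enum V) s1.
  apply: (for_ord (P := P)) => //; first by move=> v /=; rewrite HX.
  move=> done v s' vd _ Ei F1 F2 IH w.
  have [D1 D2 D3] := HD v.
  rewrite mem_rcons in_cons !evI [opst (Get _ _) _]/= [opres _ _]/= [opst (Get _ _) _]/= [opres (Get _ _) _]/= Ei.
  rewrite !F2 // D2 D3.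
  have [->|wv] := eqVneq w v; last first.
    have Nw : (nat_of_ord w == v) = false by apply/negbTE.
    by rewrite /= -IH; case: (1 < _); [case: (2 < _)|]; rewrite /= ?Ei ?Nw.
  have IHv : tr s' tX v = false by rewrite IH (negbTE vd).
  by case: #|nb E v| => [|[|[|c]]] /=; rewrite /= ?Ei ?eqxx ?IHv.
move=> v; rewrite inE /= (_ : vr s1 0 = 0); last by rewrite ev_vr //; case: Bs.
rewrite P1 mem_enum /= -Ex (inj_eq val_inj).
by case: (v == x0); rewrite ?orbT ?orbF.
Qed.

Lemma corec_ok s (x0 : V) : base s -> trk s tX (special E x0) ->
  trk (ev corec s) tY (core E x0).
Proof.
move=> Bs HX; rewrite /corec evS; set s1 := ev (copyt _ _) s.
have B1 : base s1 by apply: base_ev.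
have N : vr s vN = n by case: Bs.
have Y1 : trk s1 tY (special E x0) by apply: copyt_ok.
pose P (done : seq (V * V)) s' := forall v : V, tr s' tY v =
  (v \in special E x0) || has (fun ab => [&& ab.1 \in special E x0, adj ab.1 ab.2 & ab.2 == v]) done.
set c := edges _.
have PP : P (pairs n) (ev c s1).
  apply: (edges_rule (E := E) (P := P)) => //.
  - by move=> done s' v x _ IH w; have := IH w.
  - by move=> v; rewrite Y1 orbF.
  - move=> done a b s' ab Ea Eb B' F1 F2 IH v.
    rewrite evI [opst _ _]/= [opres _ _]/= Ea F2 // ev_tr // HX has_rcons /= ab /=.
    case: (a \in special E x0) => /=; last by rewrite IH.
    by rewrite Eb (inj_eq val_inj) eq_sym; case: (b == v); rewrite ?orbT //= IH.
  - by move=> done a b s' /negbTE ab IH v; rewrite has_rcons /= ab andbF IH.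
move=> v; rewrite PP in_setU inE; congr (_ || _).
apply/hasP/exists_inP => [[[a b] _ /and3P[/= aX ab /eqP <-]]|[u uX uv]]; first by exists a.
by exists (u, v); rewrite /= ?uX ?uv ?eqxx //; apply/allpairsP; exists (u, v); rewrite !mem_enum.
Qed.

Definition powstep : cmd :=
  When (Get tY vI) (Do (Cpy vQ vW) ;; For vJ vQ (Do (Inc vW))).

Lemma powstep_ok (Y : {set V}) j s : j < n -> trk s tY Y -> vr s vI = j ->
  vr s vW = 2 ^ count (mem Y) (take j (enum V)) ->
  vr (ev powstep s) vW = 2 ^ count (mem Y) (take j.+1 (enum V)).
Proof.
move=> Hj HY Ei IH; pose v := Ordinal Hj.
have Ej : nth v (enum V) j = v by apply/val_inj; rewrite /= nth_enum_ord.
rewrite (take_nth v) ?size_enum_ord // Ej -cats1 count_cat [count _ [:: v]]/= addn0.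
rewrite /powstep evI [opst (Get _ _) _]/= [opres _ _]/= Ei (HY v).
case: (v \in Y); last by rewrite addn0.
rewrite addn1 expnS mul2n -addnn -IH evS; set s2 := ev (Do _) s.
have Q2 : vr s2 vQ = vr s vW by [].
rewrite -[in X in _ = X + _]Q2.
apply: (for_rule (P := fun j s' => vr s' vW = j + vr s vW)) => //.
by move=> j' s3 Hj' Ej' _ _ H; rewrite /= H.
Qed.

Section Pow.
Variables (Y : {set V}) (s : st).
Hypotheses (Bs : base s) (HY : trk s tY Y) (W0 : vr s vW = 0).
Let P j s' := vr s' vW = 2 ^ count (mem Y) (take j (enum V)).

Let step j s' : j < vr s vN -> vr s' vI = j ->
  (forall t, t \notin mt powstep -> tr s' t = tr s t) ->
  P j s' -> P j.+1 (opst (Inc vI) (ev powstep s')).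
Proof.
case: Bs => _ -> _ Hj Ej Ft IH; apply: powstep_ok => // v.
by rewrite Ft.
Qed.

Lemma powc_ok : vr (ev powc s) vW = 2 ^ #|Y|.
Proof.
rewrite /powc evS; set s1 := ev (Do _) s.
have sN : vr s1 vN = n by case: Bs.
have : P (vr s1 vN) (ev (For vI vN powstep) s1).
  apply: for_rule => //; first by rewrite /P /= W0 take0.
  by move=> j s' Hj Ej F1 F2; apply: step.
by rewrite /P sN take_oversize ?size_enum_ord // count_card.
Qed.

(** The bound [vQ] of the inner loop is recomputed in each round, so [tm_le] does not apply; the
    invariant [P] keeps it at most 2 ^ #|Y|. *)
Lemma powc_tm : tm powc s <= 3 + n * (3 * 2 ^ #|Y| + 6).
Proof.
rewrite -[tm powc s]/(1 + tm (For vI vN powstep) (ev (Do (Inc vW)) s)); set s1 := ev (Do _) s.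
have sN : vr s1 vN = n by case: Bs.
have := @for_tm (3 * 2 ^ #|Y| + 4) vI vN powstep s1 P isT.
rewrite sN => H; apply: leq_trans (leq_add (leqnn 1) (H _ _ _)) _.
- by rewrite /P /= W0 take0.
- by move=> j s' Hj Ej F1 F2; apply: step => //; case: Bs => _ ->.
- move=> j s' Hj _ HP; have : vr s' vW <= 2 ^ #|Y|.
    rewrite HP leq_exp2l // -count_card -[in X in _ <= X](cat_take_drop j (enum V)) count_cat.
    exact: leq_addr.
  rewrite /= sum_nat_const card_ord; move: (vr s' vW) (2 ^ _) => x y xy.
  by case: ifP => _; lia.
- by rewrite -!addnA.
Qed.

End Pow.

End Setup.

End Loading.

(** * Running times *)

Module Cost.
Import Machine Simulation Language Threads Families Core Completeness Programs Counting Evaluation Moves Search Loading.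

Fixpoint bnds (c : cmd) : seq nat :=
  match c with
  | Do _ | Ones _ => [::]
  | Seq c1 c2 | If _ c1 c2 => bnds c1 ++ bnds c2
  | For _ v c => v :: bnds c
  end.

Fixpoint expo (c : cmd) : nat :=
  match c with
  | Do _ | Ones _ => 0
  | Seq c1 c2 | If _ c1 c2 => (expo c1 + expo c2).+1
  | For _ _ c => (expo c).+2
  end.

Fixpoint noones (c : cmd) : bool :=
  match c with
  | Do _ => true
  | Ones _ => false
  | Seq c1 c2 | If _ c1 c2 => noones c1 && noones c2
  | For _ _ c => noones c
  end.

Definition bounded (c : cmd) : bool := noones c && all (fun v => v \notin mv c) (bnds c).

Lemma pow_sum M a b : 1 + (M + 3) ^ a + (M + 3) ^ b <= (M + 3) ^ (a + b).+1.
Proof.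
rewrite expnS expnD; have := expn_gt0 (M + 3) a; have := expn_gt0 (M + 3) b.
rewrite addn3 /=; move: (_ ^ a) (_ ^ b) => x y y0 x0.
have [z Ez] : exists z, x = z.+1 by exists x.-1; rewrite prednK.
have [w Ew] : exists w, y = w.+1 by exists y.-1; rewrite prednK.
rewrite {}Ez {}Ew !mulSn !mulnS; move: (z * w) (M * _) => p q; lia.
Qed.

(** Loop bounds are never assigned, so each nesting level multiplies the time by about [M], and the
    exponent depends on the program text alone. With [M] about 2 ^ #|Y| times a polynomial in n,
    this is the claimed running time. *)
Lemma tm_le c s M : bounded c -> (forall v, v \in bnds c -> vr s v <= M) ->
  tm c s <= (M + 3) ^ expo c.
Proof.
elim: c s => [o|c1 IH1 c2 IH2|o c1 IH1 c2 IH2|i v c IH|v] s //=.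
- rewrite /bounded /= => /andP[/andP[n1 n2]]; rewrite all_cat => /andP[/allP a1 /allP a2] H.
  have Hc1 : tm c1 s <= (M + 3) ^ expo c1.
    apply: IH1 => [|v Hv]; last by apply: H; rewrite mem_cat Hv.
    by rewrite /bounded n1; apply/allP => v /a1; rewrite mem_cat negb_or => /andP[].
  have Hc2 : tm c2 (ev c1 s) <= (M + 3) ^ expo c2.
    apply: IH2 => [|v Hv]; last first.
      rewrite ev_vr; first by apply: H; rewrite mem_cat Hv orbT.
      by have := a2 v Hv; rewrite mem_cat negb_or => /andP[].
    by rewrite /bounded n2; apply/allP => v /a2; rewrite mem_cat negb_or => /andP[].
  by have := pow_sum M (expo c1) (expo c2); move: Hc1 Hc2; lia.
- rewrite /bounded /= => /andP[/andP[n1 n2]]; rewrite all_cat => /andP[/allP a1 /allP a2] H.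
  have Ho v : v \in bnds c1 ++ bnds c2 -> vr (opst o s) v <= M.
    move=> Hv; rewrite opst_vr; first exact: H.
    by move: Hv; rewrite mem_cat => /orP[/a1|/a2]; rewrite !mem_cat !negb_or => /and3P[].
  have := pow_sum M (expo c1) (expo c2); case: ifP => _ Hp.
    have Hc1 : tm c1 (opst o s) <= (M + 3) ^ expo c1.
      apply: IH1 => [|v Hv]; last by apply: Ho; rewrite mem_cat Hv.
      by rewrite /bounded n1; apply/allP => v /a1; rewrite !mem_cat !negb_or => /and3P[].
    by move: Hc1 Hp; lia.
  have Hc2 : tm c2 (opst o s) <= (M + 3) ^ expo c2.
    apply: IH2 => [|v Hv]; last by apply: Ho; rewrite mem_cat Hv orbT.
    by rewrite /bounded n2; apply/allP => v /a2; rewrite !mem_cat !negb_or => /and3P[].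
  by move: Hc2 Hp; lia.
- rewrite /bounded /= inE negb_or => /andP[nc /andP[/andP[vi vc] /allP ab]] H.
  have Hv : vr s v <= M by apply: H; rewrite mem_head.
  have Hb : all (fun v => v \notin mv c) (bnds c).
    by apply/allP => w /ab; rewrite inE negb_or => /andP[].
  have Hj (j : 'I_(vr s v)) :
      tm c (iter j (fun s => opst (Inc i) (ev c s)) (setv s i 0)) + 2 <= (M + 3) ^ expo c + 2.
    rewrite leq_add2r; apply: IH => [|w Hw]; first by rewrite /bounded nc.
    have /ab := Hw; rewrite inE negb_or => /andP[wi wc].
    suff -> : vr (iter j (fun s => opst (Inc i) (ev c s)) (setv s i 0)) w = vr s w.
      by apply: H; rewrite inE Hw orbT.
    elim: (nat_of_ord j) => [|j' IHj] /=; first by rewrite (negbTE wi).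
    by rewrite (negbTE wi) ev_vr.
  have : \sum_(j < vr s v) (tm c (iter j (fun s => opst (Inc i) (ev c s)) (setv s i 0)) + 2) <=
      \sum_(j < vr s v) ((M + 3) ^ expo c + 2) by apply: leq_sum.
  rewrite sum_nat_const card_ord => Hs.
  rewrite !expnS; have := expn_gt0 (M + 3) (expo c); rewrite addn3 /=; rewrite addn3 in Hs.
  move: (_ ^ _) Hs => x Hs x0.
  have : vr s v * (x + 2) <= M * (x + 2) by rewrite leq_mul2r Hv orbT.
  move: Hs; move: (\sum_(j < _) _) (vr s v * _) => a b ab' bM.
  apply: leq_trans (_ : 2 + M * (x + 2) <= _); first by lia.
  have [z Ez] : exists z, x = z.+1 by exists x.-1; rewrite prednK.
  by rewrite {}Ez !mulSn !mulnDr !mulnS; move: (M * _) => p; lia.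
Qed.

Lemma nth_allpairs (T U : eqType) (f : T -> U -> bool) (l : seq T) (m : seq U) a b i j :
  i < size l -> j < size m ->
  nth false [seq f x y | x <- l, y <- m] (i * size m + j) = f (nth a l i) (nth b m j).
Proof.
move=> + jm; elim: l i => // x l IH [|i] /=; rewrite nth_cat size_map.
  by rewrite mul0n jm => _; rewrite (nth_map b).
by move=> il; rewrite mulSn -addnA ltnNge leq_addr /= addKn IH.
Qed.

Lemma tm_leN c s n M : bounded c -> all (pred1 vN) (bnds c) -> vr s vN = n -> n <= M ->
  tm c s <= (M + 3) ^ expo c.
Proof.
by move=> Hc /allP Hb sN nM; apply: tm_le => // v /Hb /eqP ->; rewrite sN.
Qed.

Definition fullc : cmd :=
  loadc ;; setupc ;; If (Lt vK vN) searchc (Do (Put tANS 0 true)).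

Section Final.
Variables (n : nat) (E : {set {set 'I_n}}) (k : nat).
Notation V := 'I_n.
Hypothesis n0 : 0 < n.
Notation L := [seq adj E i j | i <- enum 'I_n, j <- enum 'I_n].
Notation B := (Defs.bin k).

Lemma sizeL : size L = n * n.
Proof. by rewrite size_allpairs size_enum_ord. Qed.

Variable s : st.
Hypothesis sV : forall v, vr s v = 0.
Hypothesis sT : forall t i, tr s t i = false.
Hypothesis sI : inp s = pr (nseq n.-1 true ++ false :: L ++ B).

Definition DD : nat :=
  expo readM + expo readK + expo countK + expo degc + expo specc + expo corec + expo searchc.

Lemma load_ok M : n <= M ->
  [/\ base E (ev loadc s), vr (ev loadc s) vNN = (n * n).+1, vr (ev loadc s) vK = minn k n &
     tm loadc s <= 3 * n + 8 + 3 * (M + 3) ^ DD].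
Proof.
move=> nM.
have pw c : expo c <= DD -> (M + 3) ^ expo c <= (M + 3) ^ DD.
  by move=> H; rewrite leq_exp2l // addn3.
rewrite -[ev loadc s]/(ev (If (Get tE 0) countK (Do (Cpy vK vN))) (ev readK (ev (Do (Inc vNN)) (ev (Do (Cpy vNN vPt)) (ev readM
    (ev (Do Adv) (ev (Ones vN) (ev (Do (Inc vN)) s)))))))).
set s1 := ev (Do (Inc vN)) s.
have [V2 I2 T2] := @ones_ok vN s1 n.-1 (L ++ B) sI.
have tm1 : tm (Ones vN) s1 = 3 * n.-1 + 1.
  rewrite /= (_ : inp s = pr (nseq n.-1 true ++ false :: L ++ B)) //.
  have F : find negb (nseq n.-1 true ++ false :: L ++ B) = n.-1 by elim: n.-1 => //= m ->.
  by congr (3 * _ + _); rewrite -[RHS]F /ones; case: (n.-1).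
set s2 := ev (Ones vN) s1 in V2 I2 T2 *; set s3 := ev (Do Adv) s2.
have V3 v : v != vN -> vr s3 v = 0.
  by move=> Hv; rewrite /s3 /s2 /= -/(ev (Ones vN) s1) ev_vr ?mem_seq1 // /s1 /= (negbTE Hv) sV.
have N3 : vr s3 vN = n by rewrite [LHS]V2 /s1 /= sV add1n prednK.
have T3 t i : tr s3 t i = false by rewrite [LHS](congr1 (fun f => f t i) T2) sT.
have I3 : inp s3 = pr (L ++ B) by rewrite (adv_pr I2).
have Q3 : QM L B 0 s3.
  split; rewrite ?V3 ?drop0 ?T3 //; first by rewrite leqNgt size_cat sizeL addn_gt0 muln_gt0 n0.
have [P4 I4 E4 M4 Z4] := readM_ok sizeL N3 Q3.
have tm3 : tm readM s3 <= (M + 3) ^ expo readM.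
  exact: tm_leN N3 nM.
set s4 := ev readM s3 in P4 I4 E4 M4 Z4 *.
have N4 : vr s4 vN = n by rewrite ev_vr.
set s6 := ev (Do (Inc vNN)) _.
have N6 : vr s6 vN = n by [].
have NN6 : vr s6 vNN = (n * n).+1 by rewrite /s6 /= P4.
have Q6 : QK B 0 s6.
  split=> //.
  - by rewrite [LHS]I4 drop_size_cat ?sizeL // drop0.
  - by rewrite [LHS]E4 size_cat sizeL -[X in _ <= X]addn0 leq_add2l.
  - by move=> i; rewrite -[LHS]/(tr (ev readM s3) tKB i) ev_tr // T3.
have [I7 E7 K7 Z7] := readK_ok N6 Q6.
have tm6 : tm readK s6 <= (M + 3) ^ expo readK.
  exact: tm_leN N6 nM.
set s7 := ev readK s6 in I7 E7 K7 Z7 *.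
have N7 : vr s7 vN = n by rewrite ev_vr.
have NN7 : vr s7 vNN = (n * n).+1 by rewrite ev_vr.
have K70 : vr s7 vK = 0 by rewrite ev_vr // -[LHS]/(vr (ev readM s3) vK) ev_vr // V3.
have B7 : base E s7.
  split=> // a b; rewrite ev_tr // -[LHS]/(tr s4 tM (a * n + b)) M4.
  have -> : a * n + b < n * n.
    by apply: leq_trans (_ : a.+1 * n <= _); rewrite ?leq_mul2r ?ltn_ord ?orbT // mulSn addnC ltn_add2r.
  have := @nth_allpairs V V (adj E) (enum V) (enum V) a b a b.
  by rewrite size_enum_ord !nth_ord_enum => ->.
set c8 := If _ _ _.
have [V8 tm8] : vr (ev c8 s7) vK = minn k n /\ tm c8 s7 <= 1 + (M + 3) ^ DD.
  have -> : tm c8 s7 = 1 + (if tr s7 tE (vr s7 0) then tm countK s7 else 1) by [].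
  rewrite leq_add2l /c8 evI [opst (Get _ _) _]/= [opres _ _]/= Z7 E7.
  case: leqP => szB.
    split; last first.
      apply: leq_trans (pw countK _); last by rewrite /DD; lia.
      exact: tm_leN N7 nM.
    rewrite (@countK_ok n s7 (mkseq (nth false B) n)) ?val2_pad ?val2_bin ?size_mkseq //.
      by rewrite ev_tr // -[LHS]/(tr (ev readM s3) tF 0) ev_tr // T3.
    by move=> i; rewrite K7 nth_mkseq // ltn_ord.
  split; last by rewrite expn_gt0 addn3.
  by rewrite /= N7; have := size_bin szB; lia.
split.
- by apply: base_ev.
- by rewrite ev_vr.
- exact: V8.
- have -> : tm loadc s = 1 + (tm (Ones vN) s1 + (1 + (tm readM s3 + (1 + (1 + (tm readK s6 + tm c8 s7)))))) by [].
  rewrite tm1; have R3 := leq_trans tm3 (pw readM ltac:(rewrite /DD; lia)).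
  have R6 := leq_trans tm6 (pw readK ltac:(rewrite /DD; lia)).
  move: (_ ^ DD) (tm readM s3) (tm readK s6) (tm c8 s7) R3 R6 tm8 => x y z w.
  by move: n0; clear; lia.
Qed.

End Final.

End Cost.

(** * The decision procedure and its constants *)

Module Final.
Import Machine Simulation Language Threads Families Core Completeness Programs Counting Evaluation Moves Search Loading Cost.

Section VI.
Variables (n : nat) (E : {set {set 'I_n}}) (k : nat).
Notation V := 'I_n.

(** The first alternative comes from the initial value n of the minimum. *)
Lemma vi_leP : reflect (n <= k \/ exists S : {set V}, #|S| + max_comp E S <= k)
  (vertex_integrity E <= k).
Proof.
rewrite /vertex_integrity; apply: (iffP idP) => [|[H|[S H]]].
- elim/big_rec: _ => [|S x _ IH]; first by left.
  by rewrite geq_min => /orP[H|/IH //]; right; exists S.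
- by apply: leq_trans H; elim/big_rec: _ => // S x _ H; rewrite geq_min H orbT.
- apply: leq_trans H; have : S \in index_enum {set V} by apply: mem_index_enum.
  elim: (index_enum _) => // T r IH; rewrite inE big_cons geq_min => /orP[/eqP <-|/IH ->].
    by rewrite leqnn.
  by rewrite orbT.
Qed.

Lemma max_compP p (S : {set V}) : (max_comp E S <= p) = feasb E p S.
Proof.
apply/bigmax_leqP/forallP => H v; first by apply/implyP => /H.
by move=> Hv; apply: (implyP (H v)).
Qed.

End VI.

Lemma tmS c1 c2 s : tm (c1 ;; c2) s = tm c1 s + tm c2 (ev c1 s). Proof. by []. Qed.

Lemma tmI o c1 c2 s :
  tm (If o c1 c2) s = 1 + (if opres o s then tm c1 (opst o s) else tm c2 (opst o s)).
Proof. by []. Qed.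

Lemma put0 t b s : vr s 0 = 0 -> tr (ev (Do (Put t 0 b)) s) t 0 = b.
Proof. by move=> s0; rewrite /= s0 eqxx. Qed.

Section Main.
Variables (n : nat) (E : {set {set 'I_n}}) (k : nat).
Notation V := 'I_n.
Notation L := [seq adj E i j | i <- enum 'I_n, j <- enum 'I_n].
Hypothesis n0 : 0 < n.
Hypothesis simpleE : simple_graph E.
Hypothesis connE : connected_graph E.
Let x0 : V := Ordinal n0.
Let Y := core E x0.
Variable s : st.
Hypothesis sV : forall v, vr s v = 0.
Hypothesis sT : forall t i, tr s t i = false.
Hypothesis sI : inp s = pr (nseq n.-1 true ++ false :: L ++ Defs.bin k).

Lemma full_ok M : n <= M -> (n * n).+1 <= M -> 2 ^ #|Y| <= M ->
  tr (ev fullc s) tANS 0 = (vertex_integrity E <= k) /\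
  tm fullc s <= (M + 3) ^ (DD + 5).
Proof.
move=> nM nnM YM.
have [B1 NN1 K1 tm1] := load_ok n0 sV sT sI nM.
set s1 := ev loadc s in B1 NN1 K1 *.
have pw c : expo c <= DD -> (M + 3) ^ expo c <= (M + 3) ^ DD.
  by move=> H; rewrite leq_exp2l // addn3.
have T1 t i : t \notin mt loadc -> tr s1 t i = false by move=> Ht; rewrite ev_tr.
have V1 v : v \notin mv loadc -> vr s1 v = 0 by move=> Hv; rewrite ev_vr.
set s2 := ev degc s1.
have D2 : forall a : V, thr3 #|nb E a| s2 a.
  by apply: degc_ok => // t i Ht; apply: T1; move: Ht; rewrite !inE => /or3P[] /eqP ->.
have B2 : base E s2 by apply: base_ev.
have N1 : vr s1 vN = n by case: B1.
have tm2 : tm degc s1 <= (M + 3) ^ DD.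
  by apply: leq_trans (tm_leN _ _ N1 nM) (pw _ _) => //; rewrite /DD; lia.
set s3 := ev specc s2.
have X3 : trk s3 tX (special E x0).
  by apply: specc_ok => // i; rewrite ev_tr // T1.
have B3 : base E s3 by apply: base_ev.
have N2 : vr s2 vN = n by case: B2.
have tm3 : tm specc s2 <= (M + 3) ^ DD.
  by apply: leq_trans (tm_leN _ _ N2 nM) (pw _ _) => //; rewrite /DD; lia.
set s4 := ev corec s3.
have Y4 : trk s4 tY Y by apply: corec_ok.
have B4 : base E s4 by apply: base_ev.
have N3 : vr s3 vN = n by case: B3.
have tm4 : tm corec s3 <= (M + 3) ^ DD.
  by apply: leq_trans (tm_leN _ _ N3 nM) (pw _ _) => //; rewrite /DD; lia.
set s5 := ev powc s4.
have W4 : vr s4 vW = 0 by rewrite 3?ev_vr // V1.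
have W5 : vr s5 vW = 2 ^ #|Y| by apply: (powc_ok B4).
have B5 : base E s5 by apply: base_ev.
have N5 : vr s5 vN = n by case: B5.
have tm5 := powc_tm B4 Y4 W4.
have Y5 : trk s5 tY Y by move=> v; rewrite ev_tr // Y4.
have NN5 : vr s5 vNN = (n * n).+1 by rewrite 4?ev_vr.
have K5 : vr s5 vK = minn k n by rewrite 4?ev_vr.
have A5 : tr s5 tANS 0 = false by rewrite 4?ev_tr // T1.
have s50 : vr s5 0 = 0 by case: B5.
have Kn : (minn k n < n) = (k < n) by rewrite gtn_min ltnn orbF.
have s5E : ev setupc s1 = s5 by rewrite /setupc (evS degc) (evS specc) (evS corec).
have oE : opres (Lt vK vN) s5 = (k < n).
  by rewrite -Kn -K5 -[X in _ = (_ < X)]N5.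
have E5 : ev fullc s = if k < n then ev searchc s5 else ev (Do (Put tANS 0 true)) s5.
  by rewrite /fullc (evS loadc) (evS setupc) -/s1 s5E evI oE.
have tmE : tm fullc s = tm loadc s + (tm degc s1 + (tm specc s2 + (tm corec s3 + tm powc s4)) +
    (1 + (if k < n then tm searchc s5 else 1))).
  rewrite /fullc (tmS loadc) (tmS setupc) -/s1 s5E tmI oE.
  by rewrite /setupc (tmS degc) (tmS specc) (tmS corec).
split.
  rewrite E5; case: ltnP => kn; last first.
    by rewrite put0 //; apply/esym/vi_leP; left.
  have Ck : ctx E Y k false s5.
    split=> //; split=> //; last by rewrite A5.
    by rewrite K5; apply/minn_idPl/ltnW.
  have [Snd Cmp] := searchc_ok simpleE (@core_deg2 _ E x0) (@core_one_port _ E x0)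
    (core_x0 E x0) (connE x0) Ck.
  apply/idP/vi_leP => [/Snd [p [S /andP[HS Hk]]]|[H|[S HS]]].
  - right; exists S; apply: leq_trans Hk; rewrite leq_add2l max_compP //.
  - by move: kn; rewrite ltnNge H.
  - have Hf : feasible E (max_comp E S) S by apply/feasP; rewrite -max_compP.
    apply: (Cmp (max_comp E S) S) => //.
    by apply: leq_ltn_trans kn; apply: leq_trans HS; apply: leq_addl.
have tms : (if k < n then tm searchc s5 else 1) <= (M + 3) ^ DD.
  case: ifP => _; last by rewrite expn_gt0 addn3.
  apply: leq_trans (tm_le (M := M) _ _) (pw _ _) => //.
  have : all (fun v => v \in [:: vN; vW; vNN]) (bnds searchc) by [].
  move=> /allP Hb v /Hb; rewrite !inE => /or3P[] /eqP ->; rewrite ?N5 ?W5 ?NN5 //.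
rewrite tmE (expnD _ DD 5).
move: tm1 tm2 tm3 tm4 tm5 tms nM YM; rewrite -/s1.
have : 0 < (M + 3) ^ DD by rewrite expn_gt0 addn3.
move: (tm loadc s) (tm degc s1) (tm specc s2) (tm corec s3) (tm powc s4) (if _ then _ else _).
move: ((M + 3) ^ DD) (2 ^ #|Y|) => X w a b c d e f X0 H1 H2 H3 H4 H5 H6 nM' wM.
have H5' : e <= 3 + M * (3 * M + 6).
  by apply: leq_trans H5 _; rewrite leq_add2l; apply: leq_mul => //; lia.
have Pm u : u <= u * X by rewrite leq_pmulr.
have Ha : a <= (3 * M + 11) * X.
  rewrite -[11]/(8 + 3) addnA mulnDl; apply: leq_trans H1 _; rewrite leq_add2r.
  by apply: leq_trans (Pm _); rewrite leq_add2r leq_mul2l nM' orbT.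
have He := leq_trans H5' (Pm _).
apply: leq_trans (_ : ((3 * M + 11) + (3 + M * (3 * M + 6)) + 5) * X <= _).
  move: (3 * M + 11) (3 + M * _) Ha He => p q; rewrite !mulnDl.
  move: (p * X) (q * X) => u v; move: H2 H3 H4 H6 X0; clear; lia.
rewrite mulnC leq_mul2l; apply/orP; right.
apply: leq_trans (_ : (M + 3) ^ 3 <= _); last by rewrite leq_exp2l // addn3.
rewrite expnS; apply: leq_trans (_ : 3 * (M + 3) ^ 2 <= _); last by rewrite leq_mul2r leq_addl orbT.
have -> : M * (3 * M + 6) = 3 * (M * M) + 6 * M by rewrite mulnDr mulnCA (mulnC M 6).
have -> : (M + 3) ^ 2 = M * M + 6 * M + 9 by rewrite sqrnD mulnn; lia.
by move: (M * M) => q; lia.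
Qed.

End Main.

Notation K := 28.
Notation B0 := 48.

(** The variables are 0 to 27 and the tracks 28 to 49, so a block has [B0.+2] = 50 cells. *)
Definition mach : TM := machine K B0 (prog tANS fullc).

Lemma wf_fullc : wf K B0 fullc. Proof. by []. Qed.

Lemma encode_pos n (E : {set {set 'I_n}}) k : 0 < n -> exists b r,
  encode E k = [:: true, b & r] /\
  (b, r) = pr (nseq n.-1 true ++ false :: [seq adj E i j | i <- enum 'I_n, j <- enum 'I_n] ++ Defs.bin k).
Proof.
case: n E => // n E _; rewrite /encode [nseq n.+1 _]/= [n.+1.-1]/=.
move: (_ ++ Defs.bin k) => l.
by case: n E => [|m] E; [exists false, l|exists true, (nseq m true ++ false :: l)].
Qed.

(** The machine needs at most (M + 3) ^ e steps with M = 2 ^ #|Y| * (n + 1) ^ 2, and M + 3 <= 2 ^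
    (51 ml) * (n + 1) ^ 4. Raising this to the power e gives the exponents 51 e and 4 e, both at
    most [c]. *)
Lemma mach_correct n (E : {set {set 'I_n}}) k (c := 51 * (2 * (DD + 5) + 6)) :
  simple_graph E -> connected_graph E ->
  exists t : nat,
    t <= 2 ^ (c * max_leaf E) * n.+1 ^ c /\
    (run mach (encode E k) t).1 = (if vertex_integrity E <= k then q_acc mach else q_rej mach).
Proof.
rewrite {}/c; set e := 2 * (DD + 5) + 6 => simpleE connE.
case: (posnP n) => [n0|n0].
  subst n; exists 1; split; first by rewrite muln_gt0 !expn_gt0.
  rewrite -[encode E k]/(false :: [seq adj E i j | i <- enum 'I_0, j <- enum 'I_0] ++ Defs.bin k).
  have -> : vertex_integrity E <= k by apply/vi_leP; left.
  exact: (@run_false K B0 tANS fullc isT isT wf_fullc).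
have [b [r [-> Ebr]]] := encode_pos E k n0.
have [t Ht Hrun] := @run_prog K B0 tANS fullc isT isT isT wf_fullc b r.
pose Y := core E (Ordinal n0).
pose M := 2 ^ #|Y| * n.+1 ^ 2.
have Y1 : 0 < 2 ^ #|Y| by rewrite expn_gt0.
have N1 : n.+1 ^ 2 <= M by rewrite leq_pmull.
have [] := @full_ok n E k n0 simpleE connE (init_st (b, r)) (fun _ => erefl) (fun _ _ => erefl) Ebr M.
- by apply: leq_trans N1; rewrite expnS expn1 mulSn; lia.
- by apply: leq_trans N1; rewrite expnS expn1 mulSn mulnS; lia.
- by rewrite leq_pmulr // expn_gt0.
move=> Ev tmB; exists t; split; last by rewrite Hrun Ev.
have M2 : 4 <= M by apply: leq_trans N1; rewrite -[4]/(2 ^ 2) leq_exp2r.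
have H1 : t <= (M + 3) ^ e.
  (* The two equal factors pay for the quadratic overhead, the last one for the constant 4 * 50 =
     200 <= 5 ^ 4; the exponents add up to [e]. *)
  apply: leq_trans Ht _; apply: leq_trans (_ : (M + 3) ^ (DD + 6) * (M + 3) ^ (DD + 6) * (M + 3) ^ 4 <= _).
    have Hx : tm fullc (init_st (b, r)) + 5 <= (M + 3) ^ (DD + 6).
      rewrite (addnS DD 5) expnS.
      move: tmB; have : 0 < (M + 3) ^ (DD + 5) by rewrite expn_gt0 addn3.
      move: (tm _ _) (_ ^ _) => x y y0 xy; rewrite mulnDl.
      have : 4 * y <= M * y by rewrite leq_mul2r M2 orbT.
      by move: (M * y) => w; lia.
    apply: leq_mul; first exact: leq_mul.
    apply: leq_trans (_ : 5 ^ 4 <= _) => //; by rewrite leq_exp2r //; lia.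
  by rewrite -!expnD leq_exp2l ?addn3 // /e; lia.
apply: leq_trans H1 _.
have H2 : M + 3 <= 2 ^ (51 * max_leaf E) * n.+1 ^ 4.
  apply: leq_trans (_ : 2 * M <= _); first lia.
  have := core_bound simpleE connE (Ordinal n0); rewrite -/Y => HY.
  have H3 : 2 ^ #|Y| <= 2 ^ (51 * max_leaf E) * 2 by rewrite -expnSr leq_exp2l // -addn1.
  rewrite /M mulnA; apply: leq_trans (_ : 2 ^ (51 * max_leaf E) * 2 ^ 2 * n.+1 ^ 2 <= _).
    rewrite leq_mul2r; apply/orP; right; rewrite mulnC -[2 ^ 2]/(2 * 2) mulnA.
    by rewrite leq_mul2r H3 orbT.
  rewrite -mulnA leq_mul2l; apply/orP; right.
  by rewrite (expnD n.+1 2 2) leq_mul2r leq_exp2r // ltnS n0 orbT.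
apply: leq_trans (_ : (2 ^ (51 * max_leaf E) * n.+1 ^ 4) ^ e <= _).
  by rewrite leq_exp2r.
rewrite expnMn -!expnM; apply: leq_mul; first by rewrite leq_exp2l // -mulnA mulnAC -mulnA (mulnC _ e) mulnA.
by rewrite leq_exp2l // leq_mul2r; apply/orP; right.
Qed.

End Final.

(* There is a Turing machine M and a constant c such that on every connected
   simple graph G on n vertices and every integer k, M started on the
   encoding of (G, k) halts within 2^(c * ml(G)) * (n+1)^c steps, in the
   accepting state iff vi(G) <= k and in the rejecting state otherwise. *)
Theorem theorem10 :
  exists (M : TM) (c : nat),
    forall (n : nat) (E : {set {set 'I_n}}) (k : nat),
      simple_graph E -> connected_graph E ->
      exists t : nat,
        t <= 2 ^ (c * max_leaf E) * n.+1 ^ c /\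
        (run M (encode E k) t).1 =
          (if vertex_integrity E <= k then q_acc M else q_rej M).
Proof.
by exists Final.mach, (51 * (2 * (Cost.DD + 5) + 6)) => n E k; apply: Final.mach_correct.
Qed.
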